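(* Consider the following two cases. (a) $-A$ is the generator of a bounded $C_0$-semigroup $(e^{-tA})_{t\ge0}$ on a Hilbert space $H$ such that $A$ is normal. (b) $\Omega$ is a locally compact Hausdorff space, $\mu$ is a $\sigma$-finite regular Borel measure on $\Omega$, and either (i) $X := L^p(\Omega,\mu)$ for some $1\le p<\infty$ and $\phi:\Omega\to\mathbb{C}$ is measurable with essential range in $\mathbb{C}_+$; or (ii) $X := C_0(\Omega)$ and $\phi:\Omega\to\mathbb{C}$ is continuous with range in $\mathbb{C}_+$. The operator $A$ is the multiplication operator induced by $\phi$ on $X$, i.e., $Af=\phi f$ with domain $D(A) := \{f\in X:\phi f\in X\}$. In both cases (a) and (b), assume that $\|e^{-tA}(I+A)^{-1}\| = O(t^{-1/\beta})$ as $t\to\infty$ for some $\beta>0$. Then, for all $\alpha>0$ and $0<\omega_p\le\omega_q<\infty$, there exist constants $M>0$ and $n_0\in\mathbb{N}$ such that $$\left\|\left(\prod_{k=1}^nV_{\omega_k}(A)\right)A^{-\alpha}\right\|\le\frac{M}{n^{\alpha/(2+\beta)}}$$ for all $n\ge n_0$ and all $(\omega_k)_{k\in\mathbb{N}}\in\mathcal{S}(\omega_p,\omega_q)$.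
   Context: All spaces are complex. $\mathbb{C}_+ := \{z\in\mathbb{C}:\operatorname{Re}z>0\}$. $C_0(\Omega)$ is the space of continuous functions on $\Omega$ vanishing at infinity. In case (b), $-A$ generates the bounded $C_0$-semigroup $e^{-tA}f=e^{-t\phi}f$. Under the stated decay assumption $A$ has a bounded inverse, and $A^{-\alpha}$ is the (bounded) fractional power. For $\omega>0$, $V_\omega(A) := (A-\omega I)(A+\omega I)^{-1}$. For $0<\omega_p\le\omega_q<\infty$, $\mathcal{S}(\omega_p,\omega_q)$ is the set of sequences $(\omega_k)_{k\in\mathbb{N}}$ of positive real numbers with $\omega_p\le\omega_k\le\omega_q$ for all $k$. The notation $f(t)=O(g(t))$ as $t\to\infty$ means that $f(t)\le Mg(t)$ for all $t\ge t_1$, for some constants $M>0$ and $t_1$. *)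

(* Defs.v *)
From HB Require Import structures.
From mathcomp Require Import all_boot all_order all_algebra.
From mathcomp Require Import complex.
From mathcomp Require Import all_classical all_reals all_analysis.
From mathcomp Require Import measurable_realfun.

Set Implicit Arguments.
Unset Strict Implicit.
Unset Printing Implicit Defensive.

Import Order.TTheory GRing.Theory Num.Theory.
Import numFieldNormedType.Exports.

Local Open Scope classical_set_scope.
Local Open Scope ring_scope.
Local Open Scope complex_scope.

(* The scalars are R[i] for an arbitrary R : realType.  The norm of a
   normedModType R[i] takes its values in R[i], where z1 <= z2 means that
   z2 - z1 is a nonnegative real; Normc.normc is the modulus with values in R,
   and `|z| = (normc z)%:C on R[i] by definition. *)
Local Notation normc := (@Normc.normc _).

Definition cexp (R : realType) (z : R[i]) : R[i] :=
  (expR (complex.Re z) * cos (complex.Im z)) +i*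
  (expR (complex.Re z) * sin (complex.Im z)).

(* A (possibly unbounded) operator on X is represented by its graph:
   [A x y] means that x is in the domain of A and A x = y. *)
Definition graph (X : Type) := X -> X -> Prop.

Section Graphs.
Variables (R : realType) (X : normedModType R[i]).
Implicit Types (A B : graph X).

Definition op_dom A : set X := [set x | exists y, A x y].

Definition op_fun (f : X -> X) : graph X := fun x y => y = f x.

Definition op_id : graph X := op_fun id.

Definition op_opp A : graph X := fun x y => A x (- y).

(* A + c I *)
Definition op_shift (c : R[i]) A : graph X := fun x y => A x (y - c *: x).

Definition op_inv A : graph X := fun x y => A y x.

(* the product B A, i.e. A is applied first *)
Definition op_mul B A : graph X := fun x z => exists2 y, A x y & B y z.

Definition op_exp A (n : nat) : graph X := iter n (op_mul A) op_id.

(* [B] is everywhere defined and bounded, with norm at most [c] *)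
Definition op_bound B (c : R) : Prop :=
  (forall x, exists! y, B x y) /\
  (forall x y, B x y -> `|y| <= c%:C * `|x|).

(* equal to +oo when B is not an everywhere defined bounded operator *)
Definition opnorm B : \bar R :=
  ereal_inf [set c%:E | c in [set c : R | 0 <= c /\ op_bound B c]].

(* V_omega(A) = (A - omega I) (A + omega I)^-1 *)
Definition cayley (omega : R) A : graph X :=
  op_mul (op_shift (- omega%:C) A) (op_inv (op_shift omega%:C A)).

(* V_{omega_1}(A) V_{omega_2}(A) ... V_{omega_n}(A) *)
Definition cayley_prod (omega : nat -> R) (n : nat) A : graph X :=
  \big[op_mul/op_id]_(1 <= k < n.+1) cayley (omega k) A.

Definition is_riemann_int (F : R -> X) (a b : R) (v : X) : Prop :=
  forall eps : R, 0 < eps -> exists2 delta : R, 0 < delta &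
    forall (n : nat) (s tag : nat -> R),
      s 0%N = a -> s n = b ->
      (forall i, (i < n)%N ->
        [/\ s i <= tag i, tag i <= s i.+1 & s i.+1 - s i < delta]) ->
      `| v - \sum_(i < n) (s i.+1 - s i)%:C *: F (tag i) | < eps%:C.

(* improper Riemann integral over ]0, +oo[ *)
Definition is_int_0y (F : R -> X) (v : X) : Prop :=
  exists2 I : R -> R -> X,
    (forall a b, 0 < a -> a <= b -> is_riemann_int F a b (I a b)) &
    I ab.1 ab.2 @[ab --> (0^'+, +oo)] --> v.

(* Balakrishnan's formula for 0 < theta < 1:
   A^{-theta} x = sin (pi theta) / pi
                  * int_0^oo lambda^{-theta} (lambda I + A)^{-1} x dlambda *)
Definition balakrishnan A (theta : R) : graph X := fun x y =>
  exists F : R -> X, exists2 v : X,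
    (forall lambda, 0 < lambda ->
       op_inv (op_shift lambda%:C A) x (F lambda)) /\
    is_int_0y (fun lambda => (lambda `^ (- theta))%:C *: F lambda) v &
    y = (sin (pi * theta) / pi)%:C *: v.

(* A^{-alpha} = A^{-n} A^{-theta} with n the integer part of alpha > 0 and
   theta its fractional part; A is the negative of the generator of a bounded
   semigroup and is boundedly invertible *)
Definition frac_pow_neg A (alpha : R) : graph X :=
  let n := Num.truncn alpha in
  let theta := alpha - n%:R in
  op_mul (op_exp (op_inv A) n)
         (if theta == 0 then op_id else balakrishnan A theta).

Definition generator (T : R -> X -> X) : graph X := fun x y =>
  (h^-1)%:C *: (T h x - x) @[h --> 0^'+] --> y.

Record bounded_C0_semigroup (T : R -> X -> X) : Prop := BoundedC0Semigroup {
  C0sg_linear : forall t, 0 <= t -> linear (T t) ;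
  C0sg_0 : forall x, T 0 x = x ;
  C0sg_D : forall s t, 0 <= s -> 0 <= t -> forall x, T (s + t) x = T s (T t x) ;
  C0sg_cvg : forall x, T t x @[t --> 0^'+] --> x ;
  C0sg_bounded : exists M : R, forall t, 0 <= t -> forall x,
    `|T t x| <= M%:C * `|x| }.

(* || S(t) (I + A)^{-1} || = O(t^{-1/beta}) as t -> oo *)
Definition decay (S : R -> graph X) A (beta : R) : Prop :=
  exists M t1 : R, 0 < M /\ forall t, t1 <= t ->
    (opnorm (op_mul (S t) (op_inv (op_shift 1%R A)))
       <= (M * t `^ (- beta^-1))%:E)%E.

Definition shifts (omegap omegaq : R) : set (nat -> R) :=
  [set omega | forall k, omegap <= omega k /\ omega k <= omegaq].

Definition cayley_estimate A (beta : R) : Prop :=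
  forall alpha omegap omegaq : R,
    0 < alpha -> 0 < omegap -> omegap <= omegaq ->
  exists (M : R) (n0 : nat), 0 < M /\
    forall n : nat, (n0 <= n)%N ->
    forall omega : nat -> R, shifts omegap omegaq omega ->
      (opnorm (op_mul (cayley_prod omega n A) (frac_pow_neg A alpha))
         <= (M / n%:R `^ (alpha / (2 + beta)))%:E)%E.

End Graphs.

Section Normal.
Variables (R : realType) (H : normedModType R[i]).

(* <., .> is the inner product inducing the norm of H; it is linear in its
   first argument *)
Definition induces_norm (ip : {dot H for @Num.conj R[i]}) : Prop :=
  forall x, ip x x = `|x| ^+ 2.

(* the Hilbert space adjoint, for densely defined A *)
Definition adjoint (ip : {dot H for @Num.conj R[i]}) (A : graph H) : graph H :=
  fun y z => forall x w, A x w -> ip w y = ip x z.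

Definition normal_op (ip : {dot H for @Num.conj R[i]}) (A : graph H) : Prop :=
  [/\ dense (op_dom A),
      closed [set xy : H * H | A xy.1 xy.2] &
      op_mul (adjoint ip A) A = op_mul A (adjoint ip A)].

End Normal.

Definition Cplus (R : realType) : set R[i] := [set z | 0 < complex.Re z].
Arguments Cplus R : clear implicits.

Lemma normc_ge0 (R : realType) (z : R[i]) : 0 <= normc z.
Proof. by case: z => a b; exact: sqrtr_ge0. Qed.

Definition cmeasurable d (Omega : measurableType d) (R : realType)
    (f : Omega -> R[i]) : Prop :=
  measurable_fun [set: Omega] (fun x => complex.Re (f x)) /\
  measurable_fun [set: Omega] (fun x => complex.Im (f x)).

(* L^p(Omega, mu), 1 <= p < oo, as the quotient of the space [cLfun] of
   complex p-integrable functions by the functions vanishing a.e.; it carries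
   the norm (int |f|^p dmu)^(1/p).  The representative of a class u is
   [repr u]. *)
Section Lp_functions.
Context d (Omega : measurableType d) (R : realType).
Variables (mu : {measure set Omega -> \bar R}) (p : R) (p1 : 1 <= p).
Local Notation C := R[i].
Implicit Types (f g : Omega -> C).

Definition cLnorm f : \bar R := 'N[mu]_p%:E[EFin \o (normc \o f)].

Lemma measurable_normc f : cmeasurable f ->
  measurable_fun [set: Omega] (fun x => normc (f x)).
Proof.
move=> [mr mi].
rewrite (_ : (fun x => _) =
  (fun x => Num.sqrt (complex.Re (f x) ^+ 2 + complex.Im (f x) ^+ 2))).
  apply: measurableT_comp; last first.
    by apply: measurable_funD; exact: measurable_funX.
  apply: continuous_measurable_fun; exact: sqrt_continuous.
by apply/funext => x; case: (f x).
Qed.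

Lemma cmeasurable0 : cmeasurable (0 : Omega -> C).
Proof. by split; exact: measurable_cst. Qed.

Lemma cmeasurableD f g : cmeasurable f -> cmeasurable g -> cmeasurable (f + g).
Proof.
move=> [fr fi] [gr gi]; split.
  rewrite (_ : (fun x => _) =
    (fun x => complex.Re (f x)) \+ (fun x => complex.Re (g x))).
    exact: measurable_funD.
  by apply/funext => x /=; rewrite -[(f + g) x]/(f x + g x); case: (f x); case: (g x).
rewrite (_ : (fun x => _) =
  (fun x => complex.Im (f x)) \+ (fun x => complex.Im (g x))).
  exact: measurable_funD.
by apply/funext => x /=; rewrite -[(f + g) x]/(f x + g x); case: (f x); case: (g x).
Qed.

Lemma cmeasurableZ (a : C) f : cmeasurable f -> cmeasurable (a *: f).
Proof.
move=> [fr fi]; case: a => a b; split.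
  rewrite (_ : (fun x => _) =
    (fun x => a * complex.Re (f x)) \- (fun x => b * complex.Im (f x))).
    by apply: measurable_funB; apply: measurable_funM.
  by apply/funext => x; rewrite /= /(_ *: _)/=; case: (f x).
rewrite (_ : (fun x => _) =
  (fun x => a * complex.Im (f x)) \+ (fun x => b * complex.Re (f x))).
  by apply: measurable_funD; apply: measurable_funM.
apply/funext => x; rewrite /= /(_ *: _)/=; case: (f x) => u v.
by rewrite /= [b * u]mulrC.
Qed.

Lemma cLnorm_ge0 f : (0 <= cLnorm f)%E.
Proof. exact: Lnorm_ge0. Qed.

Lemma cLnormE f : cLnorm f =
  poweR (\int[mu]_x ((normc (f x) `^ p)%:E)) p^-1.
Proof.
rewrite /cLnorm unlock /=; congr poweR; apply: eq_integral => x _.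
by rewrite /= ger0_norm// normc_ge0.
Qed.

Lemma measurable_normcX f : cmeasurable f ->
  measurable_fun [set: Omega] (fun x => (normc (f x) `^ p)%:E).
Proof.
move=> mf; apply/measurable_EFinP.
apply: (@measurableT_comp _ _ _ _ _ _ (@powR R ^~ p)) => //.
exact: measurable_normc.
Qed.

Lemma cLnormD f g : cmeasurable f -> cmeasurable g ->
  (cLnorm (f + g)%R <= cLnorm f + cLnorm g)%E.
Proof.
move=> mf mg.
have p0 : 0 <= p by exact: le_trans p1.
have F := @eminkowski _ _ _ mu (fun x => normc (f x)) (fun x => normc (g x)) p%:E.
apply: (le_trans _ (F _ _ _)); rewrite ?lee_fin//; [|exact: measurable_normc..].
rewrite cLnormE unlock /=; apply: gt0_ler_poweR.
- by rewrite invr_ge0.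
- by rewrite in_itv/= leey andbT integral_ge0// => x _; rewrite lee_fin powR_ge0.
- by rewrite in_itv/= leey andbT integral_ge0// => x _; rewrite ?poweR_ge0 ?lee_fin ?powR_ge0.
- apply: ge0_le_integral => //.
  + by move=> x _; rewrite lee_fin powR_ge0.
  + by apply: measurable_normcX; exact: cmeasurableD.
  + apply/measurable_EFinP.
    apply: (@measurableT_comp _ _ _ _ _ _ (@powR R ^~ p)) => //.
    apply: measurableT_comp => //.
    by apply: measurable_funD; exact: measurable_normc.
  + move=> x _; rewrite lee_fin.
    have h : normc (f x + g x) <= normc (f x) + normc (g x) by exact: le_normcD.
    by rewrite ge0_ler_powR ?nnegrE ?normc_ge0// (le_trans h)// ler_norm.
Qed.

Lemma cLnormZ (a : C) f : cmeasurable f ->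
  (cLnorm (a *: f)%R = (normc a)%:E * cLnorm f)%E.
Proof.
move=> mf; rewrite !cLnormE.
have p0 : p != 0 by rewrite gt_eqF// (lt_le_trans _ p1).
under eq_integral => x _.
  rewrite (_ : (a *: f) x = a * f x)// Normc.normcM powRM ?normc_ge0// EFinM.
  over.
rewrite ge0_integralZl//; last 3 first.
- exact: measurable_normcX.
- by move=> x _; rewrite lee_fin powR_ge0.
- by rewrite lee_fin powR_ge0.
rewrite poweRM ?lee_fin ?powR_ge0//; last first.
  by apply: integral_ge0 => x _; rewrite lee_fin powR_ge0.
by rewrite poweR_EFin -powRrM mulfV// powRr1// normc_ge0.
Qed.

Lemma cLnorm0 : cLnorm 0 = 0%E.
Proof.
rewrite /cLnorm (_ : EFin \o _ = cst 0%E) ?Lnorm0//.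
  by rewrite eqe gt_eqF// (lt_le_trans _ p1).
by apply/funext => x /=; congr (_%:E); exact: Normc.normc0.
Qed.

Lemma cLnorm_eq0 f : cmeasurable f -> cLnorm f = 0%E ->
  {ae mu, forall x, f x = 0}.
Proof.
move=> mf /Lnorm_eq0_eq0.
have : measurable_fun [set: Omega] (fun x => (normc (f x))%:E).
  by apply/measurable_EFinP; exact: measurable_normc.
move=> /[swap] /[apply].
rewrite lte_fin (lt_le_trans _ p1)// => /(_ isT).
by apply: filterS => x /(_ I) /= [] /Normc.eq0_normc.
Qed.

Lemma cLnorm_ae0 f : cmeasurable f -> {ae mu, forall x, f x = 0} ->
  cLnorm f = 0%E.
Proof.
move=> mf f0; rewrite cLnormE.
have p0 : 0 < p by exact: lt_le_trans p1.
rewrite (ae_eq_integral (cst 0%E))//=.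
- by rewrite integral0 poweR0r// invr_neq0// gt_eqF.
- exact: measurable_normcX.
- by apply: filterS f0 => x fx _ /=; rewrite fx Normc.normc0 powR0// gt_eqF.
Qed.

Definition cLfun_pred of 1 <= p : {pred Omega -> C} :=
  fun f => `[< cmeasurable f /\ (cLnorm f < +oo)%E >].

Lemma cLfun_submod : submod_closed (cLfun_pred p1).
Proof.
split; first by apply/asboolP; split; [exact: cmeasurable0|rewrite cLnorm0].
move=> a f g /asboolP[mf ff] /asboolP[mg fg]; apply/asboolP.
have mZ := cmeasurableZ a mf.
split; first exact: cmeasurableD.
rewrite (le_lt_trans (cLnormD mZ mg))// lte_add_pinfty// cLnormZ//.
by rewrite lte_mul_pinfty// lee_fin normc_ge0.
Qed.

HB.instance Definition _ :=
  GRing.isSubmodClosed.Build C (Omega -> C) (cLfun_pred p1) cLfun_submod.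

Record cLfun : Type := CLfun {
  cLfun_val :> Omega -> C ; cLfunP : cLfun_val \in cLfun_pred p1 }.
HB.instance Definition _ := [isSub for cLfun_val].
HB.instance Definition _ := [Choice of cLfun by <:].
HB.instance Definition _ := [SubChoice_isSubLmodule of cLfun by <:].

Definition cLnull : {pred cLfun} :=
  fun f : cLfun => `[< {ae mu, forall x, f x = 0} >].

Lemma cLnull_submod : submod_closed cLnull.
Proof.
split; first by apply/asboolP; exact: nearW.
move=> a f g /asboolP f0 /asboolP g0; apply/asboolP.
apply: filterS2 f0 g0 => x /= fx gx.
by rewrite -[_ x]/(a * f x + g x) fx gx mulr0 addr0.
Qed.

HB.instance Definition _ :=
  GRing.isSubmodClosed.Build C cLfun cLnull cLnull_submod.

Definition Lp : Type := Quotient.quot cLnull.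
HB.instance Definition _ := GRing.Zmodule.on Lp.
HB.instance Definition _ := EqQuotient.on Lp.

Local Open Scope quotient_scope.

Lemma Lp_piP (f g : cLfun) :
  \pi_Lp f = \pi_Lp g <-> {ae mu, forall x, f x = g x}.
Proof.
have -> : (\pi_Lp f = \pi_Lp g) <-> (f - g \in cLnull).
  by rewrite Quotient.idealrBE; split => /eqP.
split=> [/asboolP|] fg; [|apply/asboolP]; apply: filterS fg => x /=.
  by move=> /eqP; rewrite subr_eq0 => /eqP.
by move=> fg; apply/eqP; rewrite subr_eq0; apply/eqP.
Qed.

Definition Lp_scale (a : C) (u : Lp) : Lp := \pi_Lp (a *: repr u).

Lemma Lp_scale_pi a (f : cLfun) : Lp_scale a (\pi_Lp f) = \pi_Lp (a *: f).
Proof.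
apply/Lp_piP; have /Lp_piP : \pi_Lp (repr (\pi_Lp f)) = \pi_Lp f by rewrite reprK.
by apply: filterS => x /= e; exact: (congr1 (fun z => a * z) e).
Qed.

Lemma Lp_piD (f g : cLfun) : \pi_Lp (f + g) = \pi_Lp f + \pi_Lp g.
Proof. by rewrite piE. Qed.

Lemma Lp_scaleA a b u : Lp_scale a (Lp_scale b u) = Lp_scale (a * b) u.
Proof. by rewrite -[u]reprK !Lp_scale_pi scalerA reprK. Qed.
Lemma Lp_scale1 : left_id 1 Lp_scale.
Proof. by move=> u; rewrite -[u]reprK Lp_scale_pi scale1r. Qed.
Lemma Lp_scaleDr : right_distributive Lp_scale +%R.
Proof.
move=> a u v; rewrite -[u]reprK -[v]reprK -Lp_piD !Lp_scale_pi -Lp_piD.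
by rewrite scalerDr.
Qed.
Lemma Lp_scaleDl u : {morph Lp_scale^~ u : a b / a + b}.
Proof. by move=> a b; rewrite -[u]reprK !Lp_scale_pi -Lp_piD scalerDl. Qed.

HB.instance Definition _ := GRing.Zmodule_isLmodule.Build C Lp
  Lp_scaleA Lp_scale1 Lp_scaleDr Lp_scaleDl.

Lemma cLfun_cmeasurable (f : cLfun) : cmeasurable f.
Proof. by case: f => f /= /asboolP[]. Qed.

Lemma cLfun_norm_fin (f : cLfun) : cLnorm f \is a fin_num.
Proof.
case: f => f /= /asboolP[_ fo].
by rewrite ge0_fin_numE// cLnorm_ge0.
Qed.

Lemma cLnorm_ae (f g : cLfun) : {ae mu, forall x, f x = g x} ->
  cLnorm f = cLnorm g.
Proof.
have mf := cLfun_cmeasurable f; have mg := cLfun_cmeasurable g.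
move=> fg; rewrite !cLnormE; congr poweR.
apply: ae_eq_integral => //; [exact: measurable_normcX..|].
by apply: filterS fg => x fgx _ /=; rewrite fgx.
Qed.

Definition Lp_norm (u : Lp) : C := (fine (cLnorm (repr u)))%:C.

Lemma Lp_norm_pi (f : cLfun) : Lp_norm (\pi_Lp f) = (fine (cLnorm f))%:C.
Proof.
rewrite /Lp_norm; congr ((fine _)%:C); apply: cLnorm_ae.
by apply/Lp_piP; rewrite reprK.
Qed.

Lemma Lp_ler_normD u v : Lp_norm (u + v) <= Lp_norm u + Lp_norm v.
Proof.
rewrite -[u]reprK -[v]reprK -Lp_piD !Lp_norm_pi -rmorphD lecR.
rewrite -lee_fin EFinD !fineK ?cLfun_norm_fin//.
by apply: cLnormD; exact: cLfun_cmeasurable.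
Qed.

Lemma Lp_normZ a u : Lp_norm (a *: u) = `|a| * Lp_norm u.
Proof.
rewrite -[u]reprK [_ *: _]Lp_scale_pi !Lp_norm_pi.
have -> : `|a| = (normc a)%:C by [].
rewrite -rmorphM; congr (_%:C).
by rewrite cLnormZ ?fineM// ?cLfun_norm_fin//; exact: cLfun_cmeasurable.
Qed.

Lemma Lp_norm0_eq0 u : Lp_norm u = 0 -> u = 0.
Proof.
rewrite -[u]reprK Lp_norm_pi => -[] /eqP; rewrite fine_eq0 ?cLfun_norm_fin//.
move=> /eqP /(cLnorm_eq0 (cLfun_cmeasurable _)) u0.
transitivity (\pi_Lp 0); last by rewrite piE.
exact/Lp_piP.
Qed.

HB.instance Definition _ :=
  Lmodule_isNormed.Build C Lp Lp_ler_normD Lp_normZ Lp_norm0_eq0.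

(* the operator of multiplication by phi, with its maximal domain *)
Definition Lp_mult (phi : Omega -> C) : graph Lp := fun u v =>
  {ae mu, forall x, repr v x = phi x * repr u x}.

Definition ess_range (phi : Omega -> C) : set C :=
  [set z | forall eps : R, 0 < eps ->
    (0 < mu [set x | (normc (phi x - z) < eps)%R])%E].

End Lp_functions.

Notation borel Omega := (g_sigma_algebraType (@open Omega)).

(* Finiteness on compact sets follows for a sigma-finite mu: singletons then
   have finite measure, and by outer regularity so do some neighbourhoods of
   them. *)
Definition regular_measure (Omega : ptopologicalType) (R : realType)
    (mu : {measure set (borel Omega) -> \bar R}) : Prop :=
  forall E : set (borel Omega), measurable E ->
    mu E = ereal_inf [set mu U |
             U in [set U : set Omega | open U /\ E `<=` U]] /\
    mu E = ereal_sup [set mu K |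
             K in [set K : set Omega | compact K /\ K `<=` E]].

Section C0_functions.
Variables (Omega : topologicalType) (R : realType).
Local Notation C := R[i].

Definition vanishes_at_infinity (f : Omega -> C) : Prop :=
  forall eps : R, 0 < eps ->
    exists2 K : set Omega, compact K & forall x, ~ K x -> normc (f x) < eps.

Definition C0_pred : {pred Omega -> C} :=
  fun f => `[< continuous (f : Omega -> C^o) /\ vanishes_at_infinity f >].

Lemma C0_submod : submod_closed C0_pred.
Proof.
split.
  apply/asboolP; split; first exact: cst_continuous.
  by move=> e e0; exists set0 => [|x _]; [exact: compact0|rewrite Normc.normc0].
move=> a f g /asboolP[cf vf] /asboolP[cg vg]; apply/asboolP; split.
  move=> x; apply: (@cvgD _ C^o); last exact: cg.
  by apply: (@cvgZr _ C^o); exact: cf.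
move=> e e0.
have a1 : 0 < normc a + 1 by rewrite ltr_wpDl// normc_ge0.
have e2 : 0 < e / 2 by rewrite divr_gt0.
have [K1 cK1 fK1] := vf _ (divr_gt0 e2 a1).
have [K2 cK2 gK2] := vg _ e2.
exists (K1 `|` K2); first exact: compactU.
move=> x /not_orP[/fK1 fx /gK2 gx].
rewrite [ltRHS]splitr (le_lt_trans (le_normcD _ _))// ler_ltD//.
rewrite -[_ x]/(a * f x) Normc.normcM.
apply: (@le_trans _ _ ((normc a + 1) * normc (f x))).
  by rewrite ler_wpM2r ?normc_ge0// lerDl.
by move: fx; rewrite ltr_pdivlMr// mulrC => /ltW.
Qed.

HB.instance Definition _ :=
  GRing.isSubmodClosed.Build C (Omega -> C) C0_pred C0_submod.

Record C0 : Type := MkC0 { C0_val :> Omega -> C ; C0P : C0_val \in C0_pred }.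
HB.instance Definition _ := [isSub for C0_val].
HB.instance Definition _ := [Choice of C0 by <:].
HB.instance Definition _ := [SubChoice_isSubLmodule of C0 by <:].

Lemma C0_continuous (f : C0) : continuous (f : Omega -> C^o).
Proof. by case: f => f /= /asboolP[]. Qed.

Lemma normcB (z w : C) : `|normc z - normc w| <= normc (z - w).
Proof.
have h (u v : C) : normc u <= normc v + normc (u - v).
  by rewrite -[in leLHS](subrK v u) addrC le_normcD.
rewrite ler_distl h andbT lerBlDr (le_trans (h w z))//.
by rewrite -(normcN (z - w)) opprB.
Qed.

Lemma C0_bounded (f : C0) : exists M, forall x, normc (f x) <= M.
Proof.
have [cf vf] : continuous (f : Omega -> C^o) /\ vanishes_at_infinity f.
  by case: f => f /= /asboolP.
have [K cK fK] := vf 1 ltr01.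
have cn : continuous (fun x => normc (f x) : R^o).
  move=> x; apply/cvgrPdist_lt => e e0.
  have /cvgrPdist_lt /(_ e%:C) := cf x.
  rewrite ltcR => /(_ e0); apply: filterS => y.
  have -> : `|f x - f y| = (normc (f x - f y))%:C by [].
  by rewrite ltcR; apply: le_lt_trans; exact: normcB.
have /compact_bounded[M [_ Mb]] : compact ((fun x => normc (f x) : R^o) @` K).
  by apply: continuous_compact => //; exact: continuous_subspaceT.
exists (Num.max 1 (M + 1)) => x; rewrite le_max.
have [Kx|/fK/ltW->//] := pselect (K x).
apply/orP; right; apply: le_trans (ler_norm _) _.
by apply: (Mb (M + 1)); [rewrite ltrDl|exists x].
Qed.

Definition supnorm (f : Omega -> C) : R := sup [set normc (f x) | x in [set: Omega]].

Lemma C0_supnorm_ub (f : C0) x : normc (f x) <= supnorm f.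
Proof.
apply: ub_le_sup; last by exists x.
by have [M fM] := C0_bounded f; exists M => _ [y _ <-].
Qed.

Lemma supnorm_ge0 (f : C0) : 0 <= supnorm f.
Proof.
have [[x _]|e] := pselect (exists x : Omega, True).
  exact: le_trans (normc_ge0 (f x)) (C0_supnorm_ub f x).
rewrite /supnorm (_ : [set _ | _ in _] = set0) ?sup0//.
by rewrite -subset0 => _ [x _ <-]; apply: e; exists x.
Qed.

Lemma supnorm_le (f : C0) (M : R) : 0 <= M ->
  (forall x, normc (f x) <= M) -> supnorm f <= M.
Proof.
move=> M0 fM; have [[x _]|e] := pselect (exists x : Omega, True).
  by apply: ge_sup => [|_ [y _ <-]//]; exists (normc (f x)), x.
rewrite /supnorm (_ : [set _ | _ in _] = set0) ?sup0//.
by rewrite -subset0 => _ [x _ <-]; apply: e; exists x.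
Qed.

Definition C0_norm (f : C0) : C := (supnorm f)%:C.

Lemma C0_ler_normD f g : C0_norm (f + g) <= C0_norm f + C0_norm g.
Proof.
rewrite -rmorphD lecR; apply: supnorm_le.
  by rewrite addr_ge0 ?supnorm_ge0.
by move=> x; rewrite (le_trans (le_normcD _ _))// lerD ?C0_supnorm_ub.
Qed.

Lemma C0_normZ a f : C0_norm (a *: f) = `|a| * C0_norm f.
Proof.
have le b (g : C0) : supnorm (b *: g : C0) <= normc b * supnorm g.
  apply: supnorm_le; first by rewrite mulr_ge0 ?normc_ge0 ?supnorm_ge0.
  move=> x; rewrite -[_ x]/(b * g x) Normc.normcM.
  by rewrite ler_wpM2l ?normc_ge0 ?C0_supnorm_ub.
have -> : `|a| = (normc a)%:C by [].
rewrite -rmorphM; congr (_%:C); apply/eqP; rewrite eq_le le /=.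
have [->|a0] := eqVneq a 0; first by rewrite Normc.normc0 mul0r; apply: (supnorm_ge0 (0 *: f)).
have na : 0 < normc a.
  by rewrite lt_neqAle normc_ge0 andbT eq_sym; apply: contra a0 => /eqP/Normc.eq0_normc->.
rewrite -ler_pdivlMl// -Normc.normcV.
by have := le a^-1 (a *: f); rewrite scalerA mulVf// scale1r.
Qed.

Lemma C0_norm0_eq0 f : C0_norm f = 0 -> f = 0.
Proof.
move=> -[f0]; apply/val_inj/funext => x /=.
apply: Normc.eq0_normc; apply/eqP; rewrite eq_le normc_ge0 andbT.
by rewrite -f0 C0_supnorm_ub.
Qed.

HB.instance Definition _ :=
  Lmodule_isNormed.Build C C0 C0_ler_normD C0_normZ C0_norm0_eq0.

(* the operator of multiplication by phi, with its maximal domain *)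
Definition C0_mult (phi : Omega -> C) : graph C0 := fun f g =>
  forall x, g x = phi x * f x.

End C0_functions.

(* Main.v *)
(* The decay of e^(-tA) (1 + A)^(-1) confines the spectrum of A to a region
   c <= Re z (1 + |z|)^beta, since |e^(-tz)| <= K t^(-1/beta) |1 + z| there for
   all large t. In this region |(z - w) / (z + w)| <= exp (- k (1 + |z|)^(-2-beta))
   uniformly in w between omega_p and omega_q, so that a product of n Cayley
   factors, divided by |z|, is at most C n^(-1/(2+beta)). An operator form of this
   bound is the case alpha = 1. Cutting a product of n factors into m blocks of
   equal length gives alpha = m, and cutting Balakrishnan's integral at
   lambda = n^(1/(2+beta)) interpolates between consecutive integers.

   For a multiplication operator the scalar bound holds pointwise. For a normal A
   no functional calculus is needed: S = \prod_k V_(omega_k)(A) A^(-1) commutes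
   with its adjoint, hence |Sx|^2 <= |S^2 x| |x|. If the norm of S exceeds K, this
   log-convexity of k |-> |S^k x| makes suitable averages of mu^(-k) S^k x
   approximate eigenvectors of S for some |mu| > K. Up to an invertible factor,
   S - mu is a polynomial in A^(-1); factoring it into linear factors, one of them
   is almost singular, which yields an approximate eigenvalue z of A for which the
   product of the scalar Cayley factors divided by |z| equals |mu|. The scalar
   bound then gives |mu| <= K, a contradiction. A similar argument with
   S = V_w(A) shows that V_w(A) is a contraction. *)

Require Import Defs.
From mathcomp Require Import all_boot all_order all_algebra.
From mathcomp Require Import complex.
From mathcomp Require Import all_classical all_reals all_analysis.
From mathcomp Require Import measurable_realfun.
From mathcomp Require Import ring lra.

Set Implicit Arguments.
Unset Strict Implicit.
Unset Printing Implicit Defensive.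

Import Order.TTheory GRing.Theory Num.Theory.
Import numFieldNormedType.Exports.

Local Open Scope classical_set_scope.
Local Open Scope ring_scope.
Local Open Scope complex_scope.

Local Notation normc := (@Normc.normc _).

(** The difficulty lies at large |z|. On the edge Re z ~ |z|^(-beta) of the region a Cayley factor
    has modulus about 1 - |z|^(-2-beta), so n factors gain nothing until n reaches |z|^(2+beta); at
    that crossover the factor 1/|z| equals n^(-1/(2+beta)). In the normal case the decay hypothesis
    has to be turned into a statement about scalars. If A y is close to z y, then e^(-tA) y is close
    to (1 - t z / n)^n y, and comparison with the decay restricts z. The tolerance in this step
    depends on an upper bound for |z|, so the possible z must be confined to a bounded set before an
    approximate eigenvector is chosen. Moreover mu does not determine z: the equation that links
    them has degree n + 1 in 1/z, and the factorization picks a solution near which A^(-1) really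
    has an approximate eigenvector. All cases meet in one interface: the inverse [J], the resolvents
    [rs], contractive Cayley maps and [word_decay]. The constant in [word_decay] is uniform over
    words, since the block argument applies it to subwords. *)

Section RealNorm.
Variables (R : realType) (X : normedModType R[i]).
Implicit Types x y : X.

(* [`|x|] lives in [R[i]]; [nrm x] is the same number in [R]. *)
Definition nrm x : R := complex.Re `|x|.

Lemma nrmE x : `|x| = (nrm x)%:C.
Proof. by rewrite RRe_real// normr_real. Qed.

Lemma nrm_ge0 x : 0 <= nrm x.
Proof. by have := normr_ge0 x; rewrite nrmE ler0c. Qed.

Lemma nrmD x y : nrm (x + y) <= nrm x + nrm y.
Proof. by have := ler_normD x y; rewrite !nrmE -rmorphD lecR. Qed.

Lemma nrmZ (a : R[i]) x : nrm (a *: x) = normc a * nrm x.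
Proof.
by rewrite /nrm normrZ nrmE /= mul0r subr0.
Qed.

Lemma nrm0 : nrm 0 = 0.
Proof. by rewrite /nrm normr0. Qed.

Lemma nrmN x : nrm (- x) = nrm x.
Proof. by rewrite /nrm normrN. Qed.

Lemma nrmB x y : nrm (x - y) = nrm (y - x).
Proof. by rewrite -nrmN opprB. Qed.

Lemma nrm_eq0 x : (nrm x == 0) = (x == 0).
Proof.
rewrite -[RHS]normr_eq0 nrmE -(inj_eq (@complexI R)); exact: erefl.
Qed.

Lemma nrm_gt0 x : (0 < nrm x) = (x != 0).
Proof. by rewrite lt_def nrm_eq0 nrm_ge0 andbT. Qed.

Lemma nrm_triangle z x y : nrm (x - y) <= nrm (x - z) + nrm (z - y).
Proof. by apply: le_trans (nrmD _ _); rewrite addrA subrK. Qed.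

Lemma nrm_le_add x y : nrm x <= nrm y + nrm (x - y).
Proof. by apply: le_trans (nrmD _ _); rewrite addrC subrK. Qed.

Lemma nrm_sum I (r : seq I) (P : pred I) (F : I -> X) :
  nrm (\sum_(i <- r | P i) F i) <= \sum_(i <- r | P i) nrm (F i).
Proof.
elim/big_rec2 : _ => [|i a b _ h]; first by rewrite nrm0.
by rewrite (le_trans (nrmD _ _))// lerD2l.
Qed.

Lemma nrm_small_eq0 x : (forall e : R, 0 < e -> nrm x <= e) -> x = 0.
Proof.
move=> h; apply/eqP; rewrite -nrm_eq0 eq_le nrm_ge0 andbT.
by apply/ler_addgt0Pl => e /h; rewrite addr0.
Qed.

Definition seq_cvg (u : nat -> X) (l : X) := forall e : R, 0 < e ->
  exists N, forall n, (N <= n)%N -> nrm (u n - l) < e.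

(* Completeness is a property here because [Lp] and [C0] carry no canonical
   [completeNormedModType] structure. *)
Definition seq_complete := forall u : nat -> X,
  (forall e : R, 0 < e -> exists N, forall m n, (N <= m)%N -> (N <= n)%N ->
     nrm (u m - u n) < e) ->
  exists l, seq_cvg u l.

End RealNorm.

Lemma complete_seq_complete (R : realType) (X : completeNormedModType R[i]) :
  seq_complete X.
Proof.
move=> u cu; have : cauchy (u @ \oo).
  apply/cauchy_ballP => e e0.
  have er : e = (complex.Re e)%:C by rewrite RRe_real// gtr0_real.
  have [|N hN] := cu (complex.Re e); first by rewrite -ltcR -er.
  exists ([set u n | n in [set n | (N <= n)%N]], [set u n | n in [set n | (N <= n)%N]]).
    by split; exists N => // n /= Nn; exists n.
  move=> [_ _] /= [[m Nm <-] [n Nn <-]].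
  by rewrite -ball_normE /ball_/= er nrmE ltcR hN.
move=> /cauchy_cvg /cvg_ex[l /= ul]; exists l => e e0.
have /cvgrPdist_lt/(_ e%:C) := ul.
rewrite ltcR => /(_ e0)[N _ hN]; exists N => n /hN/=.
by rewrite nrmE ltcR nrmB.
Qed.

(** * Scalar estimates *)

Section Scalar.
Variable R : realType.
Implicit Types (z : R[i]) (K beta c : R).

Lemma normc_gt0 z : (0 < normc z) = (z != 0).
Proof.
rewrite lt_def normc_ge0 andbT; apply/idP/idP; apply: contra => /eqP.
  by move=> ->; rewrite Normc.normc0.
by move/Normc.eq0_normc => ->.
Qed.

Lemma normc_ge_absRe z : `|complex.Re z| <= normc z.
Proof. by rewrite -lecR; exact: normc_ge_Re. Qed.

Lemma normc_real (r : R) : normc r%:C = `|r|.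
Proof. by rewrite /= expr0n/= addr0 sqrtr_sqr. Qed.

Lemma normc_sqr z : normc z ^+ 2 = complex.Re z ^+ 2 + complex.Im z ^+ 2.
Proof. by case: z => a b /=; rewrite sqr_sqrtr// addr_ge0// sqr_ge0. Qed.

Lemma ReD z1 z2 : complex.Re (z1 + z2) = complex.Re z1 + complex.Re z2.
Proof. by case: z1 => a b; case: z2. Qed.

Lemma ImD z1 z2 : complex.Im (z1 + z2) = complex.Im z1 + complex.Im z2.
Proof. by case: z1 => a b; case: z2. Qed.

(* [t] is [s `^ beta] up to constants. *)
Lemma decay_time K (t1 : R) beta : 0 < K -> 0 < beta ->
  exists2 c : R, 0 < c & forall s : R, 1 <= s -> exists t : nat,
    [/\ (0 < t)%N, t1 <= t%:R, K * t%:R `^ (- beta^-1) * s <= 8^-1 &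
        t%:R * c <= s `^ beta].
Proof.
move=> K0 b0.
pose c1 := Num.max 1 (Num.max t1 ((8 * K) `^ beta)).
have c11 : 1 <= c1 by rewrite le_max lexx.
have c1t : t1 <= c1 by rewrite !le_max lexx orbT.
have c1K : (8 * K) `^ beta <= c1 by rewrite !le_max lexx !orbT.
have c10 : 0 < c1 by rewrite (lt_le_trans _ c11).
exists (c1 + 1)^-1; first by rewrite invr_gt0 addr_gt0.
move=> s s1.
have s0 : 0 < s by rewrite (lt_le_trans _ s1).
have sb1 : 1 <= s `^ beta by rewrite -[leLHS](powRr0 s) ler_powR// ltW.
exists (Num.truncn (c1 * s `^ beta)).+1.
set t := (_.+1)%:R.
have tge : c1 * s `^ beta <= t by exact/ltW/truncnS_gt.
have tc1 : c1 <= t by apply: le_trans tge; rewrite ler_peMr// ltW.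
have t0 : 0 < t by exact: lt_le_trans tc1.
split => //.
- exact: le_trans tc1.
- have : t `^ (- beta^-1) <= (c1 * s `^ beta) `^ (- beta^-1).
    rewrite !powRN lef_pV2 ?posrE ?powR_gt0 ?mulr_gt0 ?powR_gt0//.
    by rewrite ge0_ler_powR ?nnegrE ?invr_ge0 ?mulr_ge0 ?powR_ge0// ltW.
  rewrite powRM ?powR_ge0 ?(ltW c10)// -powRrM mulrN mulfV ?gt_eqF// => h.
  apply: (@le_trans _ _ (K * (c1 `^ (- beta^-1) * s `^ -1) * s)).
    by rewrite ler_wpM2r ?(ltW s0)// ler_wpM2l ?(ltW K0).
  rewrite powR_inv1 ?(ltW s0)// -!mulrA mulVf ?gt_eqF// mulr1.
  rewrite powRN ler_pdivrMr ?powR_gt0//.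
  have /(ge0_ler_powR _) : (8 * K) `^ beta <= c1 by [].
  move=> /(_ beta^-1); rewrite invr_ge0 ltW// => /(_ isT).
  rewrite !nnegrE powR_ge0 ltW// => /(_ isT isT).
  rewrite -powRrM mulfV ?gt_eqF// powRr1 ?mulr_ge0// ?(ltW K0)// => hh.
  by rewrite mulrC ler_pdivlMr// mulrC.
- rewrite ler_pdivrMr ?addr_gt0// mulrC.
  apply: (@le_trans _ _ (c1 * s `^ beta + 1)).
    by rewrite /t -natr1 lerD2r truncn_le// mulr_ge0 ?powR_ge0 ?ltW.
  by rewrite mulrDl mul1r lerD2l.
Qed.

(** For real w, |z + w|^2 - |z - w|^2 = 4 w Re z. *)
Lemma cayley_factor z (w : R) : 0 < complex.Re z -> 0 < w ->
  normc ((z - w%:C) / (z + w%:C)) ^+ 2 =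
  1 - 4 * complex.Re z * w / normc (z + w%:C) ^+ 2.
Proof.
move=> a0 w0.
have n0 : normc (z + w%:C) ^+ 2 != 0.
  rewrite gt_eqF// exprn_gt0// normc_gt0; case: z a0 => a b /= a0.
  by apply/eqP => -[/eqP]; rewrite gt_eqF// addr_gt0.
rewrite Normc.normcM Normc.normcV expr_div_n.
apply: (mulIf n0); rewrite divfK// mulrBl mul1r divfK//.
rewrite !normc_sqr; case: z {n0} a0 => a b /= a0; ring.
Qed.

(** The region stays away from 0: if |z| <= 1, then c <= |z| 2^beta. Hence |z| is comparable to 1 +
    |z| on it. *)
Lemma region_lower_bound c beta : 0 < c -> 0 < beta ->
  exists2 d : R, 0 < d & forall z, 0 < complex.Re z ->
    c <= complex.Re z * (1 + normc z) `^ beta -> d * (1 + normc z) <= normc z.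
Proof.
move=> c0 b0; pose m := Num.min 1 (c / 2 `^ beta).
have m0 : 0 < m by rewrite lt_min ltr01 divr_gt0 ?powR_gt0.
exists (m / 2); first by rewrite divr_gt0.
move=> z a0 h; have m1 : m <= 1 by rewrite ge_min lexx.
have n0 := normc_ge0 z.
suff : m <= normc z by move=> mz; nra.
have [z1|/ltW z1] := leP (normc z) 1; last exact: le_trans z1.
apply: (@le_trans _ _ (c / 2 `^ beta)); first by rewrite ge_min lexx orbT.
rewrite ler_pdivrMr ?powR_gt0//; apply: (le_trans h).
have az : complex.Re z <= normc z by rewrite (le_trans (ler_norm _))// normc_ge_absRe.
apply: ler_pM => //; [exact: ltW|exact: powR_ge0|].
by rewrite ge0_ler_powR ?nnegrE ?addr_ge0// ?(ltW b0)//; lra.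
Qed.

(** In [cayley_factor], Re z >= c (1 + |z|)^(-beta) while |z + w|^2 is at most of order (1 + |z|)^2,
    which produces the exponent -2-beta; then 1 - x <= exp (-x). *)
Lemma cayley_factor_le c beta (p q : R) : 0 < c -> 0 < beta -> 0 < p -> p <= q ->
  exists2 k : R, 0 < k & forall z w, 0 < complex.Re z ->
    c <= complex.Re z * (1 + normc z) `^ beta -> p <= w <= q ->
  normc ((z - w%:C) / (z + w%:C)) <= expR (- (k * (1 + normc z) `^ (- (2 + beta)))).
Proof.
move=> c0 b0 p0 pq; pose m := Num.max 1 q.
have m1 : 1 <= m by rewrite le_max lexx.
have qm : q <= m by rewrite le_max lexx orbT.
have m0 : 0 < m by lra.
have k0 : 0 < 2 * c * p / m ^+ 2 by rewrite !(mulr_gt0,invr_gt0,exprn_gt0).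
exists (2 * c * p / m ^+ 2) => //.
move=> z w a0 h /andP[pw wq].
have w0 : 0 < w by lra.
set s := 1 + normc z.
have s1 : 1 <= s by rewrite lerDl normc_ge0.
have s0 : 0 < s by lra.
set D := normc (z + w%:C).
have Ds : D <= m * s.
  apply: (le_trans (le_normcD _ _)); rewrite normc_real gtr0_norm// /s.
  by have := normc_ge0 z; nra.
have D0 : 0 < D.
  rewrite normc_gt0; apply/eqP => /(congr1 (@complex.Re _)) /=.
  by rewrite ReD /= => e; lra.
rewrite -(@ler_pXn2r _ 2)// ?nnegrE ?normc_ge0 ?expR_ge0//.
rewrite cayley_factor// -expRM_natl.
apply: (le_trans _ (expR_ge1Dx _)); rewrite lerD2l lerNl.
set Y := s `^ beta in h.
have Y0 : 0 < Y by rewrite powR_gt0.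
have -> : s `^ (- (2 + beta)) = (s ^+ 2 * Y)^-1.
  rewrite powRN powRD; last by rewrite (gt_eqF s0) implybT.
  by rewrite -[2]/(2%:R) powR_mulrn// ltW.
have D2 : D ^+ 2 <= m ^+ 2 * s ^+ 2.
  by rewrite -exprMn ler_pXn2r// nnegrE ?mulr_ge0 ?ltW.
have -> : - (2 * - (2 * c * p / m ^+ 2 * (s ^+ 2 * Y)^-1))
  = 4 * c * p / Y / (m ^+ 2 * s ^+ 2).
  by field; rewrite !gt_eqF.
rewrite -/D.
apply: (@le_trans _ _ (4 * c * p / Y / D ^+ 2)).
  rewrite ler_wpM2l//; first by rewrite ltW// !(mulr_gt0,invr_gt0).
  by rewrite lef_pV2// posrE ?mulr_gt0 ?exprn_gt0.
rewrite ler_wpM2r ?invr_ge0 ?exprn_ge0 ?(ltW D0)//.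
rewrite ler_pdivrMr//; nra.
Qed.

(** With x = (1 + |z|)^(-2-beta), g = 1/(2+beta) and u = n x, the product is at most exp (-k u) <=
    1/(1 + k u), and 1/|z| is at most a multiple of x^g = u^g n^(-g). The function u^g/(1 + k u) is
    bounded because u^g <= 1 + u. *)
Lemma cayley_pointwise c beta (p q : R) : 0 < c -> 0 < beta -> 0 < p -> p <= q ->
  exists2 C : R, 0 < C & forall z (s : seq R), 0 < complex.Re z ->
    c <= complex.Re z * (1 + normc z) `^ beta ->
    (0 < size s)%N -> all (fun w => p <= w <= q) s ->
  (\prod_(w <- s) normc ((z - w%:C) / (z + w%:C))) / normc z <=
    C * (size s)%:R `^ (- (2 + beta)^-1).
Proof.
move=> c0 b0 p0 pq.
have [d d0 dP] := region_lower_bound c0 b0.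
have [k k0 kP] := cayley_factor_le c0 b0 p0 pq.
exists (d^-1 * (1 + k^-1)); first by rewrite mulr_gt0 ?invr_gt0 ?addr_gt0 ?invr_gt0.
move=> z s a0 h s0 /allP sP.
set g := (2 + beta)^-1; set S := 1 + normc z.
have b2 : 0 < 2 + beta by lra.
have g0 : 0 < g by rewrite invr_gt0.
have g1 : g <= 1 by rewrite invf_le1//; lra.
have S0 : 0 < S by have := normc_ge0 z; rewrite /S; lra.
have dS : d * S <= normc z by exact: dP.
have nz : 0 < normc z by apply: lt_le_trans dS; exact: mulr_gt0.
set x := S `^ (- (2 + beta)).
have x0 : 0 < x by exact: powR_gt0.
set n := size s in s0 *.
have n0 : 0 < n%:R :> R by rewrite ltr0n.
have prodle : \prod_(w <- s) normc ((z - w%:C) / (z + w%:C)) <= (1 + k * (n%:R * x))^-1.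
  apply: (@le_trans _ _ (\prod_(w <- s) expR (- (k * x)))).
    rewrite big_seq [leRHS]big_seq; apply: ler_prod => w ws.
    by rewrite normc_ge0 kP// sP.
  rewrite big_const_seq count_predT iter_mulr_1 -expRM_natl mulrN expRN.
  rewrite lef_pV2 ?posrE ?expR_gt0 ?addr_gt0 ?mulr_gt0//.
  by rewrite (le_trans _ (expR_ge1Dx _))// mulrCA.
have inv_nz : (normc z)^-1 <= d^-1 * x `^ g.
  rewrite -powRrM mulNr mulfV ?gt_eqF// powR_inv1 ?(ltW S0)// -invfM.
  by rewrite lef_pV2// posrE// mulr_gt0.
have xg : x `^ g = (n%:R * x) `^ g * n%:R `^ (- g).
  rewrite powRM ?(ltW n0) ?(ltW x0)// mulrAC -powRD ?subrr ?eqxx// ?powRr0 ?mul1r//.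
  by rewrite gt_eqF ?implybT.
set u := n%:R * x in prodle xg.
have u0 : 0 < u by rewrite mulr_gt0.
have ug : u `^ g <= 1 + u.
  have [u1|u1] := leP u 1.
    apply: (@le_trans _ _ 1); last by lra.
    suff : u `^ g <= 1 `^ g by rewrite powR1.
    by rewrite ge0_ler_powR ?nnegrE ?(ltW u0) ?(ltW g0).
  apply: (@le_trans _ _ u); last by lra.
  by rewrite -[leRHS]powRr1 ?ler_powR ?(ltW u0) ?(ltW u1).
apply: (@le_trans _ _ ((1 + k * u)^-1 * (d^-1 * ((1 + u) * n%:R `^ (- g))))).
  apply: ler_pM => //.
  - by apply: prodr_ge0 => w _; exact: normc_ge0.
  - by rewrite invr_ge0 ltW.
  - apply: (le_trans inv_nz); rewrite xg.
    by rewrite ler_wpM2l ?invr_ge0 ?(ltW d0)// ler_wpM2r ?powR_ge0.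
rewrite [leLHS]mulrCA mulrA -[leLHS]mulrA -!mulrA.
rewrite ler_wpM2l ?invr_ge0 ?(ltW d0)// mulrA ler_wpM2r ?powR_ge0//.
rewrite mulrC ler_pdivrMr; last by rewrite addr_gt0 ?mulr_gt0.
have kk : k^-1 * k = 1 by rewrite mulVf ?gt_eqF.
have k1 : 0 < k^-1 by rewrite invr_gt0.
have : 0 < k * u by exact: mulr_gt0.
have -> : (1 + k^-1) * (1 + k * u) = 1 + k^-1 + k * u + (k^-1 * k) * u by ring.
by rewrite kk; lra.
Qed.

End Scalar.

(** * Riemann integrals of vector-valued functions *)

Section Primitive.
Variables (R : realType) (X : normedModType R[i]).
Hypothesis complX : seq_complete X.
Variable F : R -> X.
Hypothesis F_lip : forall a : R, 0 < a -> exists2 L : R, 0 <= L &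
  forall s t, a <= s -> a <= t -> nrm (F s - F t) <= L * `|s - t|.

(* The primitive is the limit of the Riemann sums [D n] on the grids [d n * nat],
   which are exactly additive in the interval. *)
Let d (n : nat) : R := n.+1%:R^-1.
Let fl n (t : R) := Num.truncn (t * n.+1%:R).
Let D n (s t : R) : X := \sum_(fl n s <= k < fl n t) (d n)%:C *: F (k%:R * d n).

Let d_gt0 n : 0 < d n.
Proof. by rewrite invr_gt0 ltr0n. Qed.

Let fl_le n (t : R) : 0 <= t -> (fl n t)%:R * d n <= t.
Proof. by move=> t0; rewrite ler_pdivrMr ?ltr0n// truncn_le mulr_ge0. Qed.

Let fl_gt n t : t - d n < (fl n t)%:R * d n.
Proof.
rewrite ltrBlDr -[X in _ + X]mul1r -mulrDl natr1 ltr_pdivlMr ?ltr0n//.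
exact: truncnS_gt.
Qed.

Let fl_mono n (s t : R) : 0 <= s -> s <= t -> (fl n s <= fl n t)%N.
Proof. by move=> s0 st; apply: le_truncn; rewrite ler_wpM2r. Qed.

Let D_cat n (r s t : R) : 0 <= r -> r <= s -> s <= t -> D n r t = D n r s + D n s t.
Proof.
move=> r0 rs st; rewrite /D (@big_cat_nat _ _ _ (fl n s))//= fl_mono//.
exact: le_trans rs.
Qed.

(** The first error term comes from replacing the values of [F] at the grid points by [F tau]. The
    second arises because the grid steps counted in the sum have total length t - s only up to
    [d n]. *)
Lemma grid_sum_approx (a : R) : 0 < a -> exists2 L : R, 0 <= L &
  forall n (s tau t : R), d n <= a / 2 -> a <= s -> s <= tau -> tau <= t ->
  nrm (D n s t - (t - s)%:C *: F tau) <= L * (t - s + d n) ^+ 2 + d n * nrm (F tau).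
Proof.
(* The first grid point may precede s by up to [d n <= a / 2]. *)
move=> a0; have [|L L0 FL] := F_lip (a := a / 2); first by rewrite divr_gt0.
exists L => // n s tau t dn as_ stau taut.
have s0 : 0 <= s by lra. have t0 : 0 <= t by lra.
have st : s <= t by lra.
have dn0 := d_gt0 n.
set m := (fl n t - fl n s)%N.
have mE : m%:R * d n = (fl n t)%:R * d n - (fl n s)%:R * d n.
  by rewrite natrB ?mulrBl// fl_mono.
have h1 := fl_le n s0; have h2 := fl_le n t0.
have h3 := fl_gt n s; have h4 := fl_gt n t.
rewrite (_ : _ - _ = (\sum_(fl n s <= k < fl n t) (d n)%:C *: (F (k%:R * d n) - F tau))
   + (m%:R * d n - (t - s))%:C *: F tau); last first.
  under eq_bigr do rewrite scalerBr.
  rewrite sumrB -/(D n s t) sumr_const_nat -/m -scaler_nat scalerA.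
  rewrite [(m%:R * d n - _)%:C]rmorphB scalerBl addrA.
  rewrite rmorphM rmorph_nat.
  by rewrite subrK.
apply: (le_trans (nrmD _ _)); apply: lerD; last first.
  by rewrite nrmZ normc_real ler_wpM2r ?nrm_ge0// ler_norml; apply/andP; split; lra.
apply: (le_trans (nrm_sum _ _ _)).
apply: (@le_trans _ _ (\sum_(fl n s <= k < fl n t) d n * (L * (t - s + d n)))).
  apply: ler_sum_nat => k /andP[sk kt].
  rewrite nrmZ normc_real gtr0_norm// ler_wpM2l ?(ltW dn0)//.
  have k1 : (fl n s)%:R * d n <= k%:R * d n by rewrite ler_wpM2r ?ler_nat// ltW.
  have k2 : k%:R * d n <= (fl n t)%:R * d n.
    by rewrite ler_wpM2r ?(ltW dn0)// ler_nat ltnW.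
  apply: (le_trans (FL _ _ _ _)); [lra|lra|].
  by rewrite ler_wpM2l// ler_norml; apply/andP; split; lra.
rewrite sumr_const_nat -/m -mulr_natl mulrA mE.
rewrite mulrCA ler_wpM2l// expr2 ler_wpM2r//; lra.
Qed.

Let d_small (e : R) : 0 < e -> exists N, forall n, (N <= n)%N -> d n < e.
Proof.
move=> e0; exists (Num.truncn e^-1) => n Nn.
rewrite invf_plt ?posrE ?ltr0n//.
by rewrite (lt_le_trans (truncnS_gt _))// ler_nat ltnS.
Qed.

(** Both grid sums are compared with one Riemann sum on a coarser partition into N steps of length
    h. First N is chosen to control the quadratic errors, then the mesh of the grid relative to
    N. *)
Lemma grid_sum_cauchy (s t : R) : 0 < s -> s <= t -> forall e : R, 0 < e ->
  exists N, forall m n, (N <= m)%N -> (N <= n)%N -> nrm (D m s t - D n s t) < e.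
Proof.
move=> s0 st e e0; have [L L0 DL] := grid_sum_approx s0.
have [L' L'0 FL] := F_lip s0.
pose B := nrm (F s) + L' * (t - s).
have B0 : 0 <= B by rewrite addr_ge0 ?nrm_ge0// mulr_ge0// subr_ge0.
have FB u : s <= u -> u <= t -> nrm (F u) <= B.
  move=> su ut; apply: (le_trans (nrm_le_add _ (F s))); rewrite lerD2l.
  apply: (le_trans (FL _ _ _ _)) => //.
  by rewrite ler_wpM2l// ler_norml; apply/andP; split; lra.
(* Chosen so that N L (2h)^2 = 4 L (t - s)^2 / N is less than e/4; later [d n < h]. *)
pose N := (Num.truncn (16 * L * (t - s) ^+ 2 / e)).+1.
have N0 : 0 < N%:R :> R by rewrite ltr0n.
have NL : 16 * L * (t - s) ^+ 2 / e < N%:R by exact: truncnS_gt.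
pose h := (t - s) / N%:R.
have h0 : 0 <= h by rewrite divr_ge0// subr_ge0.
pose u k := s + k%:R * h.
have u_mono k : u k <= u k.+1 by rewrite /u lerD2l ler_wpM2r// ler_nat.
have su k : s <= u k by rewrite /u lerDl mulr_ge0.
have ut k : (k <= N)%N -> u k <= t.
  move=> kN; rewrite /u -lerBrDl /h mulrA ler_pdivrMr// mulrC.
  by rewrite ler_wpM2l ?subr_ge0// ler_nat.
have uN : u N = t by rewrite /u /h; field; rewrite gt_eqF.
pose M := \sum_(k < N) h%:C *: F (u k).
have approx n : d n <= s / 2 ->
    nrm (D n s t - M) <= N%:R * (L * (h + d n) ^+ 2 + d n * B).
  move=> dn; have : forall k, (k <= N)%N ->
      nrm (D n s (u k) - \sum_(i < k) h%:C *: F (u i))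
      <= k%:R * (L * (h + d n) ^+ 2 + d n * B).
    elim=> [_|k IH kN].
      by rewrite /u mul0r addr0 /D big_geq// big_ord0 subr0 nrm0 mul0r.
    rewrite big_ord_recr/= (D_cat n (ltW s0) (su k) (u_mono k)).
    rewrite opprD addrACA (le_trans (nrmD _ _))// -natr1 mulrDl mul1r lerD//.
      by rewrite IH// ltnW.
    have hE : u k.+1 - u k = h by rewrite /u -natr1; ring.
    rewrite -hE (le_trans (DL n (u k) (u k) (u k.+1) dn _ _ _))//.
    by rewrite lerD2l ler_wpM2l ?FB ?ut 1?ltnW// ltW.
  by move=> /(_ N (leqnn _)); rewrite uN.
have eh : N%:R * (L * (h + h) ^+ 2) < e / 4.
  rewrite (_ : _ * _ = 4 * L * (t - s) ^+ 2 / N%:R); last first.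
    by rewrite /h; field; rewrite gt_eqF.
  by rewrite ltr_pdivrMr//; move: NL; rewrite ltr_pdivrMr//; lra.
have [h_eq0|h_neq0] := eqVneq h 0.
  have ts : t = s by rewrite -uN /u h_eq0 mulr0 addr0.
  by exists 0%N => m n _ _; rewrite ts /D !big_geq// subrr nrm0.
have h_gt0 : 0 < h by rewrite lt_def h_neq0.
have NB : 0 < e / 4 / (N%:R * (B + 1)).
  by rewrite !divr_gt0// mulr_gt0//; lra.
have [N1 N1P] := d_small NB.
have [N2 N2P] := d_small h_gt0.
have [|N3 N3P] := @d_small (s / 2); first by rewrite divr_gt0.
exists (maxn N1 (maxn N2 N3)).
have main n : (maxn N1 (maxn N2 N3) <= n)%N -> nrm (D n s t - M) < e / 2.
  rewrite !geq_max => /andP[/N1P nN1 /andP[/N2P nN2 /N3P nN3]].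
  have dn0 := d_gt0 n.
  apply: (le_lt_trans (approx _ (ltW nN3))).
  rewrite [X in _ < X](_ : e / 2 = e / 4 + e / 4); last by field.
  rewrite mulrDr; apply: ler_ltD.
    apply: le_trans (ltW eh); rewrite ler_wpM2l ?(ltW N0)// ler_wpM2l//.
    by rewrite ler_pXn2r ?nnegrE ?addr_ge0 ?(ltW dn0)// lerD2l ltW.
  move: nN1; rewrite ltr_pdivlMr; last by rewrite mulr_gt0//; lra.
  apply: le_lt_trans; rewrite mulrCA ler_wpM2l ?(ltW dn0)// ler_wpM2l ?(ltW N0)//.
  lra.
move=> m n /main hm /main hn; apply: (le_lt_trans (nrm_triangle M _ _)).
by rewrite [nrm (M - _)]nrmB; lra.
Qed.

(** The grid sums are exactly additive, so the differences of [u t] and [u s] are grid sums over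
    [s, t]; [grid_sum_approx] survives the limit and its terms in [d n] vanish. *)
Lemma primitive_exists : exists G : R -> X, forall a : R, 0 < a ->
  exists2 L : R, 0 <= L & forall s tau t : R, a <= s -> s <= tau -> tau <= t ->
    nrm (G t - G s - (t - s)%:C *: F tau) <= L * (t - s) ^+ 2.
Proof.
(* The base point is 1 because nothing is known about [F] at 0. *)
pose u t n := if 1 <= t then D n 1 t else - D n t 1.
have /choice[G GP] : forall t : R, exists l, 0 < t -> seq_cvg (u t) l.
  move=> t; have [t0|] := ltP 0 t; last by exists 0.
  suff /complX[l ul] : forall e : R, 0 < e -> exists N, forall m n,
      (N <= m)%N -> (N <= n)%N -> nrm (u t m - u t n) < e by exists l.
  rewrite /u; have [t1|/ltW t1] := leP 1 t; first exact: grid_sum_cauchy.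
  move=> e e0; have [N NP] := grid_sum_cauchy t0 t1 e0; exists N => m n Nm Nn.
  by rewrite -opprD nrmN NP.
exists G => a a0; have [L L0 DL] := grid_sum_approx a0.
exists L => // s tau t as_ stau taut.
have s0 : 0 < s by lra.
have t0 : 0 < t by lra.
have uD n : u t n - u s n = D n s t.
  rewrite /u; have [s1|/ltW s1] := leP 1 s; have [t1|/ltW t1] := leP 1 t.
  - by rewrite (@D_cat n 1 s t) ?ler01//; [rewrite addrC addKr|lra].
  - have -> : t = 1 by lra.
    have -> : s = 1 by lra.
    by rewrite /D big_geq// subr0 oppr0.
  - by rewrite (@D_cat n s 1 t) ?opprK 1?addrC//; lra.
  - by rewrite (@D_cat n s t 1) ?(ltW s0)//; [rewrite opprK addrC addrK|lra].
apply/ler_addgt0Pl => e e0.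
pose w := t - s; have w0 : 0 <= w by rewrite subr_ge0; lra.
have c0 : 0 < L * (2 * w + 1) + nrm (F tau) + 1.
  by rewrite ltr_wpDl// addr_ge0 ?nrm_ge0// mulr_ge0//; lra.
have e40 : 0 < e / 4 by lra.
have [N1 N1P] := GP t t0 _ e40.
have [N2 N2P] := GP s s0 _ e40.
have [|N3 N3P] := @d_small (Num.min 1 (Num.min (a / 2) (e / 2 / (L * (2 * w + 1) + nrm (F tau) + 1)))).
  by rewrite !lt_min ltr01 !divr_gt0.
pose n := maxn N1 (maxn N2 N3).
have nN1 : (N1 <= n)%N by rewrite leq_maxl.
have nN2 : (N2 <= n)%N by rewrite /n maxnCA leq_maxl.
have nN3 : (N3 <= n)%N by rewrite /n maxnA leq_maxr.
have := N3P n nN3; rewrite !lt_min => /and3P[d1 da de].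
have dn0 := d_gt0 n.
have A := DL n s tau t (ltW da) as_ stau taut.
have B1 := N1P n nN1; have B2 := N2P n nN2.
rewrite (_ : G t - G s - _ = (G t - u t n) - (G s - u s n) + (D n s t - (t - s)%:C *: F tau)); last first.
  rewrite -uD -[in LHS](subrK (u t n) (G t)) -[in LHS](subrK (u s n) (G s)).
  by rewrite [- (G s - u s n + u s n)]opprD addrACA !addrA.
rewrite (le_trans (nrmD _ _))// (le_trans (lerD (nrmD _ _) A))// nrmN.
rewrite [nrm (G t - _)]nrmB [nrm (G s - _)]nrmB -/w.
have : d n * (L * (2 * w + 1) + nrm (F tau) + 1) < e / 2 by rewrite -ltr_pdivlMr.
have : L * (w + d n) ^+ 2 <= L * w ^+ 2 + d n * (L * (2 * w + 1)).
  rewrite (_ : L * w ^+ 2 + _ = L * (w ^+ 2 + d n * (2 * w + 1))); last by ring.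
  by rewrite ler_wpM2l//; nra.
lra.
Qed.

End Primitive.

Section LinearMaps.
Variables (R : realType) (X : normedModType R[i]) (S : X -> X).
Hypothesis S_lin : linear S.

Lemma linD x y : S (x + y) = S x + S y.
Proof. by have := S_lin 1 x y; rewrite !scale1r. Qed.

Lemma lin0 : S 0 = 0.
Proof. by apply: (addrI (S 0)); rewrite -linD !addr0. Qed.

Lemma linZ a x : S (a *: x) = a *: S x.
Proof. by have := S_lin a x 0; rewrite !addr0 lin0 addr0. Qed.

Lemma linN x : S (- x) = - S x.
Proof. by rewrite -scaleN1r linZ scaleN1r. Qed.

Lemma linB x y : S (x - y) = S x - S y.
Proof. by rewrite linD linN. Qed.

Lemma lin_sum I (r : seq I) (P : pred I) (F : I -> X) :
  S (\sum_(i <- r | P i) F i) = \sum_(i <- r | P i) S (F i).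
Proof. by apply: big_morph; [exact: linD|exact: lin0]. Qed.

End LinearMaps.

Section RiemannIntegral.
Variables (R : realType) (X : normedModType R[i]).
Implicit Types (F : R -> X) (a b : R).

Lemma partition_ge (a : R) n (s tag : nat -> R) : s 0%N = a ->
  (forall i, (i < n)%N -> s i <= tag i /\ tag i <= s i.+1) ->
  forall i, (i <= n)%N -> a <= s i.
Proof.
move=> s0 st; elim=> [_|i IH ni]; first by rewrite s0.
by have [h1 h2] := st i ni; rewrite (le_trans (IH (ltnW ni)))// (le_trans h1).
Qed.

(** Local errors that are quadratic in the step add up to at most L times the mesh times b - a. *)
Lemma primitive_riemann F (G : R -> X) a b (L : R) : 0 <= L ->
  (forall s tau t : R, a <= s -> s <= tau -> tau <= t ->
    nrm (G t - G s - (t - s)%:C *: F tau) <= L * (t - s) ^+ 2) ->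
  is_riemann_int F a b (G b - G a).
Proof.
move=> L0 GL eps e0.
have c0 : 0 < L * `|b - a| + 1 by rewrite ltr_wpDl// mulr_ge0.
exists (eps / (L * `|b - a| + 1)); first by rewrite divr_gt0.
move=> n s tag sa sb st.
set dl := eps / _ in st *.
have dl0 : 0 < dl by rewrite divr_gt0.
have as_ : forall i, (i <= n)%N -> a <= s i.
  by apply: (partition_ge sa (tag := tag)) => i /st[].
have ab : a <= b by rewrite -sb as_.
have tel (V : zmodType) (g : nat -> V) : g n - g 0%N = \sum_(i < n) (g i.+1 - g i).
  by rewrite -(big_mkord xpredT (fun i => g i.+1 - g i)) telescope_sumr.
rewrite nrmE ltcR.
have -> : G b - G a = \sum_(i < n) (G (s i.+1) - G (s i)).
  by rewrite -(tel _ (fun i => G (s i))) sa sb.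
rewrite -sumrB (le_lt_trans (nrm_sum _ _ _))//.
apply: (@le_lt_trans _ _ (\sum_(i < n) (L * dl) * (s i.+1 - s i))).
  apply: ler_sum => i _; have [h1 h2 h3] := st i (ltn_ord i).
  rewrite (le_trans (GL _ _ _ _ _ _))// ?as_ 1?ltnW//.
  rewrite expr2 mulrA ler_wpM2r ?subr_ge0 ?(le_trans h1)//.
  by rewrite ler_wpM2l// ltW.
rewrite -mulr_sumr -(tel _ s) sa sb.
have : dl * (L * `|b - a| + 1) = eps by rewrite divfK// gt_eqF.
rewrite ger0_norm ?subr_ge0//; nra.
Qed.

Lemma riemann_linear F (S : X -> X) (c : R) a b v : linear S -> 0 <= c ->
  (forall x, nrm (S x) <= c * nrm x) ->
  is_riemann_int F a b v -> is_riemann_int (S \o F) a b (S v).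
Proof.
move=> lS c0 Sc Fv eps e0.
have [|dl dl0 dP] := Fv (eps / (c + 1)); first by rewrite divr_gt0//; lra.
exists dl => // n s tag sa sb st.
have := dP n s tag sa sb st; rewrite !nrmE !ltcR => h.
rewrite (_ : _ - _ = S (v - \sum_(i < n) (s i.+1 - s i)%:C *: F (tag i))); last first.
  by rewrite (linB lS) (lin_sum lS); congr (_ - _); apply: eq_bigr => i _; rewrite (linZ lS).
rewrite (le_lt_trans (Sc _))//; move: h; rewrite ltr_pdivlMr; last by lra.
have := nrm_ge0 (v - \sum_(i < n) (s i.+1 - s i)%:C *: F (tag i)).
by nra.
Qed.

Lemma uniform_partition a b (dl : R) : a <= b -> 0 < dl ->
  exists (s : nat -> R) (n : nat), [/\ s 0%N = a, s n = b,
    forall i, s i <= s i.+1 & forall i, s i.+1 - s i < dl].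
Proof.
move=> ab d0; pose n := (Num.truncn ((b - a) / dl)).+1.
have n0 : 0 < n%:R :> R by rewrite ltr0n.
have nb : (b - a) / dl < n%:R by exact: truncnS_gt.
pose s i := a + i%:R * ((b - a) / n%:R).
have sS i : s i.+1 - s i = (b - a) / n%:R by rewrite /s -natr1; ring.
exists s, n; split.
- by rewrite /s mul0r addr0.
- by rewrite /s; field; rewrite gt_eqF.
- by move=> i; rewrite -subr_ge0 sS divr_ge0// subr_ge0.
- by move=> i; rewrite sS; move: nb; rewrite ltr_pdivrMr// ltr_pdivrMr// mulrC.
Qed.

(** [H] plays the part of a primitive of a bound for |F|. Comparing increments at right end points
    avoids any scalar integral. *)
Lemma riemann_norm_le F (H : R -> R) a b v : a <= b ->
  is_riemann_int F a b v ->
  (forall l r : R, a <= l -> l <= r -> nrm (F r) * (r - l) <= H r - H l) ->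
  nrm v <= H b - H a.
Proof.
move=> ab Fv FH; apply/ler_addgt0Pl => e e0.
have [dl dl0 dP] := Fv _ e0.
have [s [n [s0 sn sm sd]]] := uniform_partition ab dl0.
have := dP n s (fun i => s i.+1) s0 sn _; rewrite nrmE ltcR => vs.
have {}vs := vs (fun i _ => And3 (sm i) (lexx _) (sd i)).
have as_ i : a <= s i by elim: i => [|i IH]; [rewrite s0|exact: le_trans (sm i)].
rewrite (le_trans (nrm_le_add _ (\sum_(i < n) (s i.+1 - s i)%:C *: F (s i.+1))))//.
rewrite addrC lerD ?(ltW vs)// (le_trans (nrm_sum _ _ _))//.
have -> : H b - H a = \sum_(i < n) (H (s i.+1) - H (s i)).
  rewrite -(big_mkord xpredT (fun i => H (s i.+1) - H (s i))).
  by rewrite telescope_sumr// s0 sn.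
apply: ler_sum => i _; rewrite nrmZ normc_real ger0_norm ?subr_ge0// mulrC.
exact: FH.
Qed.

Lemma riemann_unique F a b v w : a <= b ->
  is_riemann_int F a b v -> is_riemann_int F a b w -> v = w.
Proof.
move=> ab Fv Fw; apply/eqP; rewrite -subr_eq0; apply/eqP/nrm_small_eq0 => e e0.
have e2 : 0 < e / 2 by lra.
have [d1 d10 dP1] := Fv _ e2; have [d2 d20 dP2] := Fw _ e2.
pose d := Num.min d1 d2.
have d0 : 0 < d by rewrite lt_min d10.
have [s [n [s0 sn sm sd]]] := uniform_partition ab d0.
have md i : s i.+1 - s i < d1 /\ s i.+1 - s i < d2.
  by apply/andP; have := sd i; rewrite lt_min.
have := dP1 n s s s0 sn _; have := dP2 n s s s0 sn _.
rewrite !nrmE !ltcR => h2 h1.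
apply: (le_trans (nrm_triangle (\sum_(i < n) (s i.+1 - s i)%:C *: F (s i)) _ _)).
rewrite [X in _ + X]nrmB [leRHS](splitr e); apply: lerD; apply: ltW.
  by apply: h1 => i _; split => //; case: (md i).
by apply: h2 => i _; split => //; case: (md i).
Qed.

Lemma eq_riemann F F' a b v : (forall t, a <= t -> F t = F' t) ->
  is_riemann_int F a b v -> is_riemann_int F' a b v.
Proof.
move=> FF' Fv e /Fv[d d0 dP]; exists d => // n s tag sa sb st.
have := dP n s tag sa sb st; congr (`|_ - _| < _); apply: eq_bigr => i _.
have as_ : forall i, (i <= n)%N -> a <= s i.
  by apply: (partition_ge sa (tag := tag)) => j /st[].
have [h _ _] := st i (ltn_ord i).
by rewrite FF'// (le_trans _ h)// as_// ltnW.
Qed.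

End RiemannIntegral.

(** * Fractional powers *)

Section PowerInequalities.
Variable R : realType.
Implicit Types (u th l r : R).

Lemma ln_leB1 u : 0 < u -> ln u <= u - 1.
Proof.
by move=> u0; have := @le_ln1Dx R (u - 1); rewrite [1 + _]addrC subrK; apply; lra.
Qed.

(** A convex function lies above its tangent at 1. *)
Lemma powRN_ge_tangent u th : 0 < u -> 0 <= th -> 1 - th * (u - 1) <= u `^ (- th).
Proof.
move=> u0 th0; rewrite /powR gt_eqF// mulNr (le_trans _ (expR_ge1Dx _))//.
by rewrite lerD2l lerN2 ler_wpM2l// ln_leB1.
Qed.

(** Concavity of u^th, obtained as Young's inequality for u^th and 1 with exponents 1/th and 1/(1 -
    th). *)
Lemma powR_le_tangent u th : 0 <= u -> 0 < th -> th < 1 -> u `^ th <= 1 + th * (u - 1).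
Proof.
move=> u0 th0 th1; have th1' : 0 < 1 - th by lra.
have := @conjugate_powR R (u `^ th) 1 th^-1 (1 - th)^-1 (powR_ge0 _ _) ler01.
rewrite !invr_gt0 !invrK => /(_ th0 th1'); rewrite addrC subrK => /(_ erefl).
rewrite mulr1 -powRrM mulfV ?gt_eqF// powRr1// powR1; lra.
Qed.

Lemma powRD1 l th : 0 < l -> l `^ (1 - th) = l * l `^ (- th).
Proof.
by move=> l0; rewrite powRD ?(gt_eqF l0) ?implybT// powRr1// ltW.
Qed.

(** The right-hand side is the integral of the decreasing function t^(-th) over [l, r]. Dividing by
    a power of r reduces the claim to the tangent inequality at l/r. This and the next lemma supply
    the function [H] of [riemann_norm_le] at the two ends of Balakrishnan's integral. *)
Lemma powR_increment_small l r th : 0 < th -> th < 1 -> 0 <= l -> l <= r -> 0 < r ->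
  r `^ (- th) * (r - l) <= (r `^ (1 - th) - l `^ (1 - th)) / (1 - th).
Proof.
move=> th0 th1 l0 lr r0; have th1' : 0 < 1 - th by lra.
have th2' : 1 - th < 1 by lra.
have lr0 : 0 <= l / r by rewrite divr_ge0// ltW.
have := powR_le_tangent lr0 th1' th2'.
have -> : l `^ (1 - th) = (l / r) `^ (1 - th) * r `^ (1 - th).
  by rewrite -powRM ?divfK ?gt_eqF// ltW.
rewrite (powRD1 th r0); have rt : 0 < r `^ (- th) by rewrite powR_gt0.
rewrite ler_pdivlMr// => h.
have -> : r `^ (- th) * (r - l) * (1 - th) =
  r * r `^ (- th) - (1 + (1 - th) * (l / r - 1)) * (r * r `^ (- th)).
  by field; rewrite gt_eqF.
by rewrite lerB// ler_wpM2r// mulr_ge0// ltW.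
Qed.

Lemma powR_increment_large l r th : 0 < th -> 0 < l -> l <= r ->
  r `^ (- th) / r * (r - l) <= (l `^ (- th) - r `^ (- th)) / th.
Proof.
move=> th0 l0 lr; have r0 : 0 < r by lra.
have lr0 : 0 < l / r by rewrite divr_gt0.
have := powRN_ge_tangent lr0 (ltW th0).
have -> : l `^ (- th) = (l / r) `^ (- th) * r `^ (- th).
  by rewrite -powRM ?divfK ?gt_eqF// ltW.
have rt : 0 < r `^ (- th) by rewrite powR_gt0.
rewrite ler_pdivlMr// => h.
have -> : r `^ (- th) / r * (r - l) * th =
  (1 - th * (l / r - 1)) * r `^ (- th) - r `^ (- th).
  by field; rewrite gt_eqF.
by rewrite lerB// ler_wpM2r// ltW.
Qed.

Lemma powR_decrement l r th : 0 < th -> 0 < l -> l <= r ->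
  l `^ (- th) - r `^ (- th) <= th * (l `^ (- th) / l) * (r - l).
Proof.
move=> th0 l0 lr; have r0 : 0 < r by lra.
have lr0 : 0 < r / l by rewrite divr_gt0.
have := powRN_ge_tangent lr0 (ltW th0).
have -> : r `^ (- th) = (r / l) `^ (- th) * l `^ (- th).
  by rewrite -powRM ?divfK ?gt_eqF// ltW.
have rt : 0 < l `^ (- th) by rewrite powR_gt0.
move=> h.
have -> : th * (l `^ (- th) / l) * (r - l) =
  l `^ (- th) - (1 - th * (r / l - 1)) * l `^ (- th).
  by field; rewrite gt_eqF.
by rewrite lerB// ler_wpM2r// ltW.
Qed.

Lemma powR_lipschitz (a s t : R) th : 0 < th -> 0 < a -> a <= s -> a <= t ->
  `|s `^ (- th) - t `^ (- th)| <= th * (a `^ (- th) / a) * `|s - t|.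
Proof.
move=> th0 a0; wlog st : s t / s <= t.
  move=> H as_ at_; have [st|/ltW st] := leP s t; first exact: H.
  by rewrite distrC [`|s - t|]distrC; apply: H.
move=> as_ at_; have s0 : 0 < s by lra.
have ge : t `^ (- th) <= s `^ (- th).
  rewrite !powRN lef_pV2 ?posrE ?powR_gt0//; [|lra].
  by rewrite ge0_ler_powR ?nnegrE//; lra.
rewrite ger0_norm ?subr_ge0// distrC ger0_norm ?subr_ge0//.
apply: (le_trans (powR_decrement th0 s0 st)).
rewrite ler_wpM2r ?subr_ge0// ler_wpM2l ?(ltW th0)//.
apply: ler_pM; rewrite ?powR_ge0 ?invr_ge0 ?(ltW s0)//.
  rewrite !powRN lef_pV2 ?posrE ?powR_gt0//.
  by rewrite ge0_ler_powR ?nnegrE//; lra.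
by rewrite lef_pV2// posrE.
Qed.

End PowerInequalities.

Section NearZeroInfinity.
Variables (R : realType) (X : normedModType R[i]).

Lemma near_0y (I : R -> R -> X) v :
  I ab.1 ab.2 @[ab --> (0^'+, +oo)] --> v -> forall e : R, 0 < e ->
  \forall ab \near (0^'+ , +oo) , [/\ 0 < ab.1, ab.1 <= ab.2 :> R & nrm (I ab.1 ab.2 - v) < e].
Proof.
move=> /cvgrPdist_lt Iv e e0.
have /Iv : 0 < e%:C by rewrite ltcR.
have H : \forall ab \near (0^'+ , +oo), 0 < ab.1 /\ (ab.1 <= ab.2 :> R).
  exists ([set a | 0 < a < 1], [set b | 1 < b]) => /=; last first.
    by move=> [a b] /= [/andP[a0 a1] b1]; split => //; lra.
  split; last exact: nbhs_pinfty_gt.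
  near=> a; apply/andP; split; near: a; first exact: nbhs_right_gt.
  exact: nbhs_right_lt.
move: H; apply: filterS2 => ab [h1 h2] h3; split => //.
by move: h3; rewrite nrmE ltcR nrmB.
Unshelve. all: by end_near.
Qed.

Lemma cvg_0y (I : R -> R -> X) v :
  (forall e : R, 0 < e -> exists2 d : R, 0 < d & forall a b : R, 0 < a -> a < d ->
     d^-1 < b -> nrm (I a b - v) < e) ->
  I ab.1 ab.2 @[ab --> (0^'+, +oo)] --> v.
Proof.
move=> H; apply/cvgrPdist_lt => e e0.
have er : e = (complex.Re e)%:C by rewrite RRe_real// gtr0_real.
have [|d d0 dP] := H (complex.Re e); first by rewrite -ltcR -er.
exists ([set a | 0 < a < d], [set b | d^-1 < b]) => /=; last first.
  by move=> [a b] /= [/andP[a0 a1] b1]; rewrite er nrmE ltcR nrmB; exact: dP.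
split; last by apply: nbhs_pinfty_gt; rewrite num_real.
near=> a; apply/andP; split; near: a; first exact: nbhs_right_gt.
exact: nbhs_right_lt.
Unshelve. all: by end_near.
Qed.

Lemma near_0y_ex (P Q : R * R -> Prop) :
  (\forall ab \near (0^'+, +oo), P ab) -> (\forall ab \near (0^'+, +oo), Q ab) ->
  exists ab, P ab /\ Q ab.
Proof.
move=> [[P1 P2] /= [hP1 hP2] PP] [[Q1 Q2] /= [hQ1 hQ2] QQ].
have /filter_ex[a [aP aQ]] : (0 : R)^'+ (P1 `&` Q1) by exact: filterI.
have /filter_ex[b [bP bQ]] : (+oo%R : set_system R) (P2 `&` Q2) by exact: filterI.
by exists (a, b); split; [exact: PP|exact: QQ].
Qed.

End NearZeroInfinity.

(** * Resolvents, Balakrishnan's integral, and the passage from alpha = 1 to all alpha *)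

Section Resolvent.
Variables (R : realType) (X : normedModType R[i]).
Hypothesis complX : seq_complete X.
(* [J] is the inverse of [A] and [rs l] is the inverse of [A + l]. *)
Variables (A : graph X) (J : X -> X) (rs : R -> X -> X) (C : R).
Hypothesis AJ : forall x y, A y x <-> y = J x.
Hypothesis J_lin : linear J.
Hypothesis A_rs : forall (l : R) x y, 0 < l -> A y (x - l%:C *: y) <-> y = rs l x.
Hypothesis rs_le : forall (l : R) x, 0 < l -> nrm (rs l x) <= C / l * nrm x.
Hypothesis rs_leJ : forall (l : R) x, 0 < l -> nrm (rs l x) <= C * nrm (J x).
Hypothesis C_ge0 : 0 <= C.

(** The resolvent at x is the only solution of y = J (x - l y). Linearity, commutation with [J] and
    the resolvent identity all follow from this equation, without domain considerations. *)
Lemma rsE l x : 0 < l -> rs l x = J (x - l%:C *: rs l x).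
Proof. by move=> l0; apply/AJ/(A_rs _ _ l0). Qed.

Lemma rs_unique l x y : 0 < l -> y = J (x - l%:C *: y) -> y = rs l x.
Proof. by move=> l0 e; apply/(A_rs _ _ l0)/AJ. Qed.

Lemma rs_comm (S : X -> X) l x : linear S -> (forall x, S (J x) = J (S x)) ->
  0 < l -> S (rs l x) = rs l (S x).
Proof.
move=> lS SJ l0; apply: rs_unique => //.
by rewrite {1}rsE// SJ (linB lS) (linZ lS).
Qed.

Lemma rs_linear l : 0 < l -> linear (rs l).
Proof.
move=> l0 a x y; apply/esym/rs_unique => //.
rewrite {1}(rsE x l0) {1}(rsE y l0) -J_lin; congr J.
by rewrite scalerBr addrACA -opprD [in RHS]scalerDr !scalerA [a * _]mulrC.
Qed.

Lemma rs_sub l m x : 0 < l -> 0 < m ->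
  rs l x - rs m x = (m - l)%:C *: rs l (rs m x).
Proof.
move=> l0 m0; set u := rs m x; set w := rs l u.
suff -> : rs l x = u + (m - l)%:C *: w by rewrite addrC addKr.
apply/esym/rs_unique => //; have uE := rsE x m0; have wE := rsE u l0.
transitivity (J (x - m%:C *: u) + (m - l)%:C *: J (u - l%:C *: w)).
  by rewrite -uE -wE.
rewrite -(linZ J_lin) -(linD J_lin); congr J.
set c := (m - l)%:C; have -> : m%:C = c + l%:C by rewrite -rmorphD subrK.
rewrite scalerDl opprD scalerBr scalerDr opprD !scalerA [c * _]mulrC !addrA.
by congr (_ - _); rewrite addrAC subrK.
Qed.

Let F th x (l : R) : X := (l `^ (- th))%:C *: rs l x.

Lemma integrand_lip th x : 0 < th -> forall a : R, 0 < a -> exists2 L : R, 0 <= L &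
  forall s t, a <= s -> a <= t -> nrm (F th x s - F th x t) <= L * `|s - t|.
Proof.
move=> th0 a a0.
have Ca : 0 <= C / a by rewrite divr_ge0// ltW.
have rsa l y : a <= l -> nrm (rs l y) <= C / a * nrm y.
  move=> al; have l0 : 0 < l by lra.
  apply: (le_trans (rs_le _ l0)); rewrite ler_wpM2r ?nrm_ge0// ler_wpM2l//.
  by rewrite lef_pV2.
exists (a `^ (- th) * (C / a * (C / a * nrm x)) + th * (a `^ (- th) / a) * (C / a * nrm x)).
  have := nrm_ge0 x; have := powR_ge0 a (- th).
  by move=> h1 h2; rewrite addr_ge0// !mulr_ge0// ?invr_ge0 ltW.
move=> s t as_ at_; have s0 : 0 < s by lra. have t0 : 0 < t by lra.
have -> : F th x s - F th x t = (s `^ (- th))%:C *: (rs s x - rs t x) +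
    (s `^ (- th) - t `^ (- th))%:C *: rs t x.
  by rewrite /F rmorphB scalerBr scalerBl addrA subrK.
rewrite (le_trans (nrmD _ _))// !nrmZ !normc_real mulrDl; apply: lerD.
  rewrite rs_sub// nrmZ normc_real distrC mulrCA mulrC ler_wpM2r//.
  rewrite ger0_norm ?powR_ge0//; apply: ler_pM; rewrite ?powR_ge0 ?nrm_ge0//.
    rewrite !powRN lef_pV2 ?posrE ?powR_gt0//.
    by rewrite ge0_ler_powR ?nnegrE//; lra.
  by apply: (le_trans (rsa _ _ as_)); rewrite ler_wpM2l// rsa.
rewrite [leRHS]mulrAC; apply: ler_pM; rewrite ?nrm_ge0 ?rsa//.
exact: powR_lipschitz.
Qed.

(** Near 0 the resolvent is bounded by C |J x|, so the integrand is of size l^(-th), integrable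
    because th < 1. *)
Lemma integral_norm_small th x a b v : 0 < th -> th < 1 -> 0 < a -> a <= b ->
  is_riemann_int (F th x) a b v ->
  nrm v <= C * nrm (J x) / (1 - th) * (b `^ (1 - th) - a `^ (1 - th)).
Proof.
move=> th0 th1 a0 ab Fv.
pose H t := C * nrm (J x) / (1 - th) * t `^ (1 - th).
rewrite mulrBr; apply: (riemann_norm_le (H := H)) Fv _ => // l r al lr.
have r0 : 0 < r by lra.
rewrite /F nrmZ normc_real ger0_norm ?powR_ge0// /H -mulrBr.
have := @powR_increment_small R l r th th0 th1 _ lr r0.
have l0 : 0 <= l by lra.
move=> /(_ l0) h; rewrite mulrAC -[leRHS]mulrA [_^-1 * _]mulrC.
rewrite [leRHS]mulrC; apply: ler_pM => //; rewrite ?nrm_ge0// ?rs_leJ//.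
by rewrite mulr_ge0 ?powR_ge0// subr_ge0.
Qed.

(** Near infinity the bound C/l on the resolvent makes the integrand of size l^(-th-1), integrable
    because th > 0. *)
Lemma integral_norm_large th x a b v : 0 < th -> 0 < a -> a <= b ->
  is_riemann_int (F th x) a b v ->
  nrm v <= C * nrm x / th * (a `^ (- th) - b `^ (- th)).
Proof.
move=> th0 a0 ab Fv.
pose H t := - (C * nrm x / th * t `^ (- th)).
rewrite mulrBr addrC -[X in _ + X]opprK.
apply: (riemann_norm_le (H := H)) Fv _ => // l r al lr.
have r0 : 0 < r by lra. have l0 : 0 < l by lra.
rewrite /F nrmZ normc_real ger0_norm ?powR_ge0// /H opprK [leRHS]addrC -mulrBr.
have h := powR_increment_large th0 l0 lr.
apply: (@le_trans _ _ (r `^ (- th) * (C / r * nrm x) * (r - l))).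
  by rewrite ler_wpM2r ?subr_ge0// ler_wpM2l ?powR_ge0// rs_le.
have -> : r `^ (- th) * (C / r * nrm x) * (r - l) = C * nrm x * (r `^ (- th) / r * (r - l)).
  by ring.
by rewrite -[leRHS]mulrA [_^-1 * _]mulrC ler_wpM2l// mulr_ge0// nrm_ge0.
Qed.

Lemma antiderivative th x : 0 < th -> exists G : R -> X, forall a b : R,
  0 < a -> a <= b -> is_riemann_int (F th x) a b (G b - G a).
Proof.
move=> th0; have [G GP] := primitive_exists complX (integrand_lip x th0).
exists G => a b a0 ab; have [L L0 LP] := GP a a0.
exact: primitive_riemann L0 LP.
Qed.

Lemma powR_arbitrarily_small (k e p : R) : 0 <= k -> 0 < e -> 0 < p ->
  exists2 d : R, 0 < d & forall a : R, 0 <= a -> a < d -> k * a `^ p < e.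
Proof.
move=> k0 e0 p0; have c0 : 0 < e / (k + 1) by rewrite divr_gt0//; lra.
exists ((e / (k + 1)) `^ p^-1) => [|a a0 ad]; first by rewrite powR_gt0.
have := gt0_ltr_powR p0 a0 (powR_ge0 _ _) ad.
rewrite -powRrM mulVf ?gt_eqF// powRr1 ?(ltW c0)// ltr_pdivlMr; last by lra.
by have := powR_ge0 a p; nra.
Qed.

(** By the two bounds above, a primitive is Cauchy at 0 and at infinity; the integral is the
    difference of its limits there. *)
Lemma balakrishnan_integral th x : 0 < th -> th < 1 ->
  exists v, is_int_0y (F th x) v.
Proof.
move=> th0 th1; have th1' : 0 < 1 - th by lra.
have [G GP] := antiderivative x th0.
pose K1 := C * nrm (J x) / (1 - th); pose K2 := C * nrm x / th.
have K10 : 0 <= K1 by rewrite /K1 divr_ge0 ?mulr_ge0 ?nrm_ge0// ltW.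
have K20 : 0 <= K2 by rewrite /K2 divr_ge0 ?mulr_ge0 ?nrm_ge0// ltW.
have G0 a b : 0 < a -> a <= b -> nrm (G b - G a) <= K1 * b `^ (1 - th).
  move=> a0 ab; apply: (le_trans (integral_norm_small th0 th1 a0 ab (GP _ _ a0 ab))).
  by rewrite -/K1 ler_wpM2l// gerBl powR_ge0.
have Goo a b : 0 < a -> a <= b -> nrm (G b - G a) <= K2 * (a^-1) `^ th.
  move=> a0 ab; apply: (le_trans (integral_norm_large th0 a0 ab (GP _ _ a0 ab))).
  rewrite -/K2 ler_wpM2l// -powR_inv1 ?(ltW a0)// -powRrM mulN1r.
  by rewrite gerBl powR_ge0.
have inv0 n : 0 < (n.+1%:R : R)^-1 by rewrite invr_gt0 ltr0n.
have invle m n : (m <= n)%N -> (n.+1%:R : R)^-1 <= m.+1%:R^-1.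
  by move=> mn; rewrite lef_pV2 ?posrE ?ltr0n// ler_nat.
have invsmall (d : R) : 0 < d -> exists N, forall n, (N <= n)%N -> (n.+1%:R : R)^-1 < d.
  move=> d0; exists (Num.truncn d^-1) => n Nn.
  by rewrite invf_plt ?posrE ?ltr0n// (lt_le_trans (truncnS_gt _))// ler_nat ltnS.
have [v0 v0P] : exists v0, seq_cvg (fun n => G n.+1%:R^-1) v0.
  apply: complX => e e0; have [d d0 dP] := powR_arbitrarily_small K10 e0 th1'.
  have [N NP] := invsmall d d0; exists N => m n Nm Nn.
  wlog mn : m n Nm Nn / (m <= n)%N.
    by move=> W; have [/W->//|/ltnW/W] := leqP m n; rewrite nrmB => ->.
  by rewrite (le_lt_trans (G0 _ _ (inv0 n) (invle _ _ mn)))// dP ?(ltW (inv0 _))// NP.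
have [v1 v1P] : exists v1, seq_cvg (fun n => G n.+1%:R) v1.
  apply: complX => e e0; have [d d0 dP] := powR_arbitrarily_small K20 e0 th0.
  have [N NP] := invsmall d d0; exists N => m n Nm Nn.
  wlog mn : m n Nm Nn / (m <= n)%N.
    by move=> W; have [/W->//|/ltnW/W] := leqP m n; rewrite nrmB => ->.
  rewrite nrmB (le_lt_trans (Goo m.+1%:R n.+1%:R _ _)) ?ltr0n ?ler_nat//.
  by rewrite dP ?(ltW (inv0 _))// NP.
exists (v1 - v0); exists (fun a b => G b - G a) => //.
apply: (@cvg_0y _ _ (fun a b => G b - G a)) => e e0; have e2 : 0 < e / 4 by lra.
have [d1 d10 d1P] := powR_arbitrarily_small K10 e2 th1'.
have [d2 d20 d2P] := powR_arbitrarily_small K20 e2 th0.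
exists (Num.min d1 d2); first by rewrite lt_min d10.
move=> a b a0; rewrite lt_min => /andP[ad1 ad2] db.
have d0 : 0 < Num.min d1 d2 by rewrite lt_min d10.
have b0 : 0 < b by apply: lt_trans db; rewrite invr_gt0.
have bd2 : b^-1 < d2.
  rewrite invf_plt ?posrE//; apply: le_lt_trans db.
  by rewrite lef_pV2 ?posrE// ge_min lexx orbT.
have A1 : nrm (G a - v0) < e / 2.
  have [N NP] := v0P _ e2; have [N' N'P] := invsmall a a0.
  have h1 := NP (maxn N N') (leq_maxl _ _); have h2 := N'P (maxn N N') (leq_maxr _ _).
  rewrite (le_lt_trans (nrm_triangle (G (maxn N N').+1%:R^-1) _ _))//.
  have := le_lt_trans (G0 _ _ (inv0 _) (ltW h2)) (d1P _ (ltW a0) ad1); lra.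
have A2 : nrm (G b - v1) < e / 2.
  have [N NP] := v1P _ e2; pose m := maxn N (Num.truncn b).
  have h1 := NP m (leq_maxl _ _).
  have h2 : b <= m.+1%:R.
    by rewrite ltW// (lt_le_trans (truncnS_gt _))// ler_nat ltnS leq_maxr.
  rewrite (le_lt_trans (nrm_triangle (G m.+1%:R) _ _))// nrmB.
  have bi : 0 <= b^-1 by rewrite invr_ge0 ltW.
  have := le_lt_trans (Goo _ _ b0 h2) (d2P _ bi bd2); lra.
have -> : G b - G a - (v1 - v0) = (G b - v1) - (G a - v0).
  by rewrite !opprD addrACA.
by rewrite (le_lt_trans (nrmD _ _))// nrmN; lra.
Qed.

Lemma is_int_0y_unique (f g : R -> X) v w : (forall l, 0 < l -> f l = g l) ->
  is_int_0y f v -> is_int_0y g w -> v = w.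
Proof.
move=> fg [I fI Iv] [I' gI' I'w].
apply/eqP; rewrite -subr_eq0; apply/eqP/nrm_small_eq0 => e e0.
have e2 : 0 < e / 2 by lra.
have [[a b] /= [[a0 ab h1] [_ _ h2]]] := near_0y_ex (near_0y Iv e2) (near_0y I'w e2).
have II' : I a b = I' a b.
  apply: (riemann_unique ab); first exact: fI.
  apply: eq_riemann (gI' _ _ a0 ab) => t at_; apply/esym/fg; lra.
rewrite (le_trans (nrm_triangle (I a b) _ _))// nrmB {2}II'; lra.
Qed.

(* The moment inequality, by cutting the integral at [s]. *)
Lemma integral_moment_bound th x v (S : X -> X) (c s : R) : 0 < th -> th < 1 ->
  linear S -> (forall x, S (J x) = J (S x)) -> 0 <= c ->
  (forall x, nrm (S x) <= c * nrm x) -> 0 < s -> is_int_0y (F th x) v ->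
  nrm (S v) <= C * nrm (J (S x)) / (1 - th) * s `^ (1 - th) +
               C * nrm (S x) / th * s `^ (- th).
Proof.
move=> th0 th1 lS SJ c0 Sc s0 [I FI Iv]; have th1' : 0 < 1 - th by lra.
have [G GP] := antiderivative x th0.
set B := leRHS.
(* Since [S] commutes with the resolvents it passes under the integral, and the bounds then involve
   J (S x) and S x rather than J x and x. *)
have SI a b : 0 < a -> a <= b -> is_riemann_int (F th (S x)) a b (S (G b - G a)).
  move=> a0 ab; apply: (eq_riemann _ (riemann_linear lS c0 Sc (GP _ _ a0 ab))).
  by move=> t at_; rewrite /F /= (linZ lS) rs_comm//; lra.
apply/ler_addgt0Pl => e e0; have ec : 0 < e / (c + 1) by rewrite divr_gt0//; lra.
have H : \forall ab \near (0^'+ , +oo), ab.1 <= s /\ s <= ab.2 :> R.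
  exists ([set a | a <= s], [set b | s <= b]) => /=; last by move=> [].
  by split; [exact: nbhs_right_le|apply: nbhs_pinfty_ge; rewrite num_real].
have [[a b] /= [[as_ sb] [a0 ab h1]]] := near_0y_ex H (near_0y Iv ec).
have IE : I a b = (G s - G a) + (G b - G s).
  rewrite addrC addrA subrK; apply: (riemann_unique ab); first exact: FI.
  exact: GP.
have P1 := integral_norm_small th0 th1 a0 as_ (SI _ _ a0 as_).
have P2 := integral_norm_large th0 s0 sb (SI _ _ s0 sb).
rewrite (le_trans (nrm_le_add _ (S (I a b))))// addrC lerD//.
  rewrite -(linB lS) (le_trans (Sc _))// nrmB.
  by move: h1; rewrite ltr_pdivlMr; [have := nrm_ge0 (I a b - v); nra|lra].
rewrite IE (linD lS) (le_trans (nrmD _ _))// lerD//.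
  apply: (le_trans P1); rewrite ler_wpM2l ?gerBl ?powR_ge0//.
  by rewrite divr_ge0 ?mulr_ge0 ?nrm_ge0// ltW.
apply: (le_trans P2); rewrite ler_wpM2l ?gerBl ?powR_ge0//.
by rewrite divr_ge0 ?mulr_ge0 ?nrm_ge0// ltW.
Qed.

Hypothesis J_inj : injective J.

(** (A - w)(A + w)^(-1) = I - 2 w (A + w)^(-1), an everywhere defined form of the Cayley factor. *)
Definition cayley_map (w : R) x := x - (2 * w)%:C *: rs w x.
Definition cayley_word (s : seq R) x := foldr cayley_map x s.

Lemma op_mul_fun (f g : X -> X) : op_mul (op_fun f) (op_fun g) = op_fun (f \o g).
Proof.
apply/funext => x; apply/funext => z; apply/propext; split.
  by move=> [y -> ->].
by move=> ->; exists (g x).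
Qed.

Lemma cayleyE w : 0 < w -> cayley w A = op_fun (cayley_map w).
Proof.
move=> w0; apply/funext => x; apply/funext => z; apply/propext; split.
  move=> [y /(A_rs _ _ w0) -> /AJ]; rewrite {1}rsE// => /J_inj.
  rewrite scaleNr opprK => /esym/(canRL (addrK _)) ->.
  by rewrite /op_fun /cayley_map -addrA -opprD -scalerDl -rmorphD mulr2n mulrDl mul1r.
move=> ->; exists (rs w x); first exact/(A_rs _ _ w0).
apply/AJ; rewrite {1}rsE//; congr J.
rewrite /cayley_map scaleNr opprK mulr2n mulrDl mul1r rmorphD scalerDl opprD.
by rewrite addrA subrK.
Qed.

Lemma cayley_wordE (omega : nat -> R) n : (forall k, 0 < omega k) ->
  cayley_prod omega n A = op_fun (cayley_word [seq omega k | k <- iota 1 n]).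
Proof.
move=> o0; rewrite /cayley_prod /index_iota subn1 /=.
elim: n 1%N => [|n IH] m; first by rewrite big_nil.
by rewrite big_cons IH cayleyE// op_mul_fun.
Qed.

Lemma op_exp_invE n : op_exp (op_inv A) n = op_fun (iter n J).
Proof.
have -> : op_inv A = op_fun J.
  by apply/funext => x; apply/funext => y; apply/propext; exact: AJ.
by elim: n => [//|n IH]; rewrite /op_exp iterS -/(op_exp _ _) IH op_mul_fun.
Qed.

Lemma cayley_map_linear w : 0 < w -> linear (cayley_map w).
Proof.
move=> w0 a x y; rewrite /cayley_map (rs_linear w0) scalerDr opprD addrACA.
by rewrite scalerBr !scalerA [a * _]mulrC.
Qed.

Lemma cayley_mapJ w x : 0 < w -> cayley_map w (J x) = J (cayley_map w x).
Proof.
move=> w0; rewrite /cayley_map (linB J_lin) (linZ J_lin).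
by rewrite (rs_comm _ J_lin).
Qed.

Lemma cayley_word_linear s : all (fun w => 0 < w) s -> linear (cayley_word s).
Proof.
elim: s => [_ //|w s IH] /= /andP[w0 s0] a x y.
have E z : cayley_word (w :: s) z = cayley_map w (cayley_word s z) by [].
by rewrite !E (IH s0) (cayley_map_linear w0).
Qed.

Lemma cayley_wordJ s x : all (fun w => 0 < w) s ->
  cayley_word s (J x) = J (cayley_word s x).
Proof.
by elim: s => [//|w s IH] /= /andP[w0 s0]; rewrite IH// cayley_mapJ.
Qed.

Hypothesis cayley_map_le : forall w x, 0 < w -> nrm (cayley_map w x) <= nrm x.

Lemma cayley_word_le s x : all (fun w => 0 < w) s -> nrm (cayley_word s x) <= nrm x.
Proof.
elim: s => [//|w s IH] /= /andP[w0 s0].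
by rewrite (le_trans (cayley_map_le _ w0))// IH.
Qed.

Variable gam : R.
Hypothesis gam_gt0 : 0 < gam.

(** The case alpha = 1 of the estimate, for arbitrary nonempty words so that it applies to each
    block of a longer word. *)
Definition word_decay (p q K : R) := forall s x, (0 < size s)%N ->
  all (fun w => p <= w <= q) s ->
  nrm (cayley_word s (J x)) <= K * (size s)%:R `^ (- gam) * nrm x.

Lemma all_gt0 (p q : R) s : 0 < p -> all (fun w => p <= w <= q) s -> all (fun w => 0 < w) s.
Proof. by move=> p0; apply: sub_all => w /andP[pw _]; lra. Qed.

(** Each of the m blocks of length n absorbs one factor [J], which commutes past the rest of the
    word; what remains after the m blocks is a contraction. *)
Lemma cayley_word_pow_blocks (p q K : R) : 0 < p -> 0 < K -> word_decay p q K ->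
  forall m n s x, (0 < n)%N -> all (fun w => p <= w <= q) s -> (m * n <= size s)%N ->
  nrm (cayley_word s (iter m J x)) <= (K * n%:R `^ (- gam)) ^+ m * nrm x.
Proof.
move=> p0 K0 WK; elim=> [|m IH] n s x n0 sP ms.
  by rewrite expr0 mul1r; apply: cayley_word_le; exact: all_gt0 sP.
have ns : (n <= size s)%N by apply: leq_trans ms; rewrite mulSn leq_addr.
move: (sP); rewrite -[s](cat_take_drop n) all_cat => /andP[s1P s2P].
have szt : size (take n s) = n by rewrite size_takel.
rewrite /cayley_word foldr_cat -/(cayley_word _ _) -/(cayley_word _ _) iterS.
rewrite (cayley_wordJ _ (all_gt0 p0 s2P)) exprS -mulrA.
apply: (le_trans (WK _ _ _ s1P)); first by rewrite szt.
rewrite szt ler_wpM2l ?mulr_ge0 ?powR_ge0 ?(ltW K0)//.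
by apply: IH => //; rewrite size_drop leq_subRL// -mulSn.
Qed.

Lemma cayley_word_pow (p q K : R) m : 0 < p -> 0 < K -> word_decay p q K ->
  exists2 M : R, 0 < M & forall s x, (0 < size s)%N -> (m <= size s)%N ->
    all (fun w => p <= w <= q) s ->
    nrm (cayley_word s (iter m J x)) <= M * (size s)%:R `^ (- (gam * m%:R)) * nrm x.
Proof.
move=> p0 K0 WK; case: m => [|m].
  exists 1 => // s x _ _ sP; rewrite mulr0 oppr0 powRr0 !mul1r.
  by apply: cayley_word_le; exact: all_gt0 sP.
exists ((K * (2 * m.+1%:R) `^ gam) ^+ m.+1).
  by rewrite exprn_gt0// mulr_gt0// powR_gt0// mulr_gt0// ltr0n.
(* As n >= 1, the size of s is at most 2 (m + 1) n. This is the origin of the factor (2 (m + 1))^gam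
   in the constant. *)
move=> s x s0 ms sP; pose n := (size s %/ m.+1)%N.
have n0 : (0 < n)%N by rewrite divn_gt0.
have mn : (m.+1 * n <= size s)%N by rewrite mulnC leq_trunc_div.
apply: (le_trans (cayley_word_pow_blocks p0 K0 WK x n0 sP mn)).
rewrite ler_wpM2r ?nrm_ge0// -mulNr powRrM powR_mulrn ?powR_ge0// -exprMn.
have K00 := ltW K0.
rewrite lerXn2r ?nnegrE ?mulr_ge0 ?powR_ge0// -mulrA ler_wpM2l//.
have n0R : 0 < n%:R :> R by rewrite ltr0n.
have s0R : 0 < (size s)%:R :> R by rewrite ltr0n.
have c0R : 0 < 2 * m.+1%:R :> R by rewrite mulr_gt0// ltr0n.
rewrite !powRN -[X in _ <= X]invrK invfM invrK lef_pV2 ?posrE ?mulr_gt0 ?invr_gt0 ?powR_gt0//.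
rewrite mulrC ler_pdivrMr ?powR_gt0// -powRM ?(ltW n0R) ?(ltW c0R)//.
rewrite ge0_ler_powR ?nnegrE ?mulr_ge0 ?(ltW gam_gt0)//.
rewrite -natrM -natrM ler_nat; apply: ltnW; apply: (leq_trans (ltn_ceil (size s) (ltn0Sn m))).
by rewrite -/n mulnA leq_mul2r /= muln2 -addnn -[X in (X <= _)%N]addn1 leq_add2l.
Qed.

Lemma iter_linear n : linear (iter n J).
Proof.
elim: n => [//|n IH] a x y; rewrite !iterS IH; exact: J_lin.
Qed.

Lemma op_bound_fun (f : X -> X) (c : R) : (forall x, nrm (f x) <= c * nrm x) ->
  op_bound (op_fun f) c.
Proof.
move=> fc; split=> [x|x _ ->]; first by exists (f x); split => // y ->.
by rewrite !nrmE -rmorphM lecR.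
Qed.

Lemma opnorm_fun_le (f : X -> X) (c : R) : 0 <= c ->
  (forall x, nrm (f x) <= c * nrm x) -> (opnorm (op_fun f) <= c%:E)%E.
Proof.
by move=> c0 fc; apply: ereal_inf_lbound; exists c => //; split => //; exact: op_bound_fun.
Qed.

(** Existence and uniqueness of the integral turn the relation [balakrishnan] into a function. *)
Lemma balakrishnanE th : 0 < th -> th < 1 -> exists2 v : X -> X,
  (forall x, is_int_0y (F th x) (v x)) &
  balakrishnan A th = op_fun (fun x => (sin (pi * th) / pi)%:C *: v x).
Proof.
move=> th0 th1; have /choice[v vP] := fun x => balakrishnan_integral x th0 th1.
exists v => //; apply/funext => x; apply/funext => y; apply/propext; split.
  move=> [f [w [fP fw] ->]]; congr (_ *: _).
  apply: is_int_0y_unique fw (vP x) => l l0; congr (_ *: _).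
  exact/(A_rs _ _ l0)/fP.
move=> ->; exists (rs ^~ x), (v x) => //; split; last exact: vP.
by move=> l l0; exact/(A_rs _ _ l0).
Qed.

(** For alpha = n + th, the word applied to J^n decays like N^(-gam n) and applied to J^(n+1) like
    N^(-gam (n+1)); the moment inequality interpolates between the two. *)
Lemma cayley_estimate_of_word_decay (beta : R) : gam = (2 + beta)^-1 ->
  (forall p q : R, 0 < p -> p <= q -> exists2 K : R, 0 < K & word_decay p q K) ->
  cayley_estimate A beta.
Proof.
move=> gE WK alpha p q a0 p0 pq.
have [K K0 {}WK] := WK p q p0 pq.
rewrite /frac_pow_neg; set n := Num.truncn alpha; set th := alpha - n%:R.
have th0 : 0 <= th by rewrite subr_ge0 truncn_le ltW.
have th1 : th < 1 by rewrite ltrBlDr addrC natr1; exact: truncnS_gt.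
have [M1 M10 P1] := cayley_word_pow n p0 K0 WK.
have [M2 M20 P2] := cayley_word_pow n.+1 p0 K0 WK.
have wordE omega N : shifts p q omega ->
    exists2 s, cayley_prod omega N A = op_fun (cayley_word s) &
      size s = N /\ all (fun w => p <= w <= q) s.
  move=> oP; exists [seq omega k | k <- iota 1 N].
    by apply: cayley_wordE => k; have [pk _] := oP k; lra.
  split; first by rewrite size_map size_iota.
  by apply/allP => _ /mapP[k _ ->]; have [-> ->] := oP k.
have aE (N : R) : N `^ (alpha / (2 + beta)) = N `^ (gam * alpha) by rewrite gE mulrC.
have [th_eq0|th_neq0] := eqVneq th 0.
  exists M1, n.+1; split => // N nN omega /(wordE _ N)[s -> [sN sP]].
  rewrite op_exp_invE !op_mul_fun aE -powRN.
  apply: opnorm_fun_le => [|x]; first by rewrite mulr_ge0 ?powR_ge0// ltW.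
  have -> : alpha = n%:R by apply/eqP; rewrite -subr_eq0 -/th th_eq0.
  by rewrite -sN; apply: P1; rewrite ?sN ?(leq_trans _ nN)// ltnW.
have {}th0 : 0 < th by rewrite lt_def th_neq0.
have th1' : 0 < 1 - th by lra.
have [v vP ->] := balakrishnanE th0 th1.
set k := sin _ / _.
(* The summand 1 ensures positivity without an examination of the sine. For N > n both [P1] and [P2]
   apply. *)
exists (`|k| * (C * M2 / (1 - th) + C * M1 / th) + 1), n.+1.
have cst0 : 0 <= C * M2 / (1 - th) + C * M1 / th.
  by rewrite addr_ge0// divr_ge0 ?mulr_ge0// ltW.
split; first by rewrite ltr_wpDl// mulr_ge0.
move=> N nN omega /(wordE _ N)[s -> [sN sP]].
rewrite op_exp_invE !op_mul_fun aE -powRN.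
apply: opnorm_fun_le => [|x].
  by rewrite mulr_ge0 ?powR_ge0// addr_ge0// mulr_ge0.
pose S x := cayley_word s (iter n J x).
have sp := all_gt0 p0 sP.
have lS : linear S by move=> a y z; rewrite /S iter_linear (cayley_word_linear sp).
have SJ y : S (J y) = J (S y) by rewrite /S -iterSr iterS cayley_wordJ.
have N0 : (0 < N)%N by exact: leq_ltn_trans nN.
have NR : 0 < N%:R :> R by rewrite ltr0n.
have S1 y : nrm (S y) <= M1 * N%:R `^ (- (gam * n%:R)) * nrm y.
  by rewrite -sN; apply: P1; rewrite ?sN// ltnW.
have S2 y : nrm (J (S y)) <= M2 * N%:R `^ (- (gam * n.+1%:R)) * nrm y.
  by rewrite -SJ /S -iterSr -sN; apply: P2; rewrite ?sN.
have s0 : 0 < N%:R `^ gam by rewrite powR_gt0.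
have c0 : 0 <= M1 * N%:R `^ (- (gam * n%:R)) by rewrite mulr_ge0 ?powR_ge0// ltW.
rewrite /= -/(S _) (linZ lS) nrmZ normc_real.
have B := integral_moment_bound th0 th1 lS SJ c0 S1 s0 (vP x).
(* With the cut at N^gam both terms of the moment inequality have the same power of N, namely -gam
   alpha. *)
have pE (r t : R) : gam * r - gam * t = gam * alpha ->
    N%:R `^ (- (gam * r)) * (N%:R `^ gam) `^ t = N%:R `^ (- (gam * alpha)).
  move=> <-; rewrite -powRrM -powRD ?(gt_eqF NR) ?implybT//.
  by congr (_ `^ _); ring.
have aeq : alpha = n%:R + th by rewrite /th addrC subrK.
have e1 := pE n.+1%:R (1 - th); have e2 := pE n%:R (- th).
set T := N%:R `^ (- (gam * alpha)) in e1 e2 *.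
have T0 : 0 <= T by exact: powR_ge0.
rewrite [in leRHS]mulrDl mul1r mulrDl.
apply: (@le_trans _ _ (`|k| * (C * M2 / (1 - th) + C * M1 / th) * T * nrm x)); last first.
  by rewrite lerDl mulr_ge0 ?nrm_ge0.
rewrite -!mulrA ler_wpM2l//; apply: (le_trans B); rewrite mulrDl; apply: lerD.
  rewrite -e1; last by rewrite -natr1 aeq; ring.
  have := S2 x; set u := N%:R `^ (- _); set w := _ `^ (1 - th) => h.
  have w0 : 0 <= w by exact: powR_ge0.
  rewrite [leLHS](_ : _ = C / (1 - th) * w * nrm (J (S x))); last by ring.
  rewrite [leRHS](_ : _ = C / (1 - th) * w * (M2 * u * nrm x)); last by ring.
  by rewrite ler_wpM2l// mulr_ge0// divr_ge0// ltW.
rewrite -e2; last by rewrite aeq; ring.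
have := S1 x; set u := N%:R `^ (- (_ * _)); set w := _ `^ (- th) => h.
have w0 : 0 <= w by exact: powR_ge0.
rewrite [leLHS](_ : _ = C / th * w * nrm (S x)); last by ring.
rewrite [leRHS](_ : _ = C / th * w * (M1 * u * nrm x)); last by ring.
by rewrite ler_wpM2l// mulr_ge0// divr_ge0// ltW.
Qed.

End Resolvent.

(** * Hilbert spaces *)

Lemma Re_conj (R : realType) (z : R[i]) : complex.Re (Num.conj z) = complex.Re z.
Proof. by case: z. Qed.

Section InnerProduct.
Variables (R : realType) (H : completeNormedModType R[i]).
Variable ip : {dot H for @Num.conj R[i]}.
Hypothesis ip_norm : induces_norm ip.
Implicit Types x y z : H.

Lemma ipZl a x y : ip (a *: x) y = a * ip x y.
Proof. exact: linearZl_LR. Qed.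

Lemma ipZr a x y : ip x (a *: y) = Num.conj a * ip x y.
Proof. exact: linearZr_LR. Qed.

Lemma ipDl x y z : ip (x + y) z = ip x z + ip y z.
Proof. exact: linearDl. Qed.

Lemma ipDr x y z : ip x (y + z) = ip x y + ip x z.
Proof. exact: linearDr. Qed.

Lemma ipBl x y z : ip (x - y) z = ip x z - ip y z.
Proof. exact: linearBl. Qed.

Lemma ipBr x y z : ip x (y - z) = ip x y - ip x z.
Proof. exact: linearBr. Qed.

Lemma ip0l y : ip 0 y = 0.
Proof. exact: linear0l. Qed.

Lemma ipC x y : ip x y = Num.conj (ip y x).
Proof. by rewrite hermC expr0 mul1r. Qed.

Lemma ip_nrm x : ip x x = (nrm x ^+ 2)%:C.
Proof. by rewrite ip_norm nrmE rmorphXn. Qed.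

Lemma ip_self_eq0 x : ip x x = 0 -> x = 0.
Proof. by move=> h; apply/eqP; rewrite -(dnorm_eq0 ip) h. Qed.

Lemma ip_ext x y : (forall z, ip z x = ip z y) -> x = y.
Proof.
by move=> e; apply/eqP; rewrite -subr_eq0; apply/eqP/ip_self_eq0; rewrite ipBr e subrr.
Qed.

Lemma nrm_sqrD x y : nrm (x + y) ^+ 2 = nrm x ^+ 2 + nrm y ^+ 2 + 2 * complex.Re (ip x y).
Proof.
have := dnormD ip x y; rewrite !ip_nrm => /(congr1 (@complex.Re R)) /= ->.
by rewrite !ReD Re_conj /=; ring.
Qed.

Lemma nrm_sqrB x y : nrm (x - y) ^+ 2 = nrm x ^+ 2 + nrm y ^+ 2 - 2 * complex.Re (ip x y).
Proof.
have := dnormB ip x y; rewrite !ip_nrm => /(congr1 (@complex.Re R)) /= ->.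
have ReN (a : R[i]) : complex.Re (- a) = - complex.Re a by case: a.
by rewrite !ReD ReN ReD Re_conj /=; ring.
Qed.

Lemma parallelogram x y : nrm (x + y) ^+ 2 + nrm (x - y) ^+ 2 = 2 * (nrm x ^+ 2 + nrm y ^+ 2).
Proof. by rewrite nrm_sqrD nrm_sqrB; ring. Qed.

Lemma nrm_sqr_proj x y : y != 0 ->
  nrm (x - (ip x y / ip y y) *: y) ^+ 2 = nrm x ^+ 2 - normc (ip x y) ^+ 2 / nrm y ^+ 2.
Proof.
move=> y0; have ny : nrm y ^+ 2 != 0 by rewrite expf_neq0// nrm_eq0.
rewrite nrm_sqrB nrmZ ipZr ip_nrm.
have -> : (nrm y ^+ 2)%:C^-1 = ((nrm y ^+ 2)^-1)%:C by rewrite fmorphV.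
have E (a : R[i]) (r : R) : complex.Re (Num.conj (a * r%:C) * a) = normc a ^+ 2 * r.
  by rewrite normc_sqr; case: a => u v /=; ring.
rewrite E Normc.normcM normc_real ger0_norm ?invr_ge0 ?sqr_ge0//.
by field; rewrite nrm_eq0.
Qed.

Lemma cauchy_schwarz x y : normc (ip x y) <= nrm x * nrm y.
Proof.
have [->|y0] := eqVneq y 0; first by rewrite ipC ip0l rmorph0 Normc.normc0 nrm0 mulr0.
have ny : 0 < nrm y ^+ 2 by rewrite exprn_gt0// nrm_gt0.
rewrite -(@ler_pXn2r _ 2)// ?nnegrE ?normc_ge0 ?mulr_ge0 ?nrm_ge0// exprMn.
by rewrite -ler_pdivrMr// -subr_ge0 -nrm_sqr_proj// sqr_ge0.
Qed.

Definition linear_subspace (K : set H) :=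
  K 0 /\ forall a x y, K x -> K y -> K (a *: x + y).

Definition seq_closed (K : set H) :=
  forall (u : nat -> H) l, (forall n, K (u n)) -> seq_cvg u l -> K l.

(** The midpoint of two almost minimizers is no closer to x than the infimum, so by the
    parallelogram law a minimizing sequence is Cauchy. *)
Lemma minimizer_exists (K : set H) x : linear_subspace K -> seq_closed K ->
  exists2 l, K l & forall k, K k -> nrm (x - l) <= nrm (x - k).
Proof.
move=> [K0 KS] Kcl; pose E := [set nrm (x - k) ^+ 2 | k in K].
have E0 : E !=set0 by exists (nrm (x - 0) ^+ 2), 0.
have Elb : has_lbound E by exists 0 => _ [k _ <-]; exact: sqr_ge0.
pose d := inf E.
have dlb k : K k -> d <= nrm (x - k) ^+ 2 by move=> Kk; apply: ge_inf => //; exists k.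
have /choice[u uP] : forall n : nat, exists k, K k /\ nrm (x - k) ^+ 2 < d + n.+1%:R^-1.
  move=> n; have [|_ [k Kk <-] h] := @inf_adherent R E n.+1%:R^-1 _ (conj E0 Elb).
    by rewrite invr_gt0 ltr0n.
  by exists k.
have u_dist m n : nrm (u m - u n) ^+ 2 <= 2 * (m.+1%:R^-1 + n.+1%:R^-1).
  have [Km hm] := uP m; have [Kn hn] := uP n.
  have := parallelogram (x - u n) (x - u m).
  have -> : (x - u n) - (x - u m) = u m - u n by rewrite opprB addrC addrA subrK.
  pose mid := 2^-1 *: u n + (2^-1 *: u m + 0).
  have Kmid : K mid by apply: (KS) => //; exact: (KS).
  have -> : (x - u n) + (x - u m) = (2 : R[i]) *: (x - mid).
    rewrite /mid addr0 scalerBr scalerDr !scalerA divff ?pnatr_eq0// !scale1r.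
    by rewrite addrACA -opprD scaler_nat mulr2n.
  rewrite nrmZ exprMn.
  have -> : normc (2 : R[i]) ^+ 2 = 4 by rewrite normc_sqr /=; ring.
  move: hm hn (dlb _ Kmid).
  move: (nrm (x - u m) ^+ 2) (nrm (x - u n) ^+ 2) (nrm (x - mid) ^+ 2) => r1 r2 r3.
  move: (nrm (u m - u n) ^+ 2) (m.+1%:R^-1) (n.+1%:R^-1) => r4 r5 r6; lra.
have [|l ul] := @complete_seq_complete R H u.
  move=> e e0; pose N := Num.truncn (4 / e ^+ 2).
  have e2 : 0 < e ^+ 2 by rewrite exprn_gt0.
  have small n : (N <= n)%N -> n.+1%:R^-1 < e ^+ 2 / 4.
    move=> Nn; rewrite invf_plt ?posrE ?ltr0n ?divr_gt0// invf_div.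
    by rewrite (lt_le_trans (truncnS_gt _))// ler_nat ltnS.
  exists N => m n /small hm /small hn.
  rewrite -(@ltr_pXn2r _ 2)// ?nnegrE ?nrm_ge0 ?(ltW e0)//.
  by move: hm hn (u_dist m n); move: m.+1%:R^-1 n.+1%:R^-1 => r1 r2; lra.
have Kl : K l by apply: Kcl ul => n; case: (uP n).
exists l => // k Kk; rewrite -(@ler_pXn2r _ 2)// ?nnegrE ?nrm_ge0//.
apply: le_trans (dlb k Kk); apply/ler_addgt0Pl => e e0.
(* For b = |u n - l| < 1 and c = |x - u n| this makes (c + b)^2 <= c^2 + b B. *)
pose B := 2 * (nrm (x - l) + 1) + 1.
have B0 : 0 < B by have := nrm_ge0 (x - l); rewrite /B; lra.
have eB : 0 < Num.min 1 (e / 2 / B) by rewrite lt_min ltr01 !divr_gt0.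
have [N NP] := ul _ eB; pose n := maxn N (Num.truncn (2 / e)).
have := NP n (leq_maxl _ _); rewrite lt_min => /andP[h1 h2].
have [_ h3] := uP n.
have h4 : n.+1%:R^-1 < e / 2.
  rewrite invf_plt ?posrE ?ltr0n ?divr_gt0// invf_div.
  by rewrite (lt_le_trans (truncnS_gt _))// ler_nat ltnS leq_maxr.
have h5 := nrm_triangle (u n) x l.
have := nrm_ge0 (x - u n); have := nrm_ge0 (u n - l); have := nrm_ge0 (x - l).
move: h2; rewrite ltr_pdivlMr// /B.
have h6 := nrm_triangle l x (u n); rewrite [nrm (l - _)]nrmB in h6.
move: h1 h3 h4 h5 h6; move: n.+1%:R^-1 (nrm (x - l)) (nrm (u n - l)) (nrm (x - u n)).
move=> r a b c h1 h3 h4 h5 h6 h7 a0 b0 c0.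
have : a ^+ 2 <= (c + b) ^+ 2 by rewrite ler_pXn2r// nnegrE addr_ge0.
have : (c + b) ^+ 2 = c ^+ 2 + b * (2 * c + b) by ring.
have : b * (2 * c + b) <= b * (2 * (a + 1) + 1) by rewrite ler_wpM2l//; lra.
lra.
Qed.

(** For the minimizer l, moving l along k would lower |x - l|^2 by |<x - l, k>|^2 / |k|^2, which
    must therefore vanish. *)
Lemma orthogonal_vector (K : set H) x : linear_subspace K -> seq_closed K -> ~ K x ->
  exists2 z, z != 0 & forall k, K k -> ip z k = 0.
Proof.
move=> Ks Kcl nKx; have [l Kl lmin] := minimizer_exists x Ks Kcl.
exists (x - l); first by rewrite subr_eq0; apply: contra_notN nKx => /eqP ->.
move=> k Kk; have [->|k0] := eqVneq k 0; first by rewrite ipC ip0l rmorph0.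
set a := ip (x - l) k / ip k k.
have := lmin (a *: k + l) (Ks.2 _ _ _ Kk Kl).
rewrite opprD addrA addrAC -(@ler_pXn2r _ 2)// ?nnegrE ?nrm_ge0//.
rewrite nrm_sqr_proj// => h.
have nk : 0 < nrm k ^+ 2 by rewrite exprn_gt0// nrm_gt0.
have : normc (ip (x - l) k) ^+ 2 / nrm k ^+ 2 <= 0 by lra.
rewrite ler_pdivrMr// mul0r => hh.
apply: Normc.eq0_normc; apply/eqP.
by rewrite -sqrf_eq0 eq_le hh sqr_ge0.
Qed.

Lemma riesz (f : H -> R[i]) (c : R) : (forall a x y, f (a *: x + y) = a * f x + f y) ->
  (forall x, normc (f x) <= c * nrm x) -> exists z, forall x, f x = ip x z.
Proof.
move=> fl fc; have f0 : f 0 = 0.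
  apply: (addrI (f 0)); rewrite addr0; have := fl 1 0 0.
  by rewrite scale1r mul1r addr0.
have fB x y : f (x - y) = f x - f y.
  by rewrite addrC -scaleN1r fl mulN1r addrC.
pose K := [set x | f x = 0].
have Ks : linear_subspace K by split => // a x y fx fy; rewrite /K /= fl (fx : f x = 0) (fy : f y = 0) mulr0 addr0.
have Kcl : seq_closed K.
  move=> u l uK ul; apply: Normc.eq0_normc; apply/eqP.
  rewrite eq_le normc_ge0 andbT; apply/ler_addgt0Pl => e e0; rewrite addr0.
  have c1 : 0 < `|c| + 1 by rewrite ltr_wpDl.
  have [N NP] := ul _ (divr_gt0 e0 c1).
  have := NP N (leqnn _); rewrite ltr_pdivlMr// => h.
  have -> : f l = f (l - u N) by rewrite fB uK subr0.
  rewrite (le_trans (fc _))// nrmB; have := nrm_ge0 (u N - l).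
  have := ler_norm c; nra.
have [allK|/existsNP[x0 nK]] := pselect (forall x, K x).
  by exists 0 => x; rewrite allK ipC ip0l rmorph0.
have [z z0 zK] := orthogonal_vector Ks Kcl nK.
have ipz : ip z z != 0 by rewrite (dnorm_eq0 ip).
have fz : f z != 0.
  by apply: contraNneq ipz => /zK ->.
exists (Num.conj (f z / ip z z) *: z) => x.
have : ip (x - (f x / f z) *: z) z = 0.
  rewrite ipC zK ?rmorph0//= /K /= fB -[_ *: z]addr0 fl f0 addr0.
  by rewrite divfK// subrr.
rewrite ipBl ipZl => /eqP; rewrite subr_eq0 => /eqP e.
by rewrite ipZr conjCK e; field; rewrite ipz fz.
Qed.

Definition bounded_by (c : R) (S : H -> H) := forall x, nrm (S x) <= c * nrm x.

Lemma adjoint_exists (S : H -> H) c : linear S -> 0 <= c -> bounded_by c S ->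
  exists2 S' : H -> H, forall x y, ip (S x) y = ip x (S' y) &
    linear S' /\ bounded_by c S'.
Proof.
move=> lS c0 Sc.
have /choice[S' SS'] : forall y, exists z, forall x, ip (S x) y = ip x z.
  move=> y; apply: (@riesz _ (c * nrm y)) => [a u v|x].
    by rewrite lS ipDl ipZl.
  rewrite (le_trans (cauchy_schwarz _ _))// [leRHS]mulrAC ler_wpM2r ?nrm_ge0//.
exists S' => //; split.
  move=> a x y; apply: ip_ext => z.
  by rewrite -SS' !ipDr !ipZr !SS'.
move=> y; have [->|nz] := eqVneq (S' y) 0; first by rewrite nrm0 mulr_ge0 ?nrm_ge0.
have n0 : 0 < nrm (S' y) by rewrite nrm_gt0.
rewrite -(ler_pM2l n0) -expr2.
have := cauchy_schwarz (S (S' y)) y.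
rewrite SS' ip_nrm normc_real ger0_norm ?sqr_ge0// => h.
by rewrite (le_trans h)// mulrCA mulrA ler_wpM2r ?nrm_ge0// mulrC.
Qed.

Lemma commuting_adjoint_nrm (N N' : H -> H) : (forall x y, ip (N x) y = ip x (N' y)) ->
  (forall x, N (N' x) = N' (N x)) -> forall x, nrm (N' x) = nrm (N x).
Proof.
move=> NN' comm x; apply/eqP; rewrite -(eqrXn2 (_ : 0 < 2)%N) ?nrm_ge0//; apply/eqP.
apply: (@complexI R); rewrite -!ip_nrm -NN' comm NN'.
by rewrite ipC -!NN' -ipC.
Qed.

Lemma range_closed (N : H -> H) (c d : R) : linear N -> bounded_by d N -> 0 < c ->
  (forall x, c * nrm x <= nrm (N x)) -> seq_closed (range N).
Proof.
move=> lN Nd c0 cN u l /= uN ul.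
have /choice[v vP] : forall n, exists x, N x = u n by move=> n; have [x _ <-] := uN n; exists x.
have [|w vw] := @complete_seq_complete R H v.
  move=> e e0; have ec : 0 < c * e / 2 by rewrite divr_gt0// mulr_gt0.
  have [M MP] := ul _ ec; exists M => m n /MP hm /MP hn.
  have := cN (v m - v n); rewrite (linB lN) !vP.
  have := nrm_triangle l (u m) (u n); rewrite [nrm (l - _)]nrmB.
  have := nrm_ge0 (v m - v n); nra.
exists w => //; apply/eqP; rewrite -subr_eq0; apply/eqP/nrm_small_eq0 => e e0.
have e2 : 0 < e / 2 by lra.
have ed : 0 < e / 2 / (`|d| + 1) by rewrite divr_gt0// ltr_wpDl.
have [M1 h1] := ul _ e2; have [M2 h2] := vw _ ed.
have {h1} := h1 (maxn M1 M2) (leq_maxl _ _).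
have {h2} := h2 (maxn M1 M2) (leq_maxr _ _).
set n := maxn M1 M2; rewrite ltr_pdivlMr ?ltr_wpDl// => h2 h1.
have := nrm_triangle (u n) (N w) l; rewrite -[X in X - u n]/(N w) -vP -(linB lN).
have := Nd (w - v n); rewrite [nrm (w - _)]nrmB vP.
have := ler_norm d; have := nrm_ge0 (v n - w); nra.
Qed.

(** The range is closed. A vector orthogonal to it is killed by N', hence by N because |N' z| = |N
    z|, hence is 0. *)
Lemma normal_bounded_below_surj (N N' : H -> H) (c d : R) :
  linear N -> bounded_by d N -> (forall x y, ip (N x) y = ip x (N' y)) ->
  (forall x, N (N' x) = N' (N x)) ->
  0 < c -> (forall x, c * nrm x <= nrm (N x)) -> forall y, exists x, N x = y.
Proof.
move=> lN Nd NN' comm c0 cN y; apply: contrapT => ny.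
have Ks : linear_subspace (range N).
  split; first by exists 0 => //; rewrite (lin0 lN).
  by move=> a _ _ [x _ <-] [z _ <-]; exists (a *: x + z) => //; rewrite lN.
have Kcl := range_closed lN Nd c0 cN.
have [|z z0 zK] := @orthogonal_vector (range N) y Ks Kcl.
  by move=> [x _ e]; apply: ny; exists x.
have N'z : N' z = 0.
  by apply: ip_ext => x; rewrite -NN' ipC zK ?rmorph0 1?ipC ?ip0l ?rmorph0//; exists x.
have := cN z; rewrite -(commuting_adjoint_nrm NN' comm) N'z nrm0.
by apply/negP; rewrite -ltNge mulr_gt0// nrm_gt0.
Qed.

(* Averaged over the [2 ^ m]-th roots of unity [l], the right-hand side equals the
   left-hand side (Parseval); the induction halves the index set and uses the
   parallelogram law. *)
Lemma unit_root_energy m (vs : seq (nat -> H)) : exists2 l : R[i], normc l = 1 &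
  \sum_(v <- vs) \sum_(0 <= k < 2 ^ m) nrm (v k) ^+ 2 <=
  \sum_(v <- vs) nrm (\sum_(0 <= k < 2 ^ m) l ^+ k *: v k) ^+ 2.
Proof.
have even_odd (V : nmodType) (g : nat -> V) n :
    \sum_(0 <= k < 2 * n) g k = \sum_(0 <= k < n) g (2 * k)%N + \sum_(0 <= k < n) g (2 * k).+1.
  elim: n => [|n IH]; first by rewrite muln0 !big_geq// addr0.
  by rewrite mulnS !big_nat_recr//= IH -addrA addrACA.
elim: m vs => [|m IH] vs.
  exists 1; first by rewrite Normc.normc1.
  by apply: ler_sum => v _; rewrite !big_nat1 expr0 scale1r.
pose ev (v : nat -> H) k := v (2 * k)%N; pose od (v : nat -> H) k := v (2 * k).+1.
(* The lemma is stated for a list of sequences so that a single mu serves the even and the odd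
   halves at once. *)
have [mu mu1] := IH ([seq ev v | v <- vs] ++ [seq od v | v <- vs]).
rewrite !big_cat !big_map /= -!big_split /= => le_mu.
pose l := sqrtC mu; have l2 : l ^+ 2 = mu by exact: sqrtCK.
have l1 : normc l = 1.
  apply/eqP; rewrite -(eqrXn2 (_ : 0 < 2)%N) ?normc_ge0 ?ler01// expr1n.
  by rewrite expr2 -Normc.normcM -expr2 l2 mu1.
pose E v := \sum_(0 <= k < 2 ^ m) mu ^+ k *: ev v k.
pose O v := \sum_(0 <= k < 2 ^ m) mu ^+ k *: od v k.
have split_sum (z : R[i]) v : z ^+ 2 = mu ->
    \sum_(0 <= k < 2 ^ m.+1) z ^+ k *: v k = E v + z *: O v.
  move=> z2; rewrite expnS even_odd scaler_sumr; congr (_ + _).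
    by apply: eq_bigr => k _; rewrite exprM z2.
  by apply: eq_bigr => k _; rewrite exprS exprM z2 scalerA.
have lhsE : \sum_(v <- vs) \sum_(0 <= k < 2 ^ m.+1) nrm (v k) ^+ 2 =
    \sum_(v <- vs) (\sum_(0 <= k < 2 ^ m) nrm (ev v k) ^+ 2 + \sum_(0 <= k < 2 ^ m) nrm (od v k) ^+ 2).
  by apply: eq_bigr => v _; rewrite expnS even_odd.
rewrite lhsE; set A := \sum_(v <- vs) _ in le_mu *.
pose Sp (c : R[i]) := \sum_(v <- vs) nrm (E v + c *: O v) ^+ 2.
(* One of the two square roots of mu does at least as well as their average. *)
have sumSp : Sp l + Sp (- l) = 2 * \sum_(v <- vs) (nrm (E v) ^+ 2 + nrm (O v) ^+ 2).
  rewrite -big_split mulr_sumr; apply: eq_bigr => v _ /=.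
  by rewrite scaleNr parallelogram nrmZ l1 mul1r.
have [hl|hl] := leP A (Sp l).
  exists l => //; apply: (le_trans hl); rewrite le_eqVlt; apply/orP; left; apply/eqP.
  by apply: eq_bigr => v _; rewrite split_sum.
exists (- l); first by rewrite normcN.
apply: (@le_trans _ _ (Sp (- l))); first by move: le_mu; rewrite -/E -/O; lra.
rewrite le_eqVlt; apply/orP; left; apply/eqP.
by apply: eq_bigr => v _; rewrite split_sum// sqrrN.
Qed.

(** * Approximate eigenvectors of paranormal operators *)

Section Paranormal.
Variable S : H -> H.
Hypothesis S_lin : linear S.
Hypothesis S_para : forall x, nrm (S x) ^+ 2 <= nrm (S (S x)) * nrm x.

(** Paranormality says that the ratio of |S^(k+1) x| to |S^k x| does not decrease in k, so its first
    value bounds all of them from below. *)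
Lemma iter_ge (r : R) x : 0 < r -> x != 0 -> r * nrm x <= nrm (S x) ->
  forall k, r ^+ k * nrm x <= nrm (iter k S x).
Proof.
move=> r0 x0 hx.
suff H1 k : 0 < nrm (iter k S x) /\ r * nrm (iter k S x) <= nrm (iter k.+1 S x).
  elim=> [|k IH]; first by rewrite expr0 mul1r.
  have [_ h] := H1 k; apply: le_trans h; rewrite exprS -mulrA ler_wpM2l//; exact: ltW.
elim: k => [|k [p0 IH]]; first by rewrite nrm_gt0.
have p1 : 0 < nrm (iter k.+1 S x) by apply: lt_le_trans IH; rewrite mulr_gt0.
split => //; rewrite -(ler_pM2r p0) -(ler_pM2r p1).
apply: (@le_trans _ _ (nrm (iter k.+1 S x) ^+ 2 * nrm (iter k.+1 S x))).
  by rewrite expr2 ler_wpM2r ?(ltW p1)// mulrAC ler_wpM2r ?(ltW p1).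
by rewrite ler_wpM2r ?(ltW p1)// !iterS S_para.
Qed.

Lemma iter_le (c : R) x : 0 <= c -> bounded_by c S ->
  forall k, nrm (iter k S x) <= c ^+ k * nrm x.
Proof.
move=> c0 Sc; elim=> [|k IH]; first by rewrite expr0 mul1r.
by rewrite iterS (le_trans (Sc _))// exprS -mulrA ler_wpM2l.
Qed.

(** Take y as the sum of mu^(-k) S^k x over k < 2^m. Then S y - mu y telescopes to two boundary
    terms, while [unit_root_energy] selects the argument of mu so that |y|^2 is at least the sum of
    the squared norms of the summands. *)
Lemma approx_eigenvector_of_growth (r c : R) x m : 0 < r -> 0 <= c -> bounded_by c S ->
  x != 0 -> r * nrm x <= nrm (S x) ->
  exists mu y, [/\ normc mu = r, (2 ^ m)%:R * nrm x ^+ 2 <= nrm y ^+ 2 &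
    nrm (S y - mu *: y) <= r * ((c / r) ^+ (2 ^ m) + 1) * nrm x].
Proof.
move=> r0 c0 Sc x0 hx.
have [l l1 le_l] := unit_root_energy m [:: fun k => (r^-1 ^+ k)%:C *: iter k S x].
pose d : R[i] := l / r%:C.
have d0 : d != 0.
  by rewrite -normc_gt0 Normc.normcM l1 Normc.normcV normc_real gtr0_norm// mul1r invr_gt0.
have nd : normc d = r^-1.
  by rewrite Normc.normcM l1 mul1r Normc.normcV normc_real gtr0_norm.
have ndX k : normc (d ^+ k) = r^-1 ^+ k.
  by elim: k => [|k IH]; rewrite ?Normc.normc1// !exprS Normc.normcM nd IH.
pose t k := d ^+ k *: iter k S x.
pose y := \sum_(0 <= k < 2 ^ m) t k.
exists d^-1, y; split.
- by rewrite Normc.normcV nd invrK.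
- move: le_l; rewrite !big_seq1.
  have -> : \sum_(0 <= k < 2 ^ m) l ^+ k *: ((r^-1 ^+ k)%:C *: iter k S x) = y.
    by apply: eq_bigr => k _; rewrite scalerA /t rmorphXn -exprMn fmorphV.
  apply: le_trans; rewrite -[X in X%:R * _](subn0 (2 ^ m)%N) mulr_natl -sumr_const_nat.
  apply: ler_sum_nat => k _; rewrite ler_pXn2r ?nnegrE ?nrm_ge0//.
  rewrite nrmZ normc_real ger0_norm ?exprn_ge0 ?invr_ge0 ?(ltW r0)//.
  by rewrite exprVn ler_pdivlMl ?exprn_gt0// iter_ge.
- have -> : S y - d^-1 *: y = d^-1 *: (t (2 ^ m)%N - t 0%N).
    rewrite -telescope_sumr// (lin_sum S_lin) !scaler_sumr -sumrB; apply: eq_bigr => k _.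
    rewrite (linZ S_lin) scalerBr; congr (_ - _).
    by rewrite /t exprS scalerA mulKf.
  rewrite nrmZ Normc.normcV nd invrK -mulrA ler_wpM2l ?(ltW r0)//.
  rewrite (le_trans (nrmD _ _))// nrmN mulrDl mul1r; apply: lerD.
    rewrite nrmZ ndX expr_div_n exprVn mulrC mulrAC ler_wpM2r ?invr_ge0 ?exprn_ge0 ?(ltW r0)//.
    exact: iter_le.
  by rewrite /t expr0 scale1r.
Qed.

(** The threshold r > K is fixed before e, so later constants may depend on it. *)
Lemma approx_eigenvector (L K : R) : bounded_by L S -> 0 < K -> ~ bounded_by K S ->
  exists2 r : R, K < r & forall e : R, 0 < e -> exists mu y,
    [/\ r <= normc mu, normc mu <= L, y != 0 & nrm (S y - mu *: y) <= e * nrm y].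
Proof.
move=> SL K0 nSK; pose E := [set q | exists2 x, x != 0 & q = nrm (S x) / nrm x].
have Eub : ubound E L.
  by move=> _ [x x0 ->]; rewrite ler_pdivrMr ?nrm_gt0.
have [x1 hx1] : exists x, K * nrm x < nrm (S x).
  apply: contrapT => h; apply: nSK => x; rewrite leNgt; apply/negP => hx.
  by apply: h; exists x.
have x10 : x1 != 0.
  by apply/eqP => e; move: hx1; rewrite e (lin0 S_lin) nrm0 mulr0 ltxx.
have E1 : E (nrm (S x1) / nrm x1) by exists x1.
have hE : has_sup E by split; [exists (nrm (S x1) / nrm x1)|exists L].
pose c := sup E.
have cE q : E q -> q <= c by move=> Eq; apply: ub_le_sup => //; exists L.
have Kc : K < c by rewrite (lt_le_trans _ (cE _ E1))// ltr_pdivlMr// nrm_gt0.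
have cL : c <= L by apply: ge_sup => //; exists (nrm (S x1) / nrm x1).
have c0 : 0 < c by lra.
have Sc : bounded_by c S.
  move=> x; have [->|x0] := eqVneq x 0; first by rewrite (lin0 S_lin) nrm0 mulr0.
  by rewrite -ler_pdivrMr ?nrm_gt0// cE//; exists x.
exists ((K + c) / 2); first by lra.
move=> e e0; pose N0 := Num.truncn (9 * c ^+ 2 / e ^+ 2).
(* The residual will be at most 3 c |x| and |y| at least sqrt n |x|. *)
have [N [n nE nbig]] : exists N, exists2 n, n = (2 ^ N)%N & 9 * c ^+ 2 <= e ^+ 2 * n%:R.
  exists N0, (2 ^ N0)%N => //.
  rewrite [leRHS]mulrC -ler_pdivrMr ?exprn_gt0//; apply: (le_trans (ltW (truncnS_gt _))).
  by rewrite ler_nat; exact: ltn_expl.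
have n0 : 0 < n%:R :> R by rewrite nE ltr0n expn_gt0.
(* With r = c (1 - d), the first entry gives (c / r)^n <= 2 by Bernoulli's inequality and the second
   keeps r above (K + c) / 2. *)
pose d := Num.min (2 * n%:R)^-1 (1 - (K + c) / 2 / c).
have d0 : 0 < d.
  by rewrite lt_min invr_gt0 mulr_gt0//= subr_gt0 ltr_pdivrMr//; lra.
have d1 : d <= (2 * n%:R)^-1 by rewrite ge_min lexx.
have d2 : d <= 1 - (K + c) / 2 / c by rewrite ge_min lexx orbT.
have rc : (K + c) / 2 <= c * (1 - d).
  by rewrite [leRHS]mulrC -ler_pdivrMr//; lra.
have d11 : d < 1 by have : 0 < (K + c) / 2 / c by [rewrite !divr_gt0//; lra]; lra.
set r := c * (1 - d) in rc *.
have r0 : 0 < r by lra.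
have rltc : r < c by rewrite /r; nra.
have cr2 : (c / r) ^+ n <= 2.
  have h : 1 - n%:R * d <= (1 - d) ^+ n.
    elim: (n) => [|k IH]; first by rewrite mul0r subr0 expr0.
    rewrite exprS -natr1; have k0 : 0 <= k%:R :> R by [].
    have : (1 - d) * (1 - k%:R * d) <= (1 - d) * (1 - d) ^+ k by rewrite ler_wpM2l//; lra.
    nra.
  have h2 : 2^-1 <= (1 - d) ^+ n.
    have hn2 : d * (2 * n%:R) <= 1 by rewrite -ler_pdivlMr ?mulr_gt0// div1r.
    by apply: le_trans h; move: hn2; move: (n%:R : R) => a; lra.
  have -> : c / r = (1 - d)^-1 by rewrite /r; field; rewrite !gt_eqF//; lra.
  rewrite exprVn -[leRHS]invrK lef_pV2 ?posrE ?exprn_gt0 ?invr_gt0//; lra.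
have cr0 : 0 < c - r by rewrite subr_gt0.
have [_ [x x0 ->]] := sup_adherent cr0 hE.
rewrite -/c opprB addrC subrK ltr_pdivlMr ?nrm_gt0// => /ltW rx.
have [mu [y [m1 m2 m3]]] := approx_eigenvector_of_growth N r0 (ltW c0) Sc x0 rx.
rewrite -nE in m2 m3.
have nx : 0 < nrm x ^+ 2 by rewrite exprn_gt0// nrm_gt0.
have ny : 0 < nrm y ^+ 2 by apply: lt_le_trans m2; rewrite mulr_gt0.
exists mu, y; rewrite m1; split => //; first by rewrite (le_trans (ltW rltc)).
  by apply/eqP => y0; move: ny; rewrite y0 nrm0 expr0n ltxx.
rewrite -(@ler_pXn2r _ 2)// ?nnegrE ?mulr_ge0 ?nrm_ge0 ?(ltW e0)//.
apply: (@le_trans _ _ ((3 * c * nrm x) ^+ 2)).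
  rewrite ler_pXn2r// ?nnegrE ?mulr_ge0 ?nrm_ge0 ?(ltW c0)//.
  apply: (le_trans m3); rewrite ler_wpM2r ?nrm_ge0//.
  have : r * ((c / r) ^+ n + 1) <= r * 3 by rewrite ler_wpM2l ?(ltW r0)//; lra.
  lra.
rewrite !exprMn; apply: (@le_trans _ _ (e ^+ 2 * (n%:R * nrm x ^+ 2))).
  rewrite mulrA ler_wpM2r ?(ltW nx)//; apply: le_trans nbig.
  by rewrite ler_wpM2r ?sqr_ge0// expr2 -natrM ler_nat.
by rewrite ler_wpM2l// ?sqr_ge0.
Qed.

End Paranormal.
End InnerProduct.

(** * Semigroups and the spectral region *)

Section OperatorBounds.
Variables (R : realType) (X : normedModType R[i]).

(** [opnorm] is an infimum, hence the strict inequality. *)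
Lemma opnorm_bound (B : graph X) (r r' : R) : (opnorm B <= r%:E)%E -> r < r' ->
  op_bound B r'.
Proof.
move=> Br rr'; have : (opnorm B < r'%:E)%E by apply: le_lt_trans Br _; rewrite lte_fin.
move=> /ereal_inf_lt[_ [c [c0 [B1 B2]] <-]]; rewrite lte_fin => cr'.
split => // x y Bxy; apply: (le_trans (B2 x y Bxy)).
by rewrite ler_wpM2r// lecR ltW.
Qed.

Lemma decay_op_bound (S : R -> graph X) (A : graph X) (beta : R) : decay S A beta ->
  exists K t1 : R, [/\ 0 < K, 0 < t1 & forall t, t1 <= t ->
    op_bound (op_mul (S t) (op_inv (op_shift 1%R A))) (K * t `^ (- beta^-1))].
Proof.
move=> [M [t1 [M0 Mt]]]; exists (M + 1), (Num.max 1 t1); split.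
- by rewrite addr_gt0.
- by rewrite lt_max ltr01.
- move=> t; rewrite ge_max => /andP[t1' tt1]; have t0 : 0 < t by lra.
  apply: opnorm_bound (Mt t tt1) _.
  by rewrite ltr_pM2r ?powR_gt0// ltrDl.
Qed.

End OperatorBounds.

Section Semigroup.
Variables (R : realType) (X : normedModType R[i]) (T : R -> X -> X) (A : graph X).
Hypothesis T_sg : bounded_C0_semigroup T.
Hypothesis A_gen : generator T = op_opp A.

Lemma A_generatorE y w : A y w = generator T y (- w).
Proof. by rewrite A_gen /op_opp opprK. Qed.

Lemma semigroup_bound : exists2 M : R, 1 <= M & forall t, 0 <= t -> forall x,
  nrm (T t x) <= M * nrm x.
Proof.
have [M MP] := C0sg_bounded T_sg; exists (Num.max 1 M); first by rewrite le_max lexx.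
move=> t t0 x; have := MP t t0 x; rewrite !nrmE -rmorphM lecR => h.
by rewrite (le_trans h)// ler_wpM2r ?nrm_ge0// le_max lexx orbT.
Qed.

(** Since -A is the generator, T h y = y - h w + o(h): one Euler step. *)
Lemma generator_approx y w (z : R[i]) (e : R) : A y w -> 0 < e ->
  exists2 d : R, 0 < d & forall h : R, 0 < h -> h < d ->
    nrm (T h y - (1 - h%:C * z) *: y) <= h * (nrm (w - z *: y) + e).
Proof.
rewrite A_generatorE => /cvgrPdist_lt Tyw e0.
have /Tyw[d /= d0 dP] : 0 < e%:C by rewrite ltcR.
exists d => // h h0 hd; have := dP h; rewrite /= sub0r normrN gtr0_norm// => /(_ hd h0).
rewrite nrmE ltcR => he.
have -> : T h y - (1 - h%:C * z) *: y =
    h%:C *: (((h^-1)%:C *: (T h y - y) + w) - (w - z *: y)).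
  rewrite [in RHS]opprD opprK addrA addrK scalerDr scalerA -rmorphM mulfV ?gt_eqF// scale1r.
  by rewrite scalerBl scale1r opprB scalerA addrA addrAC.
rewrite nrmZ normc_real gtr0_norm// ler_wpM2l ?(ltW h0)//.
rewrite (le_trans (nrmD _ _))// nrmN addrC lerD2l ltW//.
by move: he; rewrite -opprD nrmN addrC.
Qed.

Variable M : R.
Hypothesis M_ge1 : 1 <= M.
Hypothesis T_le : forall t, 0 <= t -> forall x, nrm (T t x) <= M * nrm x.

(* [T h] acts on an approximate eigenvector [y] almost as the scalar [c]. *)
Lemma telescoped_power (h : R) (c : R[i]) y n : 0 <= h ->
  nrm (T (n%:R * h) y - c ^+ n *: y) <=
  (\sum_(0 <= k < n) normc c ^+ k) * (M * nrm (T h y - c *: y)).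
Proof.
move=> h0; elim: n => [|n IH].
  by rewrite mul0r (C0sg_0 T_sg) expr0 scale1r subrr nrm0 big_geq// mul0r.
have nh : 0 <= n%:R * h by rewrite mulr_ge0.
have -> : T (n.+1%:R * h) y - c ^+ n.+1 *: y =
    T (n%:R * h) (T h y - c *: y) + c *: (T (n%:R * h) y - c ^+ n *: y).
  rewrite -natr1 mulrDl mul1r (C0sg_D T_sg)// (linB (C0sg_linear T_sg nh)).
  rewrite (linZ (C0sg_linear T_sg nh)) scalerBr scalerA -exprS.
  by rewrite addrA subrK.
rewrite big_nat_recl// expr0 mulrDl mul1r (le_trans (nrmD _ _))// lerD ?T_le//.
rewrite nrmZ; under eq_bigr do rewrite exprS.
by rewrite -mulr_sumr -mulrA ler_wpM2l ?normc_ge0.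
Qed.

Lemma geometric_sum (q : R) n : (q - 1) * \sum_(0 <= k < n) q ^+ k = q ^+ n - 1.
Proof.
elim: n => [|n IH]; first by rewrite big_geq// mulr0 expr0 subrr.
by rewrite big_nat_recr//= mulrDr IH exprS; ring.
Qed.

Lemma bernoulli (x : R) n : - 1 <= x -> 1 + n%:R * x <= (1 + x) ^+ n.
Proof.
move=> x1; elim: n => [|n IH]; first by rewrite mul0r addr0.
rewrite exprS -natr1; have n0 : 0 <= n%:R :> R by [].
have : (1 + x) * (1 + n%:R * x) <= (1 + x) * (1 + x) ^+ n by rewrite ler_wpM2l//; lra.
nra.
Qed.

(** For Re z < 0 the scalar c = 1 - h z has modulus above 1. As T is bounded, the growth of |c|^n
    |y| must be compensated by the telescoped errors, which forces (|c| - 1) |y| <= M |T h y - c y|;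
    then divide by h. *)
Lemma generator_bounded_below y w (z : R[i]) : A y w -> complex.Re z < 0 ->
  - complex.Re z * nrm y <= M * nrm (w - z *: y).
Proof.
move=> Ayw z0; apply/ler_addgt0Pl => e e0; have M0 : 0 < M := lt_le_trans ltr01 M_ge1.
have eM : 0 < e / M by rewrite divr_gt0.
have [d d0 dP] := generator_approx z Ayw eM.
pose h := d / 2; have h0 : 0 < h by rewrite divr_gt0.
have hd : h < d by rewrite /h; lra.
have := dP h h0 hd; set c := 1 - _ => hc.
have c1 : 1 + h * (- complex.Re z) <= normc c.
  apply: le_trans (normc_ge_absRe c); apply: le_trans (ler_norm _).
  by rewrite /c; case: (z) => a b /=; lra.
have hz : 0 < h * - complex.Re z by rewrite mulr_gt0//; lra.
have cgt1 : 0 < normc c - 1 by lra.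
suff : (normc c - 1) * nrm y <= M * nrm (T h y - c *: y).
  move=> H; have : h * (- complex.Re z * nrm y) <= h * (e + M * nrm (w - z *: y)).
    have ny := nrm_ge0 y.
    apply: (@le_trans _ _ ((normc c - 1) * nrm y)); first by nra.
    apply: (le_trans H); apply: (@le_trans _ _ (M * (h * (nrm (w - z *: y) + e / M)))).
      by rewrite ler_wpM2l// ltW.
    by rewrite le_eqVlt; apply/orP; left; apply/eqP; field; rewrite gt_eqF.
  by rewrite ler_pM2l.
(* With a positive gap g the product |c|^n g would stay below a bound that does not depend on n,
   although |c|^n >= 1 + n (|c| - 1). *)
rewrite leNgt; apply/negP => H.
set D := nrm (T h y - _) in H hc; set g := (normc c - 1) * nrm y - M * D.
have g0 : 0 < g by rewrite subr_gt0.
have [n nn] : exists n : nat, (normc c - 1) * (M * nrm y) / g / (normc c - 1) < n%:R.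
  by exists (Num.truncn ((normc c - 1) * (M * nrm y) / g / (normc c - 1))).+1; exact: truncnS_gt.
have := telescoped_power c y n (ltW h0); rewrite -/D => tp.
have h1 : (normc c - 1) * nrm (T (n%:R * h) y - c ^+ n *: y) <= (normc c ^+ n - 1) * (M * D).
  by rewrite -geometric_sum -mulrA ler_wpM2l// ltW.
have ncX : normc (c ^+ n) = normc c ^+ n.
  by elim: (n) => [|k IH]; rewrite ?expr0 ?Normc.normc1// !exprS Normc.normcM IH.
have h2 : normc c ^+ n * nrm y <= M * nrm y + nrm (T (n%:R * h) y - c ^+ n *: y).
  rewrite -ncX -nrmZ (le_trans (nrm_le_add _ (T (n%:R * h) y)))// lerD//.
    by apply: T_le; rewrite mulr_ge0// ltW.
  by rewrite nrmB.
have h3 : 1 + n%:R * (normc c - 1) <= normc c ^+ n.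
  by have := @bernoulli (normc c - 1) n; rewrite [1 + (_ - 1)]addrC subrK; apply; lra.
have D0 : 0 <= D by exact: nrm_ge0.
have h4 : normc c ^+ n * g <= (normc c - 1) * (M * nrm y).
  have := ler_wpM2l (ltW cgt1) h2; rewrite /g.
  have : 0 <= M * D by rewrite mulr_ge0// ltW.
  nra.
have h5 : (normc c - 1) * (M * nrm y) < n%:R * (normc c - 1) * g.
  by rewrite -ltr_pdivrMr// -ltr_pdivrMr.
have : (1 + n%:R * (normc c - 1)) * g <= normc c ^+ n * g by rewrite ler_wpM2r// ltW.
nra.
Qed.

(** T t y is compared with (1 - h z)^n y for n h = t, whose modulus is at least (1 - t Re z) |y| >=
    |y| / 2. *)
Lemma semigroup_lower_bound y w (z : R[i]) (t : R) : A y w -> 0 < t ->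
  t * complex.Re z <= 2^-1 -> y != 0 -> t * M * nrm (w - z *: y) <= 8^-1 * nrm y ->
  4^-1 * nrm y <= nrm (T t y).
Proof.
move=> Ayw t0 tz y0 small; have M0 : 0 < M := lt_le_trans ltr01 M_ge1.
have ny : 0 < nrm y by rewrite nrm_gt0.
have e0 : 0 < 8^-1 * nrm y / (t * M) by rewrite divr_gt0 ?mulr_gt0.
have [d d0 dP] := generator_approx z Ayw e0.
have [n n0 nd] : exists2 n : nat, 0 < n%:R :> R & t / d < n%:R.
  by exists (Num.truncn (t / d)).+1; [rewrite ltr0n|exact: truncnS_gt].
pose h := t / n%:R; have h0 : 0 < h by rewrite divr_gt0.
have hd : h < d by rewrite /h ltr_pdivrMr// mulrC -ltr_pdivrMr.
have nh : n%:R * h = t by rewrite /h; field; rewrite gt_eqF.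
have := dP h h0 hd; set c := 1 - _; set D := nrm (T h y - _) => hc.
have ncX : normc (c ^+ n) = normc c ^+ n.
  by elim: (n) => [|k IH]; rewrite ?expr0 ?Normc.normc1// !exprS Normc.normcM IH.
set E := normc c ^+ n.
have c1 : 1 - h * complex.Re z <= normc c.
  apply: le_trans (normc_ge_absRe c); apply: le_trans (ler_norm _).
  by rewrite /c; case: (z) => a b /=; lra.
have n1 : 1 <= n%:R :> R by rewrite ler1n -(ltr0n R).
have hz : h * complex.Re z <= 2^-1.
  by rewrite /h mulrAC ler_pdivrMr//; lra.
have E2 : 2^-1 <= E.
  have b := @bernoulli (- (h * complex.Re z)) n.
  apply: (@le_trans _ _ ((1 - h * complex.Re z) ^+ n)); last first.
    by rewrite lerXn2r ?nnegrE ?normc_ge0//; lra.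
  apply: le_trans (b _); last by lra.
  by rewrite mulrN mulrA nh; lra.
(* The modulus of c may lie on either side of 1. An error relative to max(1, |c|^n) suffices, so no
   upper bound for |c|^n is required. *)
have sumE : \sum_(0 <= k < n) normc c ^+ k <= n%:R * Num.max 1 E.
  rewrite mulr_natl -[X in _ *+ X](subn0 n) -sumr_const_nat.
  apply: ler_sum_nat => k /andP[_ kn]; rewrite le_max.
  have [cle|cge] := leP (normc c) 1.
    by rewrite exprn_ile1// normc_ge0.
  by apply/orP; right; rewrite ler_weXn2l ?(ltW cge)// ltnW.
have tp := telescoped_power c y n (ltW h0).
have D0 : 0 <= D by exact: nrm_ge0.
have mx0 : 0 <= Num.max 1 E by rewrite le_max ler01.
have h1 : nrm (T t y - c ^+ n *: y) <= Num.max 1 E * (4^-1 * nrm y).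
  rewrite -nh; apply: (le_trans tp); rewrite -/D.
  apply: (@le_trans _ _ (n%:R * Num.max 1 E * (M * (h * (nrm (w - z *: y) + 8^-1 * nrm y / (t * M)))))).
    by apply: ler_pM => //; [apply: sumr_ge0 => k _; rewrite exprn_ge0// normc_ge0|
       rewrite mulr_ge0// ltW|rewrite ler_wpM2l// ltW].
  have -> : n%:R * Num.max 1 E * (M * (h * (nrm (w - z *: y) + 8^-1 * nrm y / (t * M)))) =
     Num.max 1 E * (n%:R * h * M * nrm (w - z *: y) + n%:R * h / t * 8^-1 * nrm y).
    by field; rewrite !gt_eqF.
  rewrite nh divff ?gt_eqF// ler_wpM2l//; lra.
have h2 : E * nrm y <= nrm (T t y) + nrm (T t y - c ^+ n *: y).
  by rewrite /E -ncX -nrmZ [nrm (T t y - _)]nrmB nrm_le_add.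
move: h1; have [E1|E1] := leP 1 E; nra.
Qed.

Variable beta : R.
Hypothesis beta_gt0 : 0 < beta.
Hypothesis T_decay : decay (fun t => op_fun (T t)) A beta.

Lemma semigroup_decay : exists K t1 : R, [/\ 0 < K, 0 < t1 & forall t y w, t1 <= t ->
  A y w -> nrm (T t y) <= K * t `^ (- beta^-1) * nrm (y + w)].
Proof.
have [K [t1 [K0 t10 KP]]] := decay_op_bound T_decay.
exists K, t1; split => // t y w tt1 Ayw; have [_ /(_ (y + w) (T t y))] := KP t tt1.
rewrite !nrmE -rmorphM lecR; apply; exists y => //.
by rewrite /op_inv /op_shift scale1r addrC addKr.
Qed.

(** Let t be of order (1 + |z|)^beta as given by [decay_time]. If t Re z <= 1/2, then |T t y| would
    be at least |y| / 4, but the decay makes it at most (1/8 + 1/16) |y|. So Re z > 1/(2t). The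
    constant c is independent of Z; only the tolerance e depends on it. *)
Lemma approx_spectrum_region : exists2 c : R, 0 < c & forall Z : R, 0 <= Z ->
  exists2 e : R, 0 < e & forall y w (z : R[i]), y != 0 -> A y w -> normc z <= Z ->
    nrm (w - z *: y) <= e * nrm y ->
    0 < complex.Re z /\ c <= complex.Re z * (1 + normc z) `^ beta.
Proof.
have M0 : 0 < M := lt_le_trans ltr01 M_ge1.
have [K [t1 [K0 t10 KP]]] := semigroup_decay.
have [c c0 cP] := decay_time t1 K0 beta_gt0.
exists (c / 2); first by rewrite divr_gt0.
(* An upper bound for all the times t that occur with |z| <= Z. *)
move=> Z Z0; pose tm := (1 + Z) `^ beta / c.
have tm0 : 0 < tm by rewrite divr_gt0// powR_gt0//; lra.
exists (Num.min 2^-1 (8 * M * tm)^-1).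
  by rewrite lt_min !invr_gt0 ltr0n /= mulr_gt0// mulr_gt0.
move=> y w z y0 Ayw zZ hyp; have ny : 0 < nrm y by rewrite nrm_gt0.
have s1 : 1 <= 1 + normc z by rewrite lerDl normc_ge0.
have [t [t0 tt1 Kt tc]] := cP _ s1.
have {}t0 : 0 < t%:R :> R by rewrite ltr0n.
set s := 1 + normc z in s1 Kt tc *.
have hy1 : nrm (w - z *: y) <= 2^-1 * nrm y.
  by apply: (le_trans hyp); rewrite ler_wpM2r ?(ltW ny)// ge_min lexx.
have hy2 : nrm (w - z *: y) <= (8 * M * tm)^-1 * nrm y.
  by apply: (le_trans hyp); rewrite ler_wpM2r ?(ltW ny)// ge_min lexx orbT.
have ttm : t%:R <= tm.
  rewrite /tm ler_pdivlMr//; apply: (le_trans tc).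
  rewrite ge0_ler_powR ?nnegrE ?(ltW beta_gt0) ?addr_ge0 ?normc_ge0//.
  by rewrite lerD2l.
have [az|az] := leP (t%:R * complex.Re z) 2^-1; last first.
  have az0 : 0 < complex.Re z.
    by rewrite -(pmulr_rgt0 _ t0); apply: lt_trans az; rewrite invr_gt0.
  split => //; have := ler_wpM2l (ltW az0) tc.
  have : 2^-1 * c < t%:R * complex.Re z * c by rewrite ltr_pM2r.
  lra.
have small : t%:R * M * nrm (w - z *: y) <= 8^-1 * nrm y.
  have tM : 0 <= t%:R * M by rewrite mulr_ge0// ltW.
  apply: (le_trans (ler_wpM2l tM hy2)); rewrite mulrA ler_wpM2r ?(ltW ny)//.
  rewrite ler_pdivrMr; last by rewrite mulr_gt0// mulr_gt0.
  have : t%:R * M <= tm * M by rewrite ler_wpM2r// ltW.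
  lra.
have low := semigroup_lower_bound Ayw t0 az y0 small.
have up := KP _ _ _ tt1 Ayw.
have yw : nrm (y + w) <= (s + 2^-1) * nrm y.
  rewrite (_ : y + w = (1 + z) *: y + (w - z *: y)).
    rewrite (le_trans (nrmD _ _))// mulrDl lerD// nrmZ ler_wpM2r ?(ltW ny)//.
    by rewrite (le_trans (le_normcD _ _))// Normc.normc1.
  by rewrite scalerDl scale1r -addrA [_ + (w - _)]addrC subrK.
have p0 : 0 <= t%:R `^ (- beta^-1) by exact: powR_ge0.
have Kp : 0 <= K * t%:R `^ (- beta^-1) by rewrite mulr_ge0// ltW.
have := ler_wpM2l Kp yw; move: Kt up low Kp.
move: (K * t%:R `^ (- beta^-1)) => k Kt up low Kp h.
have : k * s * nrm y <= 8^-1 * nrm y by rewrite ler_wpM2r// ltW.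
have : k * nrm y <= k * s * nrm y.
  by rewrite ler_wpM2r ?(ltW ny)// ler_peMr.
lra.
Qed.

(** [semigroup_lower_bound] at z = 0: if |w| were small against |y|, then T t y would be too large
    for the decay. *)
Lemma generator_injective_bound : exists2 C : R, 0 < C & forall y w, A y w ->
  nrm y <= C * nrm w.
Proof.
have M0 : 0 < M := lt_le_trans ltr01 M_ge1.
have [K [t1 [K0 t10 KP]]] := semigroup_decay.
have [c c0 cP] := decay_time t1 K0 beta_gt0.
have [t [t0 tt1 Kt _]] := cP 1 (lexx 1).
have {}t0 : 0 < t%:R :> R by rewrite ltr0n.
exists (8 * (t%:R * M) + 1); first by rewrite addr_gt0// !mulr_gt0.
move=> y w Ayw; have nw := nrm_ge0 w.
have [->|y0] := eqVneq y 0.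
  by rewrite nrm0 mulr_ge0// addr_ge0// !mulr_ge0// ltW.
have tM : 0 <= t%:R * M * nrm w by rewrite !mulr_ge0// ltW.
have [small|] := leP (t%:R * M * nrm w) (8^-1 * nrm y); last by nra.
have low := @semigroup_lower_bound y w 0 t%:R Ayw t0.
rewrite scale0r subr0 mulr0 in low; have {}low := low _ y0 small.
have {}low : 4^-1 * nrm y <= nrm (T t%:R y) by apply: low; rewrite invr_ge0.
have up := KP _ _ _ tt1 Ayw; rewrite mulr1 in Kt.
have yw := nrmD y w; have nyw := nrm_ge0 (y + w).
have : nrm (T t%:R y) <= 8^-1 * (nrm y + nrm w).
  apply: (le_trans up); apply: (@le_trans _ _ (8^-1 * nrm (y + w))).
    by rewrite ler_wpM2r.
  by rewrite ler_wpM2l.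
nra.
Qed.

End Semigroup.

(** * Normal operators *)

Section PolynomialAction.
Variables (R : realType) (X : normedModType R[i]) (J : X -> X).
Hypothesis J_lin : linear J.
Implicit Types (p q : {poly R[i]}) (x u : X).

(** The vector p(J) x. *)
Definition pact p x := \sum_(i < size p) p`_i *: iter i J x.

Lemma pactE n p x : (size p <= n)%N -> pact p x = \sum_(i < n) p`_i *: iter i J x.
Proof.
move=> pn; rewrite /pact (big_ord_widen n (fun i => p`_i *: iter i J x))//.
rewrite big_mkcond; apply: eq_bigr => i _; case: ifPn => //.
by rewrite -leqNgt => /leq_sizeP/(_ i (leqnn _)) ->; rewrite scale0r.
Qed.

Lemma pactD p q x : pact (p + q) x = pact p x + pact q x.
Proof.
pose n := maxn (size p) (size q).
rewrite (@pactE n) ?size_polyD// (@pactE n p) ?leq_maxl// (@pactE n q) ?leq_maxr//.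
by rewrite -big_split; apply: eq_bigr => i _; rewrite coefD scalerDl.
Qed.

Lemma pactZ a p x : pact (a *: p) x = a *: pact p x.
Proof.
rewrite (@pactE (size p)) ?size_scale_leq// /pact scaler_sumr.
by apply: eq_bigr => i _; rewrite coefZ scalerA.
Qed.

Lemma pactMX p x : pact (p * 'X) x = J (pact p x).
Proof.
rewrite (@pactE (size p).+1); last first.
  by rewrite (leq_trans (size_polyMleq _ _))// size_polyX addn2.
rewrite big_ord_recl coefMX /= scale0r add0r /pact (lin_sum J_lin).
by apply: eq_bigr => i _; rewrite coefMX /= (linZ J_lin).
Qed.

Lemma pact1 x : pact 1 x = x.
Proof. by rewrite /pact size_poly1 big_ord1 coef1 scale1r. Qed.

Definition affine_word (I : eqType) (f : I -> R[i] * R[i]) (s : seq I) x :=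
  foldr (fun w y => (f w).1 *: y + (f w).2 *: J y) x s.

Lemma pact_affine (I : eqType) (f : I -> R[i] * R[i]) s x :
  pact (\prod_(w <- s) ((f w).1%:P + (f w).2 *: 'X)) x = affine_word f s x.
Proof.
elim: s => [|w s IH]; first by rewrite big_nil pact1.
rewrite big_cons mulrDl mul_polyC -scalerAl [('X * _)]mulrC pactD !pactZ pactMX.
by rewrite IH.
Qed.

Lemma affine_wordJ (I : eqType) (f : I -> R[i] * R[i]) s x : affine_word f s (J x) = J (affine_word f s x).
Proof.
by elim: s => [//|w s IH] /=; rewrite IH (linD J_lin) !(linZ J_lin).
Qed.

Lemma affine_word_linear (I : eqType) (f : I -> R[i] * R[i]) s : linear (affine_word f s).
Proof.
elim: s => [//|w s IH] a x y /=; rewrite IH J_lin !scalerDr !scalerA.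
by rewrite addrACA [a * (f w).1]mulrC [a * (f w).2]mulrC.
Qed.

Lemma affine_word_bound (I : eqType) (f : I -> R[i] * R[i]) s (c l : R) x : 0 <= c -> 0 <= l ->
  (forall x, nrm (J x) <= c * nrm x) ->
  (forall w, w \in s -> normc (f w).1 + normc (f w).2 * c <= l) ->
  nrm (affine_word f s x) <= l ^+ size s * nrm x.
Proof.
move=> c0 l0 Jc; elim: s => [_|w s IH sl] /=; first by rewrite mul1r.
have {}IH := IH (fun v vs => sl v (mem_behead (vs : v \in behead (w :: s)))).
rewrite (le_trans (nrmD _ _))// !nrmZ exprS -mulrA.
apply: (@le_trans _ _ ((normc (f w).1 + normc (f w).2 * c) * nrm (affine_word f s x))).
  by rewrite mulrDl lerD2l -mulrA ler_wpM2l ?normc_ge0.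
by apply: ler_pM => //; rewrite ?addr_ge0 ?mulr_ge0 ?normc_ge0 ?nrm_ge0// sl ?mem_head.
Qed.

(** If every factor J - w were bounded below by eta, their product would be bounded below by eta to
    the number of factors. *)
Lemma root_word_factor (s : seq R[i]) (eta : R) u : 0 < eta ->
  nrm (affine_word (fun w : R[i] => (- w, 1)) s u) < eta ^+ size s * nrm u ->
  exists w v, [/\ w \in s, v != 0 & nrm (J v - w *: v) <= eta * nrm v].
Proof.
move=> eta0; apply: contraPP => nex; apply/negP; rewrite -leNgt.
have {}nex w v : w \in s -> eta * nrm v <= nrm (J v - w *: v).
  move=> ws; have [->|v0] := eqVneq v 0.
    by rewrite (lin0 J_lin) scaler0 subr0 nrm0 mulr0.
  by rewrite leNgt; apply/negP => h; apply: nex; exists w, v; split => //; exact: ltW.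
elim: s nex => [_|w s IH nex] /=; first by rewrite mul1r.
have h := IH (fun v x vs => nex v x (mem_behead (vs : v \in behead (w :: s)))).
rewrite scaleNr scale1r addrC exprS -mulrA.
apply: le_trans (nex _ _ (mem_head _ _)).
by rewrite ler_wpM2l// ltW.
Qed.

End PolynomialAction.

Section ProductBounds.
Variables (R : realType) (I : eqType) (s : seq I) (F : I -> R) (c : R).

Lemma prod_le_exp : (forall o, o \in s -> 0 <= F o <= c) ->
  \prod_(o <- s) F o <= c ^+ size s.
Proof.
move=> Fc; apply: (@le_trans _ _ (\prod_(o <- s) c)).
  by rewrite big_seq [leRHS]big_seq; exact: ler_prod.
by rewrite big_const_seq count_predT iter_mulr_1.
Qed.

Lemma exp_le_prod : 0 <= c -> (forall o, o \in s -> c <= F o) ->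
  c ^+ size s <= \prod_(o <- s) F o.
Proof.
move=> c0 Fc; apply: (@le_trans _ _ (\prod_(o <- s) c)).
  by rewrite big_const_seq count_predT iter_mulr_1.
by rewrite big_seq [leRHS]big_seq; apply: ler_prod => o os; rewrite c0 Fc.
Qed.

End ProductBounds.

(** * The polynomial that links mu with 1/z *)

Section CayleyPolynomial.
Variable R : realType.
Implicit Types (s : seq R) (mu w : R[i]).

(* With [w = z^-1], a root [w] means that [mu] is the value at [z] of the product
   of the Cayley factors divided by [z]. *)
Definition cayley_poly s mu : {poly R[i]} :=
  'X * \prod_(o <- s) (1%:P + (- o%:C) *: 'X) - mu *: \prod_(o <- s) (1%:P + o%:C *: 'X).

Lemma size_affine (c : R[i]) : c != 0 -> size (1%:P + c *: 'X : {poly R[i]}) = 2.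
Proof.
move=> c0; rewrite addrC size_polyDl ?size_scale ?size_polyX//.
by rewrite size_polyC oner_eq0.
Qed.

Lemma lead_affine (c : R[i]) : c != 0 -> lead_coef (1%:P + c *: 'X : {poly R[i]}) = c.
Proof.
move=> c0; rewrite addrC lead_coefDl; last first.
  by rewrite size_scale// size_polyX size_polyC oner_eq0.
by rewrite lead_coefZ lead_coefX mulr1.
Qed.

Lemma size_prod_affine (f : R -> R[i]) s : (forall o, o \in s -> f o != 0) ->
  size (\prod_(o <- s) (1%:P + f o *: 'X : {poly R[i]})) = (size s).+1.
Proof.
elim: s => [_|o s IH fs]; first by rewrite big_nil size_poly1.
have {}IH := IH (fun v vs => fs v (mem_behead (vs : v \in behead (o :: s)))).
have q0 : \prod_(o <- s) (1%:P + f o *: 'X : {poly R[i]}) != 0.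
  by rewrite -size_poly_eq0 IH.
rewrite big_cons size_mul// ?IH ?size_affine ?fs ?mem_head//.
by rewrite -size_poly_eq0 size_affine ?fs ?mem_head.
Qed.

(** The term with mu has smaller degree than the first one, so the leading coefficient does not
    depend on mu. *)
Lemma cayley_poly_lead s mu : all (fun o => 0 < o) s ->
  size (cayley_poly s mu) = (size s).+2 /\
  normc (lead_coef (cayley_poly s mu)) = \prod_(o <- s) o.
Proof.
move=> /allP s0.
have f0 o : o \in s -> o%:C != 0 :> R[i].
  by move=> /s0 o0; rewrite eq_complex /= eqxx andbT gt_eqF.
have nf0 o : o \in s -> - o%:C != 0 :> R[i] by rewrite oppr_eq0; exact: f0.
have s1 : size ('X * \prod_(o <- s) (1%:P + (- o%:C) *: 'X) : {poly R[i]}) = (size s).+2.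
  rewrite mulrC size_mulX ?size_prod_affine//.
  by rewrite -size_poly_eq0 size_prod_affine.
have s2 : (size (- (mu *: \prod_(o <- s) (1%:P + o%:C *: 'X)) : {poly R[i]})%R <
    size ('X * \prod_(o <- s) (1%:P + (- o%:C) *: 'X)%R : {poly R[i]})%R)%N.
  by rewrite s1 size_polyN ltnS (leq_trans (size_scale_leq _ _))// size_prod_affine.
rewrite /cayley_poly size_polyDl// lead_coefDl// s1; split => //.
rewrite lead_coefM lead_coefX mul1r lead_coef_prod.
rewrite (big_morph (@Normc.normc R) (@Normc.normcM R) (Normc.normc1 R)).
apply: eq_big_seq => o os; rewrite lead_affine ?nf0// normcN normc_real.
by rewrite gtr0_norm// s0.
Qed.

Lemma cayley_poly_root s mu w : root (cayley_poly s mu) w ->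
  w * \prod_(o <- s) (1 - o%:C * w) = mu * \prod_(o <- s) (1 + o%:C * w).
Proof.
rewrite rootE /cayley_poly !hornerE !horner_prod subr_eq0 => /eqP.
under eq_bigr do rewrite !hornerE mulNr.
by under [in RHS]eq_bigr do rewrite !hornerE.
Qed.

(** If |w| <= 1/(2q), all factors 1 - o w and 1 + o w have modulus between 1/2 and 3/2, so r 2^(-n)
    <= |w| (3/2)^n. Hence z = 1/w is bounded, as [approx_spectrum_region] requires. *)
Lemma cayley_poly_root_lower (q r : R) n : 0 < q -> 0 < r ->
  exists2 k : R, 0 < k & forall s mu w, size s = n -> all (fun o => 0 < o <= q) s ->
    r <= normc mu -> root (cayley_poly s mu) w -> k <= normc w.
Proof.
move=> q0 r0; exists (Num.min (2 * q)^-1 (r / 3 ^+ n)).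
  by rewrite lt_min invr_gt0 mulr_gt0//= divr_gt0// exprn_gt0.
move=> s mu w sn /allP sq rmu /cayley_poly_root/(congr1 (@Normc.normc R)).
rewrite !Normc.normcM !(big_morph (@Normc.normc R) (@Normc.normcM R) (Normc.normc1 R)).
move=> e; rewrite leNgt; apply/negP; rewrite lt_min => /andP[w1 w2].
have oq o : o \in s -> normc (o%:C * w) <= 2^-1.
  move=> /sq /andP[ o0 oq]; rewrite Normc.normcM normc_real gtr0_norm//.
  apply: (@le_trans _ _ (q * normc w)); first by rewrite ler_wpM2r ?normc_ge0.
  have := w1; rewrite -[_^-1]mul1r ltr_pdivlMr ?mulr_gt0// => h; lra.
have u1 : \prod_(o <- s) normc (1 - o%:C * w) <= (3 / 2) ^+ n.
  rewrite -sn; apply: prod_le_exp => o /oq h; rewrite normc_ge0/=.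
  by apply: (le_trans (le_normcD _ _)); rewrite Normc.normc1 normcN; lra.
have u2 : 2^-1 ^+ n <= \prod_(o <- s) normc (1 + o%:C * w).
  rewrite -sn; apply: exp_le_prod => [|o /oq h]; first by rewrite invr_ge0.
  have := le_normcD (1 + o%:C * w) (- (o%:C * w)).
  by rewrite addrK Normc.normc1 normcN; lra.
have : r * 2^-1 ^+ n <= normc w * (3 / 2) ^+ n.
  apply: (@le_trans _ _ (normc mu * \prod_(o <- s) normc (1 + o%:C * w))).
    by apply: ler_pM => //; rewrite ?exprn_ge0 ?invr_ge0 ?(ltW r0).
  by rewrite -e ler_wpM2l// normc_ge0.
rewrite [(3 / 2) ^+ n]exprMn mulrA ler_pM2r ?exprn_gt0 ?invr_gt0//.
by move: w2; rewrite ltr_pdivlMr ?exprn_gt0// => /lt_le_trans/[apply]; rewrite ltxx.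
Qed.

Lemma cayley_poly_root_value s mu z : all (fun o => 0 < o) s -> 0 < complex.Re z ->
  root (cayley_poly s mu) z^-1 ->
  normc mu = \prod_(o <- s) normc ((z - o%:C) / (z + o%:C)) / normc z.
Proof.
move=> /allP s0 z0 /cayley_poly_root/(congr1 (@Normc.normc R)) e.
have zn0 : z != 0 by apply/eqP => h; move: z0; rewrite h ltxx.
have d0 o : o \in s -> z + o%:C != 0.
  move=> /s0 o0; apply/eqP => /(congr1 (@complex.Re R)); rewrite ReD /=; lra.
have P0 : \prod_(o <- s) normc (1 + o%:C * z^-1) != 0.
  rewrite prodf_seq_neq0; apply/allP => o os /=.
  rewrite gt_eqF// normc_gt0.
  have -> : 1 + o%:C * z^-1 = (z + o%:C) / z by rewrite mulrDl mulfV.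
  by rewrite mulf_neq0 ?invr_eq0 ?d0.
apply: (mulIf P0); move: e; rewrite !Normc.normcM.
rewrite !(big_morph (@Normc.normc R) (@Normc.normcM R) (Normc.normc1 R)) => <-.
rewrite Normc.normcV mulrAC mulrC; congr (_ / _).
rewrite -big_split /= big_seq [RHS]big_seq; apply: eq_bigr => o os.
by rewrite -Normc.normcM; congr normc; field; rewrite zn0 d0.
Qed.

End CayleyPolynomial.

(** * Bounded invertibility of a normal generator *)

Section NormalGenerator.
Variables (R : realType) (H : completeNormedModType R[i]).
Variables (ip : {dot H for @Num.conj R[i]}) (T : R -> H -> H) (A : graph H) (beta : R).
Hypothesis ip_norm : induces_norm ip.
Hypothesis T_sg : bounded_C0_semigroup T.
Hypothesis A_gen : generator T = op_opp A.
Hypothesis A_normal : normal_op ip A.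
Hypothesis beta_gt0 : 0 < beta.
Hypothesis T_decay : decay (fun t => op_fun (T t)) A beta.

Lemma generator_linear (a : R[i]) x u y v : A x u -> A y v -> A (a *: x + y) (a *: u + v).
Proof.
rewrite !(A_generatorE A_gen) => xu yv.
have -> : - (a *: u + v) = a *: (- u) + - v by rewrite opprD scalerN.
have : a *: ((h^-1)%:C *: (T h x - x)) + (h^-1)%:C *: (T h y - y) @[h --> 0^'+]
    --> a *: (- u) + - v by apply: cvgD => //; exact: cvgZr.
apply: cvg_trans; apply: near_eq_cvg; near=> h.
have h0 : 0 <= h by near: h; exact: nbhs_right_ge.
have lT := C0sg_linear T_sg h0.
by rewrite lT [in RHS]opprD [in RHS]addrACA -[in RHS]scalerBr [RHS]scalerDr !scalerA [a * _]mulrC.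
Unshelve. all: by end_near.
Qed.

Lemma generator_functional x u v : A x u -> A x v -> u = v.
Proof.
rewrite !(A_generatorE A_gen) => xu xv; apply: oppr_inj.
exact: (cvg_unique (@norm_hausdorff _ _) xu xv).
Qed.

Lemma generator0 : A 0 0.
Proof.
rewrite (A_generatorE A_gen) oppr0 /generator.
have : (0 : H) @[h --> (0 : R)^'+] --> (0 : H) by exact: cvg_cst.
apply: cvg_trans; apply: near_eq_cvg; near=> h.
have h0 : 0 <= h by near: h; exact: nbhs_right_ge.
by rewrite (lin0 (C0sg_linear T_sg h0)) subr0 scaler0.
Unshelve. all: by end_near.
Qed.

Lemma generator_seq_closed (u v : nat -> H) x y : (forall n, A (u n) (v n)) ->
  seq_cvg u x -> seq_cvg v y -> A x y.
Proof.
move=> Auv ux vy; have [_ Acl _] := A_normal.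
have cvgH (s : nat -> H) l : seq_cvg s l -> s @ \oo --> l.
  move=> sl; apply/cvgrPdist_lt => e e0.
  have er : e = (complex.Re e)%:C by rewrite RRe_real// gtr0_real.
  have [|N NP] := sl (complex.Re e); first by rewrite -ltcR -er.
  by exists N => // n /= Nn; rewrite er nrmE ltcR nrmB NP.
have := @closed_cvg _ _ (\oo) _ (fun n => (u n, v n)) _ Acl _ (x, y); apply.
  by apply: nearW => n /=.
by apply: cvg_pair; exact: cvgH.
Qed.

(** The range is closed because A is closed and bounded below. A vector v orthogonal to it is sent
    to 0 by the adjoint of A; normality then yields A v = 0, so v = 0. *)
Lemma generator_surjective x : exists y, A y x.
Proof.
have [M M1 TM] := semigroup_bound T_sg.
have [C C0 CP] := generator_injective_bound T_sg A_gen M1 TM beta_gt0 T_decay.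
pose K := [set w | exists y, A y w].
have Ks : linear_subspace K.
  split; first by exists 0; exact: generator0.
  by move=> a u v [y Ay] [z Az]; exists (a *: y + z); exact: generator_linear.
have AB y w z v : A y w -> A z v -> A (y - z) (w - v).
  by move=> Ay Az; have := generator_linear (-1) Az Ay; rewrite !scaleN1r ![- _ + _]addrC.
have Kcl : seq_closed K.
  move=> u l uK ul; have /choice[y yP] := uK.
  have [|z yz] := @complete_seq_complete R H y.
    move=> e e0; have eC : 0 < e / (2 * C) by rewrite divr_gt0// mulr_gt0.
    have [N NP] := ul _ eC; exists N => m n /NP hm /NP hn.
    rewrite (le_lt_trans (CP _ _ (AB _ _ _ _ (yP m) (yP n))))//.
    have h := nrm_triangle l (u m) (u n); rewrite [nrm (l - _)]nrmB in h.
    rewrite mulrC -ltr_pdivlMr//; apply: (le_lt_trans h).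
    have -> : e / C = e / (2 * C) + e / (2 * C) by field; rewrite gt_eqF.
    exact: ltrD.
  by exists z; exact: generator_seq_closed yz ul.
apply: contrapT => nx; have [v v0 vK] := orthogonal_vector ip_norm Ks Kcl nx.
have adjv : adjoint ip A v 0.
  move=> y w Ayw; rewrite [RHS]ipC ip0l rmorph0 ipC vK ?rmorph0//.
  by exists y.
have [_ _ comm] := A_normal.
(* Normality enters here: it places v in the domain of A and makes the adjoint annihilate A v,
   whence <A v, A v> = 0. *)
have : op_mul A (adjoint ip A) v 0 by exists 0 => //; exact: generator0.
rewrite -comm => -[y Avy adjy].
have y0 : y = 0.
  apply: (ip_self_eq0 (ip := ip)); rewrite (adjy v y Avy).
  by rewrite ipC ip0l rmorph0.
move: Avy; rewrite y0 => /CP; rewrite nrm0 mulr0 => hv.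
by move: v0; rewrite -nrm_gt0 ltNge hv.
Qed.

End NormalGenerator.

(** * Contractivity and word decay for normal operators *)

Section NormalInverse.
Variables (R : realType) (H : completeNormedModType R[i]).
Variables (ip : {dot H for @Num.conj R[i]}) (A : graph H) (J J' : H -> H) (beta M C : R).
Hypothesis ip_norm : induces_norm ip.
Hypothesis AJ : forall x y, A y x <-> y = J x.
Hypothesis J_lin : linear J.
Hypothesis C_ge0 : 0 <= C.
Hypothesis J_le : bounded_by C J.
Hypothesis J_adj : forall x y, ip (J x) y = ip x (J' y).
Hypothesis J'_lin : linear J'.
Hypothesis J_comm : forall x, J (J' x) = J' (J x).
Hypothesis M_ge1 : 1 <= M.
Hypothesis A_below : forall y w (z : R[i]), A y w -> complex.Re z < 0 ->
  - complex.Re z * nrm y <= M * nrm (w - z *: y).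

Let M_ge0 : 0 <= M. Proof. exact: le_trans ler01 M_ge1. Qed.

Lemma resolvent_below (l : R) x y : 0 < l -> A y (x - l%:C *: y) ->
  l * nrm y <= M * nrm x.
Proof.
move=> l0 /(A_below (z := - l%:C)); rewrite /= oppr_lt0 => /(_ l0).
by rewrite opprK scaleNr opprK subrK.
Qed.

(** I + l J is bounded and normal. It is bounded below because u = N u - l J u and l |J u| <= M |N
    u|, the latter by [resolvent_below]. *)
Lemma shift_surjective (l : R) y : 0 < l -> exists u, u + l%:C *: J u = y.
Proof.
move=> l0; pose N u := u + l%:C *: J u; pose N' u := u + l%:C *: J' u.
have N_lin : linear N.
  move=> a u v; rewrite /N J_lin !scalerDr addrACA !scalerA.
  by rewrite [l%:C * a]mulrC.
have N_bd : bounded_by (1 + l * C) N.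
  move=> u; rewrite (le_trans (nrmD _ _))// mulrDl mul1r lerD2l nrmZ normc_real.
  by rewrite gtr0_norm// -mulrA ler_wpM2l ?J_le// ltW.
have NN' u v : ip (N u) v = ip u (N' v).
  by rewrite ipDl ipZl ipDr ipZr J_adj conj_Creal//; apply/complex_realP; exists l.
have comm u : N (N' u) = N' (N u).
  rewrite /N /N' (linD J_lin) (linD J'_lin) (linZ J_lin) (linZ J'_lin) J_comm.
  by rewrite !scalerDr !addrA; congr (_ + _); rewrite addrAC.
have below u : (1 + M)^-1 * nrm u <= nrm (N u).
  rewrite ler_pdivrMl; last by rewrite addr_gt0// (lt_le_trans ltr01).
  have h : A (J u) (N u - l%:C *: J u) by rewrite /N addrK; apply/AJ.
  have := resolvent_below l0 h; have := nrm_triangle (N u) u 0.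
  rewrite !subr0 {1}/N opprD addrA subrr sub0r nrmN nrmZ normc_real gtr0_norm//.
  by lra.
have Mp : 0 < (1 + M)^-1 by rewrite invr_gt0 addr_gt0// (lt_le_trans ltr01).
exact: (normal_bounded_below_surj ip_norm N_lin N_bd NN' comm Mp below).
Qed.

Lemma resolvent_unique (l : R) x y z : 0 < l -> A y (x - l%:C *: y) ->
  A z (x - l%:C *: z) -> y = z.
Proof.
move=> l0 /AJ hy /AJ hz; apply/eqP; rewrite -subr_eq0 -nrm_eq0.
have h : A (y - z) (0 - l%:C *: (y - z)).
  apply/AJ; rewrite {1}hy {1}hz -(linB J_lin); congr J.
  by rewrite scalerBr sub0r !opprB addrC addrA subrK.
have := resolvent_below l0 h; rewrite nrm0 mulr0 pmulr_rle0// => h2.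
by rewrite eq_le h2 nrm_ge0.
Qed.

Lemma resolvent_exists : exists rs : R -> H -> H,
  forall (l : R) x y, 0 < l -> A y (x - l%:C *: y) <-> y = rs l x.
Proof.
have /choice[rs rsP] : forall lx : R * H, exists y, 0 < lx.1 -> A y (lx.2 - lx.1%:C *: y).
  move=> [l x] /=; have [l0|] := ltP 0 l; last by exists 0.
  have [u uE] := shift_surjective x l0; exists (J u) => _.
  by apply/AJ; rewrite -uE addrK.
exists (fun l x => rs (l, x)) => l x y l0; split => [Ay|->].
  exact: resolvent_unique l0 Ay (rsP (l, x) l0).
exact: rsP (l, x) l0.
Qed.

Variable rs : R -> H -> H.
Hypothesis A_rs : forall (l : R) x y, 0 < l -> A y (x - l%:C *: y) <-> y = rs l x.

Lemma rs_bound (l : R) x : 0 < l -> nrm (rs l x) <= M / l * nrm x.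
Proof.
move=> l0; have h : A (rs l x) (x - l%:C *: rs l x) by exact/(A_rs _ _ l0).
by rewrite mulrAC ler_pdivlMr// mulrC (resolvent_below l0 h).
Qed.

(** (A + l)^(-1) = J - l (A + l)^(-1) J. *)
Lemma rs_boundJ (l : R) x : 0 < l -> nrm (rs l x) <= (1 + M) * nrm (J x).
Proof.
move=> l0; have -> : rs l x = J x - l%:C *: rs l (J x).
  rewrite -(rs_comm AJ A_rs x J_lin)// -(linZ J_lin) -(linB J_lin).
  exact: (rsE AJ A_rs).
rewrite (le_trans (nrmD _ _))// nrmN mulrDl mul1r lerD2l nrmZ normc_real gtr0_norm//.
apply: (@le_trans _ _ (l * (M / l * nrm (J x)))).
  by rewrite ler_wpM2l ?rs_bound// ltW.
by rewrite mulrA mulrCA mulfV ?gt_eqF// mulr1.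
Qed.

(** The commutation hypothesis places S in the bicommutant of J. So J' commutes with S, by
    adjunction J commutes with S', and therefore S' commutes with S. Then |S x|^2 = <x, S' S x> and
    |S' S x| = |S S x|. *)
Lemma paranormal_of_comm (S : H -> H) (c : R) : linear S -> 0 <= c -> bounded_by c S ->
  (forall S' : H -> H, linear S' -> (forall x, S' (J x) = J (S' x)) ->
     forall x, S' (S x) = S (S' x)) ->
  forall x, nrm (S x) ^+ 2 <= nrm (S (S x)) * nrm x.
Proof.
move=> lS c0 Sc S_comm.
have [S' SS' [lS' _]] := adjoint_exists ip_norm lS c0 Sc.
have J'S x : J' (S x) = S (J' x) by apply: S_comm => // y; rewrite J_comm.
have S'J x : S' (J x) = J (S' x).
  apply: (ip_ext (ip := ip)) => y; rewrite -SS' [RHS]ipC J_adj -ipC -[RHS]SS'.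
  by rewrite -J'S [RHS]ipC -J_adj -ipC.
have comm x : S (S' x) = S' (S x) by rewrite S_comm.
move=> x; apply: (@le_trans _ _ (normc (ip (S x) (S x)))).
  by rewrite (ip_nrm ip_norm) normc_real ger0_norm ?sqr_ge0.
rewrite SS' (le_trans (cauchy_schwarz ip_norm _ _))// mulrC ler_wpM2r ?nrm_ge0//.
by rewrite (commuting_adjoint_nrm ip_norm SS' comm).
Qed.

(** Otherwise S has approximate eigenvalues mu with |mu| >= r > 1. The inverse Cayley transform maps
    such mu to some z with Re z < 0, contrary to [A_below]. *)
Lemma cayley_map_contraction o x : 0 < o -> nrm (cayley_map rs o x) <= nrm x.
Proof.
move=> o0; set S := cayley_map rs o.
have S_lin : linear S := cayley_map_linear AJ J_lin A_rs o0.
pose L := 1 + 2 * M.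
have L0 : 0 <= L by rewrite /L; move: M_ge0; lra.
have SL : bounded_by L S.
  move=> y; rewrite /S /cayley_map (le_trans (nrmD _ _))// nrmN nrmZ normc_real.
  rewrite gtr0_norm ?mulr_gt0// /L.
  by have := rs_bound y o0; rewrite mulrAC ler_pdivlMr//; lra.
have para := @paranormal_of_comm S L S_lin L0 SL.
have {}para : forall y, nrm (S y) ^+ 2 <= nrm (S (S y)) * nrm y.
  apply: para => S' lS' S'J y; rewrite /S /cayley_map (linB lS') (linZ lS').
  by rewrite (rs_comm AJ A_rs).
suff : bounded_by 1 S by move=> /(_ x); rewrite mul1r.
apply: contrapT => nS1.
have [r r1 rP] := approx_eigenvector ip_norm S_lin para SL ltr01 nS1.
(* An upper bound for |z|, as |1 + mu| <= 1 + L and |1 - mu| >= r - 1; likewise g below is a lower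
   bound for -Re z. *)
pose Z := o * (1 + L) / (r - 1).
have r10 : 0 < r - 1 by lra.
have Z0 : 0 <= Z by rewrite /Z divr_ge0 ?mulr_ge0 ?(ltW o0) ?(ltW r10)// addr_ge0.
pose g := o * (r ^+ 2 - 1) / (1 + L) ^+ 2.
have L1 : 0 < (1 + L) ^+ 2 by rewrite exprn_gt0//; lra.
have g0 : 0 < g by rewrite /g divr_gt0 ?mulr_gt0//; nra.
have M0 : 0 < M := lt_le_trans ltr01 M_ge1.
(* The first entry yields |y| <= 2 (Z + o) |v|, the second then M |u - z v| <= (g / 2) |v|. *)
pose e := Num.min ((r - 1) / 2) (g * (r - 1) / (4 * M * (Z + o))).
have e0 : 0 < e.
  have Zo : 0 < Z + o by lra.
  have d40 : 0 < 4 * M * (Z + o) by apply: mulr_gt0 => //; apply: mulr_gt0.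
  rewrite lt_min; apply/andP; split; first exact: divr_gt0.
  by apply: divr_gt0 => //; exact: mulr_gt0.
have [mu [y [rmu muL y0 hyp]]] := rP e e0.
have ny : 0 < nrm y by rewrite nrm_gt0.
pose v := rs o y; pose u := y - o%:C *: v.
have Avu : A v u by exact/(A_rs _ _ o0).
have mu1 : r - 1 <= normc (1 - mu).
  have := le_normcD (1 - mu) (- 1); rewrite addrAC subrr add0r !normcN Normc.normc1.
  lra.
have mu1L : normc (1 - mu) <= 1 + L.
  by rewrite (le_trans (le_normcD _ _))// Normc.normc1 normcN; lra.
have mu0 : 0 < normc (1 - mu) by lra.
have mu10 : 1 - mu != 0 by rewrite -normc_gt0.
pose z := o%:C * (1 + mu) / (1 - mu).
(* With v = (A + o)^(-1) y and u = A v, one has y = u + o v and S y = u - o v. *)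
have SE : S y - mu *: y = (1 - mu) *: (u - z *: v).
  rewrite scalerBr scalerA /z [(1 - mu) * _]mulrC divfK// /S /cayley_map -/v.
  have -> : y = u + o%:C *: v by rewrite subrK.
  rewrite !scalerBl !scalerDr !scale1r !scalerA mulrDr mulr1 scalerDl [mu * _]mulrC.
  rewrite mulrDl mul1r rmorphD scalerDl !opprD !addrA.
  rewrite addrK -!addrA; congr (_ + _); rewrite addrCA; congr (_ + _).
  by rewrite addrCA; congr (_ + _); rewrite addrCA.
have uz : nrm (u - z *: v) <= e / (r - 1) * nrm y.
  move: hyp; rewrite SE nrmZ => h.
  rewrite mulrAC ler_pdivlMr// mulrC; apply: le_trans h.
  by rewrite ler_wpM2r ?nrm_ge0.
have zZ : normc z <= Z.
  rewrite /z !Normc.normcM Normc.normcV normc_real gtr0_norm// /Z.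
  apply: ler_pM; rewrite ?mulr_ge0 ?normc_ge0 ?invr_ge0 ?(ltW o0) ?(ltW mu0)//.
    rewrite ler_wpM2l ?(ltW o0)// (le_trans (le_normcD _ _))// Normc.normc1.
    by rewrite lerD2l.
  by rewrite lef_pV2.
have e1 : e / (r - 1) <= 2^-1.
  by rewrite ler_pdivrMr// mulrC ge_min lexx.
have e2 : e / (r - 1) <= g / (4 * M * (Z + o)).
  by rewrite ler_pdivrMr// mulrAC ge_min lexx orbT.
have nyv : nrm y <= 2 * (Z + o) * nrm v.
  have : nrm y <= nrm (u - z *: v) + (Z + o) * nrm v.
    have -> : y = (u - z *: v) + (z + o%:C) *: v by rewrite scalerDl addrA subrK subrK.
    rewrite (le_trans (nrmD _ _))// lerD2l nrmZ ler_wpM2r ?nrm_ge0//.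
    by rewrite (le_trans (le_normcD _ _))// normc_real gtr0_norm// lerD2r.
  have : e / (r - 1) * nrm y <= 2^-1 * nrm y by rewrite ler_wpM2r// ltW.
  lra.
have nv : 0 < nrm v.
  rewrite lt_def nrm_ge0 andbT; apply/eqP => nv0; move: nyv.
  by rewrite nv0 mulr0 leNgt ny.
have Rez : complex.Re z <= - g.
  have -> : complex.Re z = o * (1 - normc mu ^+ 2) / normc (1 - mu) ^+ 2.
    rewrite !normc_sqr; have : normc (1 - mu) ^+ 2 != 0 by rewrite expf_neq0// gt_eqF.
    rewrite normc_sqr /z; case: (mu) => a b /= hab.
    by field; move: hab; rewrite sub0r sqrrN.
  rewrite lerNr -mulNr -mulrN opprB /g.
  have nr : r ^+ 2 <= normc mu ^+ 2 by rewrite ler_pXn2r ?nnegrE ?normc_ge0//; lra.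
  have nL : normc (1 - mu) ^+ 2 <= (1 + L) ^+ 2.
    by rewrite ler_pXn2r ?nnegrE ?normc_ge0//; lra.
  have n0 : 0 < normc (1 - mu) ^+ 2 by rewrite exprn_gt0.
  have r2 : 1 <= r ^+ 2 by nra.
  apply: ler_pM; rewrite ?invr_ge0 ?(ltW L1)//.
  - by rewrite mulr_ge0 ?(ltW o0)//; lra.
  - by rewrite ler_wpM2l ?(ltW o0)// lerD2r.
  - by rewrite lef_pV2.
have Rez0 : complex.Re z < 0 by lra.
have := A_below Avu Rez0.
have : M * nrm (u - z *: v) <= g / 2 * nrm v.
  apply: (@le_trans _ _ (M * (g / (4 * M * (Z + o)) * (2 * (Z + o) * nrm v)))).
    rewrite ler_wpM2l// (le_trans uz)//.
    apply: ler_pM => //; rewrite ?nrm_ge0 ?divr_ge0 ?(ltW e0) ?(ltW r10)//.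
  rewrite le_eqVlt; apply/orP; left; apply/eqP; field.
  by rewrite !gt_eqF//; lra.
nra.
Qed.

Lemma cayley_map_affine o u : 0 < o ->
  cayley_map rs o (u + o%:C *: J u) = u - o%:C *: J u.
Proof.
move=> o0; have : A (J u) ((u + o%:C *: J u) - o%:C *: J u) by rewrite addrK; apply/AJ.
move=> /(A_rs _ _ o0) e; rewrite /cayley_map -e mulr_natl mulr2n rmorphD scalerDl opprD.
by rewrite addrA addrK.
Qed.

Let den (o : R) : R[i] * R[i] := (1, o%:C).
Let num (o : R) : R[i] * R[i] := (1, - o%:C).

(** Since A + o = (I + o J) A and A - o = (I - o J) A, applying the word to a vector in which the
    factors I + o J are already extracted clears all denominators. *)
Lemma cayley_word_affine s u : all (fun o => 0 < o) s ->
  cayley_word rs s (affine_word J den s u) = affine_word J num s u.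
Proof.
elim: s u => [//|o s IH] u /= /andP[ o0 s0].
have -> : 1 *: affine_word J den s u + o%:C *: J (affine_word J den s u) =
    affine_word J den s (o%:C *: J u + u).
  by rewrite (affine_word_linear J_lin) (affine_wordJ J_lin) scale1r addrC.
rewrite /= IH// (affine_word_linear J_lin) (affine_wordJ J_lin) addrC.
by rewrite cayley_map_affine// scale1r scaleNr.
Qed.

Lemma affine_word_surjective s y : all (fun o => 0 < o) s ->
  exists u, affine_word J den s u = y.
Proof.
elim: s y => [|o s IH] y /=; first by exists y.
move=> /andP[ o0 s0]; have [t ty] := shift_surjective y o0.
by have [u ut] := IH t s0; exists u; rewrite ut scale1r.
Qed.

Lemma cayley_word_comm s (S : H -> H) x : all (fun o => 0 < o) s -> linear S ->
  (forall x, S (J x) = J (S x)) -> S (cayley_word rs s x) = cayley_word rs s (S x).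
Proof.
move=> + lS SJ; elim: s => [//|o s IH] /= /andP[ o0 s0].
rewrite /cayley_map (linB lS) (linZ lS) (rs_comm AJ A_rs)//.
by rewrite IH.
Qed.

Variables (c p q : R).
Hypothesis beta_gt0 : 0 < beta.
Hypothesis c_gt0 : 0 < c.
Hypothesis region : forall Z : R, 0 <= Z -> exists2 e : R, 0 < e &
  forall y w (z : R[i]), y != 0 -> A y w -> normc z <= Z ->
    nrm (w - z *: y) <= e * nrm y ->
    0 < complex.Re z /\ c <= complex.Re z * (1 + normc z) `^ beta.
Hypothesis p_gt0 : 0 < p.
Hypothesis p_le_q : p <= q.

(** If J v is close to w v, then J v is an approximate eigenvector of A at 1/w, since A (J v) =
    v. *)
Lemma approx_eigenvalue_of_root (k : R) : 0 < k -> exists2 eta : R, 0 < eta &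
  forall v (w : R[i]), v != 0 -> k <= normc w -> nrm (J v - w *: v) <= eta * nrm v ->
    0 < complex.Re w^-1 /\ c <= complex.Re w^-1 * (1 + normc w^-1) `^ beta.
Proof.
move=> k0; have k10 : 0 < k^-1 by rewrite invr_gt0.
have [e e0 eP] := region (ltW k10).
(* The first entry gives |J v| >= (k / 2) |v|; the second turns the error for J into the tolerance e
   for A. *)
pose eta := Num.min (k / 2) (e * k ^+ 2 / 2).
have eta0 : 0 < eta by rewrite lt_min !divr_gt0// mulr_gt0// exprn_gt0.
have eta1 : eta <= k / 2 by rewrite ge_min lexx.
have eta2 : eta <= e * k ^+ 2 / 2 by rewrite ge_min lexx orbT.
exists eta => // v w v0 kw hv.
have nv : 0 < nrm v by rewrite nrm_gt0.
have nw : 0 < normc w by lra.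
have w0 : w != 0 by rewrite -normc_gt0.
have low : k / 2 * nrm v <= nrm (J v).
  have := nrm_le_add (w *: v) (J v); rewrite nrmB nrmZ; nra.
have Jv0 : J v != 0 by rewrite -nrm_gt0; nra.
have iw : normc w^-1 <= k^-1 by rewrite Normc.normcV lef_pV2.
apply: (eP (J v) v) => //; first exact/AJ.
have -> : v - w^-1 *: J v = - w^-1 *: (J v - w *: v).
  by rewrite scalerBr !scaleNr scalerA mulVf// scale1r opprK addrC.
rewrite nrmZ normcN.
apply: (@le_trans _ _ (k^-1 * (eta * nrm v))).
  by apply: ler_pM; rewrite ?normc_ge0 ?nrm_ge0.
apply: (@le_trans _ _ (e * (k / 2 * nrm v))); last by rewrite ler_wpM2l// ltW.
rewrite [leLHS]mulrA [leRHS]mulrA ler_wpM2r ?(ltW nv)// ler_pdivrMl//.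
by apply: (le_trans eta2); rewrite le_eqVlt; apply/orP; left; apply/eqP; ring.
Qed.

Lemma normal_word_decay : exists2 K : R, 0 < K &
  word_decay J rs (2 + beta)^-1 p q K.
Proof.
have [K K0 KP] := cayley_pointwise c_gt0 beta_gt0 p_gt0 p_le_q.
exists K => // s x sz sP.
have q0 : 0 < q := lt_le_trans p_gt0 p_le_q.
have s0 : all (fun o => 0 < o) s := all_gt0 p_gt0 sP.
have s0q : all (fun o => 0 < o <= q) s.
  by apply: sub_all sP => o /andP[po ->]; rewrite andbT (lt_le_trans p_gt0).
pose S y := cayley_word rs s (J y).
have S_lin : linear S.
  by move=> a y z; rewrite /S J_lin (cayley_word_linear AJ J_lin A_rs s0).
have SC : bounded_by C S.
  move=> y; apply: le_trans (J_le y); apply: cayley_word_le => // w z w0.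
  exact: cayley_map_contraction.
have para : forall y, nrm (S y) ^+ 2 <= nrm (S (S y)) * nrm y.
  apply: (paranormal_of_comm S_lin C_ge0 SC) => S' lS' S'J y.
  by rewrite /S (cayley_word_comm _ s0 lS' S'J) S'J.
set n := size s in sz *.
set K1 := K * n%:R `^ _.
have K10 : 0 < K1 by rewrite mulr_gt0// powR_gt0// ltr0n.
suff : bounded_by K1 S by apply.
apply: contrapT => nSK.
have [r r1 rP] := approx_eigenvector ip_norm S_lin para SC K10 nSK.
have r0 : 0 < r by lra.
have [k k0 kP] := cayley_poly_root_lower n q0 r0.
have [eta eta0 etaP] := approx_eigenvalue_of_root k0.
pose l := 1 + q * C.
have l0 : 0 < l by rewrite /l; have := mulr_ge0 (ltW q0) C_ge0; lra.
(* l^n bounds the product of the factors I + o J, p^n bounds the leading coefficient from below, and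
   the n + 1 linear factors share eta^(n+1); the final 1/2 makes the inequality strict. *)
pose e := eta ^+ n.+1 * p ^+ n / l ^+ n / 2.
have e0 : 0 < e.
  by apply: divr_gt0 => //; apply: divr_gt0; rewrite ?mulr_gt0 ?exprn_gt0.
have [mu [y [rmu muL y0 hyp]]] := rP e e0.
have [u uy] := affine_word_surjective y s0.
pose P := cayley_poly s mu.
(* Writing y as the product of the I + o J applied to u makes the residual a polynomial in J at
   u. *)
have SE : S y - mu *: y = pact J P u.
  rewrite /P /cayley_poly mulrC pactD -[- (mu *: \prod_(_ <- _) _)]scaleNr pactZ pactMX//.
  rewrite (pact_affine J_lin num) (pact_affine J_lin den) -cayley_word_affine// uy.
  by rewrite /S (cayley_wordJ AJ J_lin A_rs)// scaleNr.
have [szP leadP] := cayley_poly_lead mu s0.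
have [ws wsE] := closed_field_poly_normal P.
have lead0 : lead_coef P != 0 by rewrite lead_coef_eq0 -size_poly_eq0 szP.
have szws : size ws = n.+1.
  by apply: succn_inj; rewrite -/n -szP -/P wsE size_scale// size_prod_XsubC.
have PE : pact J P u = lead_coef P *: affine_word J (fun w : R[i] => (- w, 1)) ws u.
  rewrite {1}wsE pactZ -(pact_affine J_lin); congr (_ *: pact J _ u).
  by apply: eq_bigr => w _ /=; rewrite scale1r addrC rmorphN.
have yu : nrm y <= l ^+ n * nrm u.
  rewrite -uy; apply: (affine_word_bound (c := C)) => //; first exact: ltW.
  move=> o /(allP s0q) /andP[ o0 oq].
  change (normc (1 : R[i]) + normc o%:C * C <= l).
  by rewrite Normc.normc1 normc_real gtr0_norm// /l lerD2l ler_wpM2r.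
have u0 : 0 < nrm u.
  rewrite lt_def nrm_ge0 andbT; apply/eqP => u0; move: yu.
  by rewrite u0 mulr0 leNgt nrm_gt0 y0.
have leadp : p ^+ n <= normc (lead_coef P).
  rewrite leadP; apply: exp_le_prod; first exact: ltW.
  by move=> o /(allP sP) /andP[].
have small : nrm (affine_word J (fun w : R[i] => (- w, 1)) ws u) < eta ^+ size ws * nrm u.
  have pn : 0 < p ^+ n by rewrite exprn_gt0.
  rewrite szws -(ltr_pM2l pn).
  apply: (@le_lt_trans _ _ (nrm (pact J P u))).
    by rewrite PE nrmZ ler_wpM2r ?nrm_ge0.
  rewrite -SE; apply: (le_lt_trans hyp).
  apply: (@le_lt_trans _ _ (e * (l ^+ n * nrm u))); first by rewrite ler_wpM2l// ltW.
  have -> : e * (l ^+ n * nrm u) = 2^-1 * (p ^+ n * (eta ^+ n.+1 * nrm u)).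
    by rewrite /e; field; rewrite gt_eqF// exprn_gt0.
  have : 0 < p ^+ n * (eta ^+ n.+1 * nrm u) by rewrite !mulr_gt0// exprn_gt0.
  lra.
have [w [v [wws v0 wv]]] := root_word_factor J_lin eta0 small.
have rw : root P w.
  by rewrite wsE rootZ// root_prod_XsubC.
have kw := kP _ _ _ (erefl n) s0q rmu rw.
have [z0 zc] := etaP v w v0 kw wv.
have := cayley_poly_root_value s0 z0; rewrite invrK => /(_ mu rw) mE.
have := KP _ _ z0 zc sz sP; rewrite -mE -/K1; lra.
Qed.

End NormalInverse.

Lemma normal_cayley_estimate (R : realType) (H : completeNormedModType R[i])
  (ip : {dot H for @Num.conj R[i]}) (T : R -> H -> H) (A : graph H) (beta : R) :
  induces_norm ip -> bounded_C0_semigroup T ->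
  generator T = op_opp A -> normal_op ip A -> 0 < beta ->
  decay (fun t => op_fun (T t)) A beta -> cayley_estimate A beta.
Proof.
move=> ip_norm T_sg A_gen A_normal beta0 T_decay.
have [M M1 TM] := semigroup_bound T_sg.
have [C C0 CP] := generator_injective_bound T_sg A_gen M1 TM beta0 T_decay.
have [c c0 region] := approx_spectrum_region T_sg A_gen M1 TM beta0 T_decay.
have /choice[J JP] := generator_surjective ip_norm T_sg A_gen A_normal beta0 T_decay.
have A_inj y z w : A y w -> A z w -> y = z.
  move=> Ay Az; have := generator_linear T_sg A_gen (-1) Az Ay.
  rewrite !scaleN1r addNr => /CP; rewrite nrm0 mulr0 => h.
  by apply/eqP; rewrite -subr_eq0 addrC -nrm_eq0 eq_le h nrm_ge0.
have AJ x y : A y x <-> y = J x.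
  by split => [Ay|->]; [exact: A_inj Ay (JP x)|exact: JP].
have J_lin : linear J.
  by move=> a x y; apply/esym/AJ; exact: (generator_linear T_sg A_gen a (JP x) (JP y)).
have J_inj : injective J.
  move=> x y e; apply: (generator_functional A_gen (x := J x)); first exact/AJ.
  by rewrite e; apply/AJ.
have J_le : bounded_by C J by move=> x; apply: CP.
have [J' JJ' [J'_lin J'_le]] := adjoint_exists ip_norm J_lin (ltW C0) J_le.
have adjJ' y : adjoint ip A (J' y) y.
  by move=> x w /AJ ->; rewrite JJ'.
have J_comm x : J (J' x) = J' (J x).
  have [_ _ comm] := A_normal.
  (* Inverting both sides of the normality relation shows that J commutes with its adjoint. *)
  have : op_mul (adjoint ip A) A (J (J' x)) x by exists (J' x).
  rewrite comm => -[v adjv /AJ vJ]; apply: (ip_ext (ip := ip)) => w.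
  by rewrite -JJ' -vJ (adjv (J w) w (JP w)).
have M0 : 0 <= M by exact: le_trans ler01 M1.
have below := generator_bounded_below T_sg A_gen M1 TM.
have [rs A_rs] := resolvent_exists ip_norm AJ J_lin J_le JJ' J'_lin J_comm M1 below.
have g0 : 0 < (2 + beta)^-1 by rewrite invr_gt0; lra.
apply: (cayley_estimate_of_word_decay (@complete_seq_complete R H) (C := 1 + M)
  AJ J_lin A_rs _ _ _ J_inj _ g0 erefl).
- move=> l x l0; apply: (le_trans (rs_bound below A_rs x l0)).
  rewrite ler_wpM2r ?nrm_ge0// ler_wpM2r ?invr_ge0 ?(ltW l0)//; lra.
- by move=> l x l0; exact: (rs_boundJ AJ J_lin below A_rs).
- lra.
- move=> w x w0.
  exact: (cayley_map_contraction ip_norm AJ J_lin JJ' J'_lin J_comm M1 below A_rs).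
- move=> p q p0 pq.
  exact: (normal_word_decay ip_norm AJ J_lin (ltW C0) J_le JJ' J'_lin J_comm M1 below
    A_rs beta0 c0 region p0 pq).
Qed.

(** * Multiplication operators *)

Section MultiplicationOperator.
Variables (R : realType) (X : normedModType R[i]) (Omega : Type).
(* [ev x] is the function represented by [x]; [F] is the filter of all points, or
   of almost all points. *)
Variables (ev : X -> Omega -> R[i]) (F : set_system Omega) (phi : Omega -> R[i]).
Context {F_filter : Filter F}.
Variables (A : graph X) (beta c : R).
Hypothesis X_complete : seq_complete X.
Hypothesis ev_inj : forall x y, (\forall t \near F, ev x t = ev y t) -> x = y.
Hypothesis ev_linear : forall (a : R[i]) x y,
  \forall t \near F, ev (a *: x + y) t = a * ev x t + ev y t.
Hypothesis ev_nrm : forall (B : R) x y, 0 <= B ->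
  (\forall t \near F, normc (ev y t) <= B * normc (ev x t)) -> nrm y <= B * nrm x.
Hypothesis ev_div : forall (l : R) x, 0 <= l ->
  exists y, \forall t \near F, ev y t = ev x t / (phi t + l%:C).
Hypothesis A_mult : forall x y, A y x <-> \forall t \near F, ev x t = phi t * ev y t.
Hypothesis beta_gt0 : 0 < beta.
Hypothesis c_gt0 : 0 < c.
Hypothesis phi_region : \forall t \near F, 0 < complex.Re (phi t) /\
  c <= complex.Re (phi t) * (1 + normc (phi t)) `^ beta.

Lemma shift_neq0 (z : R[i]) (l : R) : 0 < complex.Re z -> 0 <= l -> z + l%:C != 0.
Proof.
move=> z0 l0; apply/eqP => /(congr1 (@complex.Re R)); rewrite ReD /=; lra.
Qed.

Lemma normc_shift_ge (z : R[i]) (l : R) : 0 < complex.Re z -> 0 <= l ->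
  l <= normc (z + l%:C) /\ normc z <= normc (z + l%:C).
Proof.
move=> z0 l0; split.
  apply: le_trans (normc_ge_absRe _); apply: le_trans (ler_norm _).
  by rewrite ReD /=; lra.
rewrite -(@ler_pXn2r _ 2)// ?nnegrE ?normc_ge0// !normc_sqr ReD ImD /= addr0.
by rewrite lerD2r; nra.
Qed.

(** The resolvents divide by phi + l and a Cayley word multiplies by the product of the scalar
    factors; [ev_nrm] turns the pointwise bounds into norm bounds. *)
Lemma multiplication_cayley_estimate : cayley_estimate A beta.
Proof.
have FF : Filter (nbhs F) := F_filter.
have /choice[rs0 rs0P] : forall lx : R * X, exists y, 0 <= lx.1 ->
    \forall t \near F, ev y t = ev lx.2 t / (phi t + lx.1%:C).
  move=> [l x] /=; have [l0|] := leP 0 l; last by exists 0.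
  by have [y yP] := ev_div x l0; exists y.
pose rs l x := rs0 (l, x).
have rsP l x : 0 <= l -> \forall t \near F, ev (rs l x) t = ev x t / (phi t + l%:C).
  exact: (rs0P (l, x)).
pose J := rs 0.
have JP x : \forall t \near F, ev (J x) t = ev x t / phi t.
  by have := rsP 0 x (lexx 0); apply: filterS => t; rewrite addr0.
have evB (l : R[i]) x y : \forall t \near F, ev (x - l *: y) t = ev x t - l * ev y t.
  have := ev_linear (- l) y x; apply: filterS => t; rewrite addrC scaleNr => ->.
  by rewrite mulNr addrC.
have phi0 (z : R[i]) : 0 < complex.Re z -> z != 0.
  by move=> z0; have := shift_neq0 z0 (lexx 0); rewrite addr0.
have AJ x y : A y x <-> y = J x.
  split=> [/A_mult yx|->]; [apply: ev_inj|apply/A_mult].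
    apply: filterS3 yx (JP x) phi_region => t -> -> [z0 _].
    by rewrite [phi t * _]mulrC mulfK ?phi0.
  apply: filterS2 (JP x) phi_region => t -> [z0 _].
  by rewrite [phi t * _]mulrC divfK ?phi0.
have J_lin : linear J.
  move=> a x y; apply: ev_inj.
  have h1 := @filterI _ _ FF _ _ (JP x) (JP y).
  have h2 := @filterI _ _ FF _ _ (ev_linear a x y) (ev_linear a (J x) (J y)).
  apply: filterS3 h1 h2 (JP (a *: x + y)) => t [e1 e2] [e3 e4] ->.
  by rewrite e3 e4 e1 e2; ring.
have A_rs (l : R) x y : 0 < l -> A y (x - l%:C *: y) <-> y = rs l x.
  move=> l0; split=> [/A_mult yx|->]; [apply: ev_inj|apply/A_mult].
    have h := @filterI _ _ FF _ _ yx (evB l%:C x y).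
    apply: filterS3 h (rsP l x (ltW l0)) phi_region => t [-> e] -> [z0 _].
    have nz := shift_neq0 z0 (ltW l0); apply: (mulIf nz).
    by rewrite divfK// mulrDr [ev y t * phi t]mulrC e [_ * l%:C]mulrC subrK.
  apply: filterS3 (evB l%:C x (rs l x)) (rsP l x (ltW l0)) phi_region => t -> -> [z0 _].
  have nz := shift_neq0 z0 (ltW l0).
  by field.
have J_inj : injective J.
  move=> x y Jxy; apply: ev_inj.
  apply: filterS3 (JP x) (JP y) phi_region => t; rewrite Jxy => -> e [z0 _].
  by apply: (mulIf (_ : (phi t)^-1 != 0)); rewrite ?invr_eq0 ?phi0.
have rs_le (l : R) x : 0 < l -> nrm (rs l x) <= 1 / l * nrm x.
  move=> l0; apply: ev_nrm; first by rewrite divr_ge0// ltW.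
  apply: filterS2 (rsP l x (ltW l0)) phi_region => t -> [z0 _].
  have [h _] := normc_shift_ge z0 (ltW l0).
  rewrite Normc.normcM Normc.normcV mulrC ler_wpM2r ?normc_ge0// div1r.
  by rewrite lef_pV2 ?posrE// (lt_le_trans l0).
have rs_leJ (l : R) x : 0 < l -> nrm (rs l x) <= 1 * nrm (J x).
  move=> l0; apply: ev_nrm => //.
  apply: filterS3 (rsP l x (ltW l0)) (JP x) phi_region => t -> -> [z0 _].
  have [_ h] := normc_shift_ge z0 (ltW l0).
  rewrite mul1r !Normc.normcM !Normc.normcV ler_wpM2l ?normc_ge0//.
  have nz : 0 < normc (phi t) by rewrite normc_gt0 phi0.
  by rewrite lef_pV2 ?posrE// (lt_le_trans nz).
have cayP (w : R) x : 0 < w -> \forall t \near F,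
    ev (cayley_map rs w x) t = (phi t - w%:C) / (phi t + w%:C) * ev x t.
  move=> w0; apply: filterS3 (evB (2 * w)%:C x (rs w x)) (rsP w x (ltW w0)) phi_region.
  move=> t -> -> [z0 _]; have nz := shift_neq0 z0 (ltW w0).
  by rewrite rmorphM rmorph_nat; field.
have wordP s x : all (fun w => 0 < w) s -> \forall t \near F,
    ev (cayley_word rs s x) t = (\prod_(w <- s) ((phi t - w%:C) / (phi t + w%:C))) * ev x t.
  elim: s => [_|w s IH] /=.
    by apply: nearW => t; rewrite big_nil mul1r.
  move=> /andP[w0 s0]; apply: filterS2 (cayP w (cayley_word rs s x) w0) (IH s0).
  by move=> t -> ->; rewrite big_cons mulrA.
have cay_le (w : R) x : 0 < w -> nrm (cayley_map rs w x) <= nrm x.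
  move=> w0; rewrite -[leRHS]mul1r; apply: ev_nrm => //.
  apply: filterS2 (cayP w x w0) phi_region => t -> [z0 _].
  rewrite Normc.normcM ler_wpM2r ?normc_ge0//.
  rewrite -(@ler_pXn2r _ 2)// ?nnegrE ?normc_ge0// expr1n cayley_factor//.
  by rewrite gerBl divr_ge0 ?sqr_ge0// !mulr_ge0// ltW.
have g0 : 0 < (2 + beta)^-1 by have b0 := beta_gt0; rewrite invr_gt0; lra.
apply: (cayley_estimate_of_word_decay X_complete AJ J_lin A_rs rs_le rs_leJ ler01
  J_inj cay_le g0 erefl).
move=> p q p0 pq; have [K K0 KP] := cayley_pointwise c_gt0 beta_gt0 p0 pq.
exists K => // s x sz sP; apply: ev_nrm; first by rewrite mulr_ge0 ?powR_ge0// ltW.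
have s0 := all_gt0 p0 sP.
apply: filterS3 (wordP s (J x) s0) (JP x) phi_region => t -> -> [z0 zc].
rewrite mulrCA mulrC Normc.normcM ler_wpM2r ?normc_ge0// Normc.normcM Normc.normcV.
rewrite (big_morph (@Normc.normc R) (@Normc.normcM R) (Normc.normc1 R)).
exact: KP.
Qed.

End MultiplicationOperator.

(** * Complex sequences and the scalar form of the decay *)

Section ScalarLimits.
Variable R : realType.
Implicit Types (z : R[i]) (K beta c : R).

Lemma normc_le_add z : normc z <= `|complex.Re z| + `|complex.Im z|.
Proof.
rewrite -(@ler_pXn2r _ 2)// ?nnegrE ?normc_ge0 ?addr_ge0// normc_sqr.
have := normr_ge0 (complex.Re z); have := normr_ge0 (complex.Im z).
by rewrite -(real_normK (num_real (complex.Re z))) -(real_normK (num_real (complex.Im z))); nra.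
Qed.

Lemma normc_ge_absIm z : `|complex.Im z| <= normc z.
Proof.
rewrite -(@ler_pXn2r _ 2)// ?nnegrE ?normc_ge0// normc_sqr real_normK ?num_real//.
by rewrite lerDr sqr_ge0.
Qed.

Lemma ReB (z1 z2 : R[i]) : complex.Re (z1 - z2) = complex.Re z1 - complex.Re z2.
Proof. by case: z1 => a b; case: z2. Qed.

Lemma ImB (z1 z2 : R[i]) : complex.Im (z1 - z2) = complex.Im z1 - complex.Im z2.
Proof. by case: z1 => a b; case: z2. Qed.

Lemma real_seq_cauchy (u : nat -> R) :
  (forall e : R, 0 < e -> exists N, forall m n, (N <= m)%N -> (N <= n)%N ->
     `|u m - u n| < e) ->
  exists l : R, forall e : R, 0 < e ->
    exists N, forall n, (N <= n)%N -> `|u n - l| < e.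
Proof.
move=> cu; have : cauchy (u @ \oo).
  apply/cauchy_ballP => e e0; have [N hN] := cu e e0.
  exists ([set u n | n in [set n | (N <= n)%N]], [set u n | n in [set n | (N <= n)%N]]).
    by split; exists N => // n /= Nn; exists n.
  by move=> [_ _] /= [[m Nm <-] [n Nn <-]]; rewrite -ball_normE /ball_/= hN.
move=> /cauchy_cvg /cvg_ex[l /= ul]; exists l => e e0.
have /cvgrPdist_lt/(_ e e0)[N _ hN] := ul; exists N => n /hN/=.
by rewrite distrC.
Qed.

Lemma complex_seq_cauchy (u : nat -> R[i]) :
  (forall e : R, 0 < e -> exists N, forall m n, (N <= m)%N -> (N <= n)%N ->
     normc (u m - u n) < e) ->
  exists l : R[i], forall e : R, 0 < e ->
    exists N, forall n, (N <= n)%N -> normc (u n - l) < e.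
Proof.
move=> cu.
have [|a ah] := @real_seq_cauchy (fun n => complex.Re (u n)).
  move=> e /cu[N hN]; exists N => m n Nm Nn.
  by rewrite -ReB (le_lt_trans (normc_ge_absRe _))// hN.
have [|b bh] := @real_seq_cauchy (fun n => complex.Im (u n)).
  move=> e /cu[N hN]; exists N => m n Nm Nn.
  by rewrite -ImB (le_lt_trans (normc_ge_absIm _))// hN.
exists (a +i* b) => e e0.
have e2 : 0 < e / 2 by rewrite divr_gt0.
have [N1 h1] := ah _ e2; have [N2 h2] := bh _ e2.
exists (maxn N1 N2) => n; rewrite geq_max => /andP[/h1 n1 /h2 n2].
by rewrite (le_lt_trans (normc_le_add _))// ReB ImB [ltRHS]splitr ltrD.
Qed.

Lemma normc_cexp z : normc (cexp z) = expR (complex.Re z).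
Proof.
rewrite /= -[RHS]ger0_norm ?expR_ge0// -sqrtr_sqr; congr Num.sqrt.
by rewrite !exprMn -mulrDr cos2Dsin2 mulr1.
Qed.

(** As exp (-x) >= 1 - x, the bound 1/8 at the time from [decay_time] forces t Re z >= 7/8. Only
    integer times are tested, so that in L^p countably many null sets suffice. *)
Lemma decay_region K (t1 : R) beta : 0 < K -> 0 < beta ->
  exists2 c : R, 0 < c & forall z, 0 < complex.Re z ->
    (forall t : nat, (0 < t)%N -> t1 <= t%:R ->
       normc (cexp (- (t%:R%:C * z))) <= K * t%:R `^ (- beta^-1) * normc (1 + z)) ->
    c <= complex.Re z * (1 + normc z) `^ beta.
Proof.
move=> K0 b0; have [c c0 cP] := decay_time t1 K0 b0.
exists (c / 2) => [|z z0 zK]; first by rewrite divr_gt0.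
have [|t [t0 t1t Kt tc]] := cP (1 + normc z); first by rewrite lerDl normc_ge0.
have t0' : 0 < t%:R :> R by rewrite ltr0n.
have : normc (cexp (- (t%:R%:C * z))) <= 8^-1.
  apply: le_trans (zK t t0 t1t) (le_trans _ Kt).
  rewrite ler_wpM2l ?mulr_ge0 ?powR_ge0 ?(ltW K0)//.
  by rewrite (le_trans (le_normcD _ _))// Normc.normc1.
rewrite normc_cexp (_ : complex.Re _ = - (t%:R * complex.Re z)); last first.
  by case: z {z0 zK Kt tc} => a b /=; rewrite mul0r subr0.
move=> /(le_trans (expR_ge1Dx _)).
move: (1 + _) tc => s; move: (s `^ _) (t%:R) (complex.Re z) z0 t0' => S T a a0 T0 h1 h2.
nra.
Qed.

End ScalarLimits.

(** * Multiplication operators on the space of continuous functions vanishing at infinity *)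

Section ContinuousFunctions.
Variables (R : realType) (Omega : topologicalType).
Local Notation C0 := (C0 Omega R).
Implicit Types (f g : C0) (phi : Omega -> R[i]).

Lemma C0_vanishes f : vanishes_at_infinity f.
Proof. by case: f => f /= /asboolP[]. Qed.

Lemma C0_sub f g x : (f - g) x = f x - g x.
Proof. by []. Qed.

Lemma C0_nrm_le (B : R) f g : 0 <= B ->
  (forall x, normc (g x) <= B * normc (f x)) -> nrm g <= B * nrm f.
Proof.
move=> B0 h; apply: supnorm_le; first by rewrite mulr_ge0 ?nrm_ge0.
by move=> x; rewrite (le_trans (h x))// ler_wpM2l// C0_supnorm_ub.
Qed.

Lemma C0_complete : seq_complete C0.
Proof.
move=> u cu.
have cu' (e : R) : 0 < e -> exists N, forall m n, (N <= m)%N -> (N <= n)%N ->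
    forall x, normc (u m x - u n x) < e.
  move=> /cu[N hN]; exists N => m n Nm Nn x.
  exact: le_lt_trans (C0_supnorm_ub (u m - u n) x) (hN m n Nm Nn).
have /choice[l lP] : forall x, exists l : R[i], forall e : R, 0 < e ->
    exists N, forall n, (N <= n)%N -> normc (u n x - l) < e.
  move=> x; apply: complex_seq_cauchy => e /cu'[N hN]; exists N => m n Nm Nn.
  exact: hN.
have unif (e : R) : 0 < e -> exists N, forall n, (N <= n)%N ->
    forall x, normc (u n x - l x) < e.
  move=> e0; have e2 : 0 < e / 2 by rewrite divr_gt0.
  have [N hN] := cu' _ e2; exists N => n Nn x; have [M hM] := lP x _ e2.
  have := hM (maxn N M) (leq_maxr _ _); have := hN n (maxn N M) Nn (leq_maxl _ _) x.
  move=> h1 h2; rewrite [e]splitr (le_lt_trans _ (ltrD h1 h2))//.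
  by rewrite (le_trans _ (le_normcD _ _))// addrA subrK.
have lC0 : l \in @C0_pred Omega R.
  apply/asboolP; split.
    move=> x; apply/cvgrPdist_lt => e e0.
    have er : e = (complex.Re e)%:C by rewrite RRe_real// gtr0_real.
    have e3 : 0 < complex.Re e / 3 by rewrite divr_gt0// -ltcR -er.
    have [N hN] := unif _ e3.
    have /cvgrPdist_lt/(_ (complex.Re e / 3)%:C) := @C0_continuous _ _ (u N) x.
    rewrite ltcR => /(_ e3); apply: filterS => y.
    rewrite !(_ : forall z : R[i]^o, `|z| = (normc z)%:C)// ltcR => h.
    rewrite er ltcR.
    have h1 := hN N (leqnn _) x; have h2 := hN N (leqnn _) y.
    have -> : l x - l y = (- (u N x - l x) + (u N x - u N y)) + (u N y - l y).
      by ring.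
    have a1 := le_normcD (- (u N x - l x) + (u N x - u N y)) (u N y - l y).
    have a2 := le_normcD (- (u N x - l x)) (u N x - u N y).
    rewrite normcN in a2; apply: le_lt_trans a1 _; move: a2 h h1 h2.
    by move: (normc _) (normc _) (normc _) (normc _); clear; intros; lra.
  move=> e e0; have e2 : 0 < e / 2 by rewrite divr_gt0.
  have [N hN] := unif _ e2; have [K cK hK] := C0_vanishes (u N) e2.
  exists K => // x /hK h1; have := hN N (leqnn _) x => h2.
  rewrite [e]splitr (le_lt_trans _ (ltrD h2 h1))//.
  by rewrite -[normc (u N x - l x)]normcN opprB (le_trans _ (le_normcD _ _))// subrK.
exists (MkC0 lC0) => e e0; have e2 : 0 < e / 2 by rewrite divr_gt0.
have [N hN] := unif _ e2; exists N => n Nn.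
have : nrm (u n - MkC0 lC0) <= e / 2.
  apply: supnorm_le; first exact: ltW.
  by move=> x; rewrite C0_sub ltW// hN.
by move=> h; rewrite (le_lt_trans h)// ltr_pdivrMr// ltr_pMr// ltrDl.
Qed.

(** Complete regularity separates x from the complement of the interior of a compact neighbourhood,
    and the function 1 - f vanishes off that neighbourhood. *)
Lemma C0_peak (x : Omega) : hausdorff_space Omega -> locally_compact [set: Omega] ->
  exists2 f : C0, f x = 1 & nrm f <= 1.
Proof.
move=> haus lc; have [V xV [cV _]] := lc x I.
have nV : nbhs x V by move: xV; rewrite withinET.
have /uniform_separatorP : uniform_separator [set x] (~` V°).
  refine (@locally_compact_completely_regular _ R lc haus _ _ _ _); last exact.
  exact/open_closedC/open_interior.
move=> /(_ R)[f [cf rf f0 f1]].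
have fx : f x = 0 by apply: f0; exists x.
pose g y : R[i] := (1 - f y)%:C.
have g01 y : normc (g y) <= 1.
  have /= := rf (f y) (imageT f y); rewrite in_itv/= => /andP[a b].
  by change (normc (1 - f y)%:C <= 1); rewrite normc_real ger0_norm ?subr_ge0// gerBl.
have gC0 : g \in @C0_pred Omega R.
  apply/asboolP; split.
    move=> y; apply/cvgrPdist_lt => e e0.
    have er : e = (complex.Re e)%:C by rewrite RRe_real// gtr0_real.
    have /cvgrPdist_lt/(_ (complex.Re e)) := cf y.
    rewrite -ltcR -er => /(_ e0); apply: filterS => z.
    rewrite (_ : forall z : R[i]^o, `|z| = (normc z)%:C)// er !ltcR -rmorphB normc_real.
    by rewrite (_ : 1 - f y - (1 - f z) = f z - f y) 1?distrC//; ring.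
  move=> e e0; exists V => // y Vy; rewrite /g (f1 (f y)); last first.
    by exists y => // /interior_subset.
  by rewrite subrr Normc.normc0.
exists (MkC0 gC0); first by rewrite /= /g fx subr0.
exact: supnorm_le.
Qed.

(** The operator bound, tested on a peak function at x, becomes a bound for the multiplier at x. *)
Lemma C0_mult_region phi (beta : R) : hausdorff_space Omega ->
  locally_compact [set: Omega] -> range phi `<=` Cplus R -> 0 < beta ->
  decay (fun t => C0_mult (fun x => cexp (- (t%:C * phi x)))) (C0_mult phi) beta ->
  exists2 c : R, 0 < c &
    forall x, c <= complex.Re (phi x) * (1 + normc (phi x)) `^ beta.
Proof.
move=> haus lc phi0 b0 /decay_op_bound[K [t1 [K0 t10 KP]]].
have [c c0 cP] := decay_region t1 K0 b0.
exists c => // x; have x0 : 0 < complex.Re (phi x) by apply: phi0; exists x.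
apply: cP => // t t0 t1t; have [f fx f1] := C0_peak x haus lc.
have [ex le] := KP _ t1t; have [y [By _]] := ex f.
have := le f y By; rewrite !nrmE -rmorphM lecR => yK.
case: By => g + yg; rewrite /op_inv /op_shift scale1r => /(_ x).
rewrite C0_sub fx => /eqP; rewrite subr_eq => /eqP gx.
have -> : cexp (- (t%:R%:C * phi x)) = y x * (1 + phi x).
  by rewrite yg -mulrA mulrDr mulr1 [g x * _]mulrC addrC -gx mulr1.
rewrite Normc.normcM ler_wpM2r ?normc_ge0//.
apply: le_trans (C0_supnorm_ub y x) (le_trans yK _).
by rewrite ler_piMr// mulr_ge0 ?powR_ge0// ltW.
Qed.

Lemma C0_mult_cayley phi (beta : R) : hausdorff_space Omega ->
  locally_compact [set: Omega] -> continuous (phi : Omega -> R[i]^o) ->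
  range phi `<=` Cplus R -> 0 < beta ->
  decay (fun t => C0_mult (fun x => cexp (- (t%:C * phi x)))) (C0_mult phi) beta ->
  cayley_estimate (C0_mult phi) beta.
Proof.
move=> haus lc cphi phi0 b0 dec.
have [c c0 cP] := C0_mult_region haus lc phi0 b0 dec.
have phi_gt0 x : 0 < complex.Re (phi x) by apply: phi0; exists x.
(* The filter consisting of the whole space alone, so that a statement near [F] is a statement at
   every point. *)
pose F : set_system Omega := [set P : set Omega | forall x, P x].
have FF : Filter F.
  split; [by []|by move=> P Q hP hQ x; split; [exact: hP|exact: hQ]|].
  by move=> P Q PQ hP x; exact/PQ/hP.
apply: (@multiplication_cayley_estimate R C0 Omega (@C0_val Omega R)
  F phi FF (C0_mult phi) beta c) => //.
- exact: C0_complete.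
- by move=> f g fg; apply/val_inj/funext.
- by move=> B f g B0 h; exact: C0_nrm_le.
- move=> l f l0.
  (* The denominators are bounded away from 0, so the quotient still vanishes at infinity. *)
  have [d d0 dP] := region_lower_bound c0 b0.
  have pl x : d <= normc (phi x + l%:C).
    have [_ h] := normc_shift_ge (phi_gt0 x) l0.
    apply: le_trans h; apply: le_trans (dP _ (phi_gt0 x) (cP x)).
    by rewrite ler_peMr ?(ltW d0)// lerDl normc_ge0.
  have gC0 : (fun x => f x / (phi x + l%:C)) \in @C0_pred Omega R.
    apply/asboolP; split.
      move=> x; have cf := @C0_continuous _ _ f x.
      have cg : (phi y + l%:C : R[i]^o) @[y --> x] --> (phi x + l%:C : R[i]^o).
        by apply: cvgD; [exact: cphi|exact: cvg_cst].
      exact: (cvgM cf (cvgV (shift_neq0 (phi_gt0 x) l0) cg)).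
    move=> e e0; have [V cV hV] := C0_vanishes f (mulr_gt0 e0 d0).
    exists V => // x /hV h; rewrite Normc.normcM Normc.normcV.
    rewrite ltr_pdivrMr ?(lt_le_trans d0)//.
    by rewrite (lt_le_trans h)// ler_wpM2l// ltW.
  by exists (MkC0 gC0).
Qed.

End ContinuousFunctions.

(** * Completeness of L^p *)

Section LpSpace.
Context d (Omega : measurableType d) (R : realType).
Variables (mu : {measure set Omega -> \bar R}) (p : R) (p1 : 1 <= p).
Local Notation Lp := (Lp mu p1).
Local Notation cLnorm := (cLnorm mu p).
Implicit Types (f g : Omega -> R[i]) (u v : Lp).

Local Open Scope quotient_scope.

Lemma cLnorm_powR f : (poweR (cLnorm f) p = \int[mu]_x (normc (f x) `^ p)%:E)%E.
Proof.
rewrite cLnormE -poweRrM mulVf ?gt_eqF ?(lt_le_trans _ p1)//.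
by rewrite poweRe1// integral_ge0// => x _; rewrite lee_fin powR_ge0.
Qed.

Lemma cLnorm_leP f (e : R) : 0 <= e ->
  (cLnorm f <= e%:E)%E <-> (\int[mu]_x (normc (f x) `^ p)%:E <= (e `^ p)%:E)%E.
Proof.
move=> e0; have p0 : 0 <= p by rewrite (le_trans _ p1).
have I0 : (0 <= \int[mu]_x (normc (f x) `^ p)%:E)%E.
  by apply: integral_ge0 => x _; rewrite lee_fin powR_ge0.
split=> h.
  rewrite -cLnorm_powR -poweR_EFin; apply: gt0_ler_poweR => //.
    by rewrite in_itv/= leey andbT cLnorm_ge0.
  by rewrite in_itv/= leey andbT lee_fin.
rewrite cLnormE (_ : e%:E = poweR (e `^ p)%:E p^-1)%E; last first.
  by rewrite poweR_EFin -powRrM mulfV ?powRr1// gt_eqF// (lt_le_trans _ p1).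
apply: gt0_ler_poweR => //; first by rewrite invr_ge0.
  by rewrite in_itv/= leey andbT.
by rewrite in_itv/= leey andbT lee_fin powR_ge0.
Qed.

Lemma cLnorm_le_ae (B : R) f g : cmeasurable f -> cmeasurable g -> 0 <= B ->
  {ae mu, forall x, normc (g x) <= B * normc (f x)} ->
  (cLnorm g <= B%:E * cLnorm f)%E.
Proof.
move=> mf mg B0 h.
have -> : (B%:E * cLnorm f = cLnorm (B%:C *: f)%R)%E.
  by rewrite cLnormZ// normc_real ger0_norm.
rewrite !cLnormE; apply: gt0_ler_poweR.
- by rewrite invr_ge0 (le_trans _ p1).
- by rewrite in_itv/= leey andbT integral_ge0// => x _; rewrite lee_fin powR_ge0.
- by rewrite in_itv/= leey andbT integral_ge0// => x _; rewrite lee_fin powR_ge0.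
apply: ae_ge0_le_integral => //.
- by move=> x _; rewrite lee_fin powR_ge0.
- exact: measurable_normcX.
- by move=> x _; rewrite lee_fin powR_ge0.
- by apply: measurable_normcX; exact: cmeasurableZ.
apply: filterS h => x h _; rewrite lee_fin.
rewrite ge0_ler_powR ?nnegrE ?normc_ge0 ?(le_trans _ p1)//.
by rewrite (_ : (B%:C *: f)%R x = B%:C * f x)// Normc.normcM normc_real ger0_norm.
Qed.

Lemma Lp_cmeasurable u : cmeasurable (repr u).
Proof. exact: cLfun_cmeasurable. Qed.

Lemma Lp_nrmE u : (nrm u)%:E = cLnorm (repr u).
Proof. by rewrite -[RHS]fineK// cLfun_norm_fin. Qed.

Lemma Lp_nrm_le (B : R) u v : 0 <= B ->
  {ae mu, forall x, normc (repr v x) <= B * normc (repr u x)} -> nrm v <= B * nrm u.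
Proof.
move=> B0 h; rewrite -lee_fin EFinM !Lp_nrmE; apply: cLnorm_le_ae => //;
  exact: Lp_cmeasurable.
Qed.

Lemma Lp_lin (a : R[i]) u v :
  {ae mu, forall x, repr (a *: u + v) x = a * repr u x + repr v x}.
Proof.
have : \pi_Lp (repr (a *: u + v)) = \pi_Lp (a *: repr u + repr v).
  by rewrite reprK Lp_piD -[X in X + _]/(Lp_scale a u) reprK.
by move/Lp_piP; apply: filterS => x ->.
Qed.

Lemma Lp_sub u v : {ae mu, forall x, repr (u - v) x = repr u x - repr v x}.
Proof.
have := Lp_lin (-1) v u; apply: filterS => x.
by rewrite scaleN1r addrC => ->; rewrite mulN1r addrC.
Qed.

Lemma Lp_of f : cmeasurable f -> (cLnorm f < +oo)%E ->
  exists u, {ae mu, forall x, repr u x = f x}.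
Proof.
move=> mf ff; have fP : f \in cLfun_pred mu p1 by apply/asboolP.
exists (\pi_Lp (CLfun fP)).
have /Lp_piP : \pi_Lp (repr (\pi_Lp (CLfun fP))) = \pi_Lp (CLfun fP) by rewrite reprK.
by apply: filterS => x ->.
Qed.

Lemma Lp_ae_inj u v : {ae mu, forall x, repr u x = repr v x} -> u = v.
Proof. by move/Lp_piP; rewrite !reprK. Qed.

Lemma powR_seq_cvg (u : nat -> R) (a : R) : (forall n, 0 <= u n) ->
  u n @[n --> \oo] --> a -> (u n `^ p) @[n --> \oo] --> a `^ p.
Proof.
move=> u0 ua; have : 0 <= a 
  by rewrite -(cvg_lim _ ua)//; apply: limr_ge; [exact: cvgP ua|exact: nearW].
rewrite le_eqVlt => /orP[/eqP a0|a0]; last first.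
  apply: (@cvg_comp _ _ _ u (fun x => x `^ p)); first exact: ua.
  have : {for a, continuous (fun x : R => x `^ p)}; last exact.
  apply: differentiable_continuous; apply/derivable1_diffP.
  by apply: derivable_powR; rewrite in_itv/= a0.
rewrite -a0 powR0 ?gt_eqF ?(lt_le_trans _ p1)//; rewrite -a0 in ua.
apply: (@squeeze_cvgr _ _ _ _ (fun=> 0) u) => //; last exact: cvg_cst.
have /cvgrPdist_lt/(_ 1 ltr01) := ua; apply: filterS => n.
rewrite sub0r normrN ger0_norm// => un.
rewrite powR_ge0/=; have := u0 n; rewrite le_eqVlt => /orP[/eqP<-|un0].
  by rewrite powR0// gt_eqF// (lt_le_trans _ p1).
by rewrite -[leRHS]powRr1// ger_powR// un0 ltW.
Qed.

(** Fatou's lemma, as the integrands converge pointwise. Convergence is asked for everywhere; the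
    exceptional null set is removed beforehand by a cutoff. *)
Lemma fatou_cLnorm (h : nat -> Omega -> R[i]) l (e : R) N : 0 <= e ->
  (forall n, cmeasurable (h n)) ->
  (forall x (r : R), 0 < r -> exists M, forall n, (M <= n)%N -> normc (h n x - l x) < r) ->
  (forall n, (N <= n)%N -> (cLnorm (h n) <= e%:E)%E) -> (cLnorm l <= e%:E)%E.
Proof.
move=> e0 mh hl he; apply/cLnorm_leP => //.
have E x : (normc (l x) `^ p)%:E = limn_einf (fun n => (normc (h n x) `^ p)%:E).
  apply/esym; apply: (cvg_limn_einf_sup _).1.
  apply: cvg_EFin; first exact: nearW.
  apply: powR_seq_cvg => [n|]; first exact: normc_ge0.
  apply/cvgrPdist_lt => r /(hl x)[M hM]; exists M => // n /hM.
  by apply: le_lt_trans; rewrite distrC normcB.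
under eq_integral do rewrite E.
apply: le_trans (fatou _ _ _ _) _ => //.
- by move=> n; exact: measurable_normcX.
- by move=> n x _; rewrite lee_fin powR_ge0.
rewrite limn_einf_lim; apply: lime_le; first exact: is_cvg_einfs.
apply: nearW => n; apply: ereal_inf_le.
exists (\int[mu]_x (normc (h (maxn n N) x) `^ p)%:E)%E.
  by exists (maxn n N) => //=; exact: leq_maxl.
by apply/cLnorm_leP => //; apply: he; exact: leq_maxr.
Qed.

Lemma geometric_cauchy (g : nat -> R[i]) (S : R) : 0 <= S ->
  (forall k, 2 ^+ k * normc (g k.+1 - g k) <= S) ->
  forall e : R, 0 < e -> exists N, forall m n, (N <= m)%N -> (N <= n)%N ->
    normc (g m - g n) < e.
Proof.
move=> S0 gS e e0.
(* The bound is the sum of S / 2^i over k <= i < k + j. *)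
have step k j : normc (g (k + j)%N - g k) <= 2 * S / 2 ^+ k - 2 * S / 2 ^+ (k + j).
  elim: j => [|j IH]; first by rewrite addn0 !subrr Normc.normc0.
  have -> : g (k + j.+1)%N - g k = (g (k + j).+1 - g (k + j)%N) + (g (k + j)%N - g k).
    by rewrite addnS addrA subrK.
  apply: le_trans (le_normcD _ _) _.
  have := gS (k + j)%N; rewrite addnS exprS; move: IH.
  have : 0 < 2 ^+ (k + j) :> R by rewrite exprn_gt0.
  have : 0 < 2 ^+ k :> R by rewrite exprn_gt0.
  move: (normc _) (normc _) (2 ^+ k) (2 ^+ (k + j)) => a b x y x0 y0 h1 h2.
  have h3 : a <= S / y by rewrite ler_pdivlMr// mulrC.
  have -> : 2 * S / (2 * y) = S / y by field; rewrite gt_eqF.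
  have h4 : 2 * S / y = S / y + S / y by field; rewrite gt_eqF.
  by move: h1 h3; rewrite h4; move: (2 * S / x) (S / y) => X Y; lra.
have pow : exists N, 2 * S / 2 ^+ N < e / 2.
  exists (Num.truncn (4 * S / e)).+1.
  rewrite ltr_pdivrMr ?exprn_gt0//.
  have h1 : 4 * S / e < (Num.truncn (4 * S / e)).+1%:R by exact: truncnS_gt.
  have h2 : (Num.truncn (4 * S / e)).+1%:R < 2 ^+ (Num.truncn (4 * S / e)).+1 :> R.
    by rewrite -natrX ltr_nat ltn_expl.
  have := lt_trans h1 h2; move: (2 ^+ _) => y; rewrite ltr_pdivrMr//; lra.
have [N Ne] := pow; exists N => m n Nm Nn.
have near k : (N <= k)%N -> normc (g k - g N) < e / 2.
  move=> Nk; have := step N (k - N)%N; rewrite subnKC// => h.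
  apply: le_lt_trans h (le_lt_trans _ Ne).
  by rewrite gerBl divr_ge0 ?mulr_ge0// exprn_ge0.
have -> : g m - g n = (g m - g N) - (g n - g N) by ring.
rewrite (le_lt_trans (le_normcD _ _))// [e]splitr normcN.
by apply: ltrD; exact: near.
Qed.

(* The integral of [\sum_k (2^k |g_(k+1) - g_k|)^p] is finite, which makes
   [g_k] a.e. geometrically Cauchy without the triangle inequality for infinite
   sums in L^p. *)
Lemma fast_cauchy_ae (g : nat -> Omega -> R[i]) : (forall k, cmeasurable (g k)) ->
  (forall k, (cLnorm (g k.+1 - g k)%R <= (2 ^- k * 2 ^- k.+1)%:E)%E) ->
  exists E : set Omega, [/\ measurable E, {ae mu, forall x, E x} &
    forall x, E x -> exists2 S : R, 0 <= S &
      forall k, 2 ^+ k * normc (g k.+1 x - g k x) <= S].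
Proof.
move=> mg gk; have p0 : 0 < p by rewrite (lt_le_trans _ p1).
pose b k x := (normc (((2 ^+ k)%:C *: (g k.+1 - g k) : Omega -> R[i]) x) `^ p)%:E.
have md k : cmeasurable ((2 ^+ k)%:C *: (g k.+1 - g k) : Omega -> R[i]).
  apply: cmeasurableZ; rewrite -scaleN1r; apply: cmeasurableD => //.
  exact: cmeasurableZ.
have mb k : measurable_fun setT (b k) by exact: measurable_normcX.
have b0 k x : (0 <= b k x)%E by rewrite lee_fin powR_ge0.
pose G x := (\sum_(k <oo) b k x)%E.
have mG : measurable_fun setT G by exact: ge0_emeasurable_sum.
have G0 x : (0 <= G x)%E by exact: nneseries_ge0.
(* The factor 2^k in [b] cancels the first factor of the hypothesis, and (2^(-k-1))^p <= 2^(-k-1)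
   because p >= 1; the integrals therefore sum to at most 1. *)
have intb k : (\int[mu]_x b k x <= (1 / (2 ^ k.+1)%:R)%:E)%E.
  have e0 : 0 <= 2 ^- k.+1 :> R by rewrite invr_ge0 exprn_ge0.
  apply: (@le_trans _ _ (((2 ^- k.+1) `^ p)%:E)%E).
    apply/cLnorm_leP => //; rewrite cLnormZ//; last first.
      rewrite -scaleN1r; apply: cmeasurableD => //; exact: cmeasurableZ.
    rewrite normc_real ger0_norm ?exprn_ge0//.
    apply: le_trans (lee_wpmul2l _ (gk k)) _; first by rewrite lee_fin exprn_ge0.
    by rewrite -EFinM lee_fin mulrA mulfV ?mul1r// gt_eqF// exprn_gt0.
  rewrite lee_fin div1r natrX -[leRHS]powRr1// ger_powR// invr_gt0 exprn_gt0//=.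
  by rewrite invf_le1 ?exprn_gt0// exprn_ege1// ler1n.
have intG : (\int[mu]_x G x <= 1%:E)%E.
  rewrite integral_nneseries//.
  apply: le_trans (epsilon_trick0 xpredT ler01).
  by apply: lee_nneseries => [k _ _|k _]; [exact: integral_ge0|exact: intb].
exists [set x | G x \is a fin_num]; split.
- by rewrite -[X in measurable X]setTI; exact: emeasurable_fin_num.
- have : mu.-integrable setT G.
    apply/integrableP; split => //.
    by under eq_integral do rewrite gee0_abs//; exact: le_lt_trans intG (ltry _).
  by move/(integrable_ae measurableT); apply: filterS => x /(_ I).
move=> x /= Gx; exists (fine (G x) `^ p^-1); first exact: powR_ge0.
move=> k; have : (b k x <= G x)%E.
  apply: le_trans (nneseries_lim_ge k.+1 _) => //.
  rewrite big_nat_recr//= -[leLHS]add0e leeD2r// sume_ge0//.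
rewrite -{1}(fineK Gx) lee_fin.
rewrite (_ : _ x = (2 ^+ k)%:C * (g k.+1 x - g k x))//.
rewrite Normc.normcM normc_real ger0_norm ?exprn_ge0//.
set w := 2 ^+ k * _ => h; have w0 : 0 <= w by rewrite mulr_ge0 ?normc_ge0 ?exprn_ge0.
rewrite -(powRr1 w0) -(@mulfV _ p) ?gt_eqF// powRrM.
by rewrite ge0_ler_powR ?nnegrE ?invr_ge0 ?powR_ge0 ?fine_ge0 ?(ltW p0).
Qed.

Lemma cmeasurable_cutoff (E : set Omega) f : measurable E -> cmeasurable f ->
  cmeasurable (fun x => if x \in E then f x else 0).
Proof.
move=> mE [mr mi]; split.
  rewrite (_ : (fun _ => _) = fun x => complex.Re (f x) * \1_E x).
    by apply: measurable_funM => //; exact: measurable_indic.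
  by apply/funext => x; rewrite indicE; case: ifP => _; rewrite ?mulr1 ?mulr0.
rewrite (_ : (fun _ => _) = fun x => complex.Im (f x) * \1_E x).
  by apply: measurable_funM => //; exact: measurable_indic.
by apply/funext => x; rewrite indicE; case: ifP => _; rewrite ?mulr1 ?mulr0.
Qed.

Lemma cmeasurable_limit (h : nat -> Omega -> R[i]) l : (forall n, cmeasurable (h n)) ->
  (forall x (r : R), 0 < r -> exists M, forall n, (M <= n)%N -> normc (h n x - l x) < r) ->
  cmeasurable l.
Proof.
move=> mh hl; split.
  apply: (measurable_fun_cvg (h := fun n x => complex.Re (h n x))).
    by move=> n; have [] := mh n.
  move=> x _; apply/cvgrPdist_lt => r /(hl x)[M hM]; exists M => // n /hM.
  by apply: le_lt_trans; rewrite distrC -ReB normc_ge_absRe.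
apply: (measurable_fun_cvg (h := fun n x => complex.Im (h n x))).
  by move=> n; have [] := mh n.
move=> x _; apply/cvgrPdist_lt => r /(hl x)[M hM]; exists M => // n /hM.
by apply: le_lt_trans; rewrite distrC -ImB normc_ge_absIm.
Qed.

Lemma cLnorm_ae_eq f g : cmeasurable f -> cmeasurable g ->
  {ae mu, forall x, f x = g x} -> cLnorm f = cLnorm g.
Proof.
move=> mf mg fg; apply/eqP; rewrite eq_le.
have := cLnorm_le_ae mf mg ler01; have := cLnorm_le_ae mg mf ler01.
rewrite !mul1e => h1 h2; rewrite h1 ?h2//.
  by apply: filterS fg => x ->; rewrite mul1r.
by apply: filterS fg => x ->; rewrite mul1r.
Qed.

Lemma cmeasurableB f g : cmeasurable f -> cmeasurable g -> cmeasurable (f - g).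
Proof.
by move=> mf mg; rewrite -scaleN1r; apply: cmeasurableD => //; exact: cmeasurableZ.
Qed.

(** Typed as a plain function, so that differences are formed pointwise and not in [cLfun]. *)
Definition Lp_fun u : Omega -> R[i] := repr u.

Lemma Lp_nrmB u v : (nrm (u - v))%:E = cLnorm (Lp_fun u - Lp_fun v).
Proof.
rewrite Lp_nrmE; apply: cLnorm_ae_eq; first exact: Lp_cmeasurable.
  by apply: cmeasurableB; exact: Lp_cmeasurable.
exact: Lp_sub.
Qed.

Lemma Lp_complete : seq_complete Lp.
Proof.
move=> u cu.
have /choice[N NP] : forall k, exists N, forall m n, (N <= m)%N -> (N <= n)%N ->
    nrm (u m - u n) < 2 ^- k * 2 ^- k.+1.
  by move=> k; apply: cu; rewrite mulr_gt0// invr_gt0 exprn_gt0.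
(* Nondecreasing, at least N k, and at least k, so that it tends to infinity. *)
pose M k := (\sum_(i < k.+1) (N i + i))%N.
have NM k : (N k + k <= M k)%N by rewrite /M big_ord_recr/= leq_addl.
have MS k : (M k <= M k.+1)%N by rewrite {2}/M big_ord_recr/= leq_addr.
pose g k := Lp_fun (u (M k)).
have mg k : cmeasurable (g k) by exact: Lp_cmeasurable.
have gk k : (cLnorm (g k.+1 - g k)%R <= (2 ^- k * 2 ^- k.+1)%:E)%E.
  rewrite -Lp_nrmB lee_fin ltW// NP//.
    exact: leq_trans (leq_addr _ _) (leq_trans (NM k) (MS k)).
  exact: leq_trans (leq_addr _ _) (NM k).
have [E [mE aeE EP]] := fast_cauchy_ae mg gk.
(* Off [E] the sequence is constantly 0, so it converges at every point. *)
pose h k x := if x \in E then g k x else 0.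
have mh k : cmeasurable (h k) by exact: cmeasurable_cutoff.
have /choice[l lP] : forall x, exists l : R[i], forall e : R, 0 < e ->
    exists N, forall n, (N <= n)%N -> normc (h n x - l) < e.
  move=> x; apply: complex_seq_cauchy; rewrite /h.
  have [xE|_ e e0] := boolP (x \in E); last first.
    by exists 0%N => m n _ _; rewrite subrr Normc.normc0.
  by have [S S0 SP] := EP _ (set_mem xE); exact: geometric_cauchy S0 SP.
have ml : cmeasurable l := cmeasurable_limit mh lP.
have close (e : R) : 0 < e -> exists K, forall n, (K <= n)%N ->
    (cLnorm (Lp_fun (u n) - l)%R <= e%:E)%E.
  move=> e0; have [K KP] := cu e e0; exists K => n Kn.
  apply: (@fatou_cLnorm (fun k => Lp_fun (u n) - h k)%R _ e K (ltW e0)).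
  - by move=> k; apply: cmeasurableB => //; exact: Lp_cmeasurable.
  - move=> x r /(lP x)[L hL]; exists L => k /hL.
    by rewrite -normcN; congr (normc _ < _); rewrite !fctE; ring.
  move=> k Kk; rewrite (@cLnorm_ae_eq _ (Lp_fun (u n) - Lp_fun (u (M k)))).
  - rewrite -Lp_nrmB lee_fin ltW// KP//; apply: leq_trans Kk _.
    exact: leq_trans (leq_addl _ _) (NM k).
  - by apply: cmeasurableB => //; exact: Lp_cmeasurable.
  - by apply: cmeasurableB => //; exact: Lp_cmeasurable.
  by apply: filterS aeE => x Ex; rewrite /= !fctE /h mem_set.
(* The limit l lies in L^p as the difference of some u K and of u K - l, which has finite norm by
   [close]. *)
have [||v vl] := @Lp_of l => //.
  have [K /(_ K (leqnn _)) hK] := close 1 ltr01.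
  have mK : cmeasurable (Lp_fun (u K) - l) by apply: cmeasurableB => //; exact: Lp_cmeasurable.
  have -> : l = Lp_fun (u K) - (Lp_fun (u K) - l) by apply/funext => x; rewrite !fctE; ring.
  have : (cLnorm (- (Lp_fun (u K) - l))%R < +oo)%E.
    by rewrite -scaleN1r cLnormZ// normcN Normc.normc1 mul1e; exact: le_lt_trans hK (ltry _).
  move=> hN; apply: le_lt_trans (cLnormD _ _ _ _) _ => //.
  - exact: Lp_cmeasurable.
  - by rewrite -scaleN1r; exact: cmeasurableZ.
  by rewrite -Lp_nrmE lte_add_pinfty// ltry.
exists v => e e0; have e2 : 0 < e / 2 by rewrite divr_gt0.
have [K hK] := close _ e2; exists K => n /hK h1.
apply: (@le_lt_trans _ _ (e / 2)); last by rewrite ltr_pdivrMr// ltr_pMr// ltrDl.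
rewrite -lee_fin Lp_nrmB (@cLnorm_ae_eq _ (Lp_fun (u n) - l))//.
- by apply: cmeasurableB; exact: Lp_cmeasurable.
- by apply: cmeasurableB => //; exact: Lp_cmeasurable.
by apply: filterS vl => x e'; rewrite !fctE /Lp_fun e'.
Qed.

End LpSpace.

(** * Multiplication operators on L^p *)

Section LpMultiplication.
Context d (Omega : measurableType d) (R : realType).
Variables (mu : {measure set Omega -> \bar R}) (p : R) (p1 : 1 <= p).
Local Notation Lp := (Lp mu p1).
Local Notation cLnorm := (cLnorm mu p).
Implicit Types (f g phi : Omega -> R[i]) (u v : Lp).

Lemma cmeasurable_cst (z : R[i]) : cmeasurable (fun _ : Omega => z).
Proof. by split; exact: measurable_cst. Qed.

Lemma cmeasurable_div f g : cmeasurable f -> cmeasurable g ->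
  cmeasurable (fun x => f x / g x).
Proof.
move=> [fr fi] mg; have [gr gi] := mg.
have mV : measurable_fun [set: Omega] (fun x => (normc (g x) ^+ 2)^-1).
  rewrite (_ : (fun _ => _) = fun x => (normc (g x) ^+ 2) `^ (-1)).
    apply: (@measurableT_comp _ _ _ _ _ _ (fun r : R => r `^ (-1))) => //.
    by apply: measurable_funX; exact: measurable_normc.
  by apply/funext => x; rewrite powR_inv1// sqr_ge0.
have E x : f x / g x =
  ((complex.Re (f x) * complex.Re (g x) + complex.Im (f x) * complex.Im (g x))
     * (normc (g x) ^+ 2)^-1) +i*
  ((complex.Im (f x) * complex.Re (g x) - complex.Re (f x) * complex.Im (g x))
     * (normc (g x) ^+ 2)^-1).
  rewrite normc_sqr; case: (f x) => a b; case: (g x) => a' b'.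
  by apply/eqP; rewrite eq_complex /=; apply/andP; split; apply/eqP; ring.
split.
  rewrite (_ : (fun _ => _) = fun x => (complex.Re (f x) * complex.Re (g x) +
    complex.Im (f x) * complex.Im (g x)) * (normc (g x) ^+ 2)^-1).
    by apply: measurable_funM => //; apply: measurable_funD; exact: measurable_funM.
  by apply/funext => x; rewrite E.
rewrite (_ : (fun _ => _) = fun x => (complex.Im (f x) * complex.Re (g x) -
  complex.Re (f x) * complex.Im (g x)) * (normc (g x) ^+ 2)^-1).
  by apply: measurable_funM => //; apply: measurable_funB; exact: measurable_funM.
by apply/funext => x; rewrite E.
Qed.

Lemma measurable_lt_set (f g : Omega -> R) : measurable_fun [set: Omega] f ->
  measurable_fun [set: Omega] g -> measurable [set x | f x < g x].
Proof.
move=> mf mg; have := measurable_fun_ltr mf mg measurableT (Y := [set true]) I.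
by rewrite setTI.
Qed.

Lemma measurable_cball f (z : R[i]) (r : R) : cmeasurable f ->
  measurable [set x | normc (f x - z) < r].
Proof.
move=> mf; apply: measurable_lt_set; last exact: measurable_cst.
apply: (@measurable_normc _ _ _ (f - (fun=> z))).
by apply: cmeasurableB => //; exact: cmeasurable_cst.
Qed.

Lemma rat_approx (a e : R) : 0 < e -> exists q : rat, `|a - ratr q| < e.
Proof.
move=> e0; have [|q] := @rat_in_itvoo _ (a - e) a; first by rewrite ltrBlDr ltrDl.
rewrite in_itv/= => /andP[h1 h2]; exists q.
by rewrite ltr_distlC; apply/andP; split; lra.
Qed.

(* Each point outside the essential range lies in a null ball with rational
   centre and radius. *)
Lemma ae_ess_range phi : cmeasurable phi -> {ae mu, forall x, ess_range mu phi (phi x)}.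
Proof.
move=> mphi.
pose ball (t : rat * rat * nat) := [set x | normc (phi x -
  (ratr t.1.1 +i* ratr t.1.2)) < t.2.+1%:R^-1].
pose F n := if unpickle n is Some t then
  (if mu (ball t) == 0%E then ball t else set0) else set0.
apply: (@negligibleS _ _ _ mu (\bigcup_n F n)); last first.
  apply: negligible_bigcup => n; rewrite /F; case: unpickle => [t|]; last first.
    exact: negligible_set0.
  case: eqP => [t0|_]; last exact: negligible_set0.
  by apply/negligibleP => //; exact: measurable_cball.
move=> x /= /existsNP[e /not_implyP[e0 /negP]]; rewrite lt0e measure_ge0 andbT negbK => /eqP B0.
have [|k] := @ltr_add_invr R 0 (e / 2); first by rewrite divr_gt0.
rewrite add0r => ke; set r : R := k.+1%:R^-1 in ke.
have r0 : 0 < r by rewrite invr_gt0.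
have r2 : 0 < r / 2 by rewrite divr_gt0.
have [a ha] := rat_approx (complex.Re (phi x)) r2.
have [b hb] := rat_approx (complex.Im (phi x)) r2.
have xr : normc (phi x - (ratr a +i* ratr b)) < r.
  by rewrite (le_lt_trans (normc_le_add _))// ReB ImB [r]splitr ltrD.
have [n nabk] : exists n, unpickle n = Some (a, b, k).
  by exists (pickle (a, b, k)); exact: pickleK.
exists n => //; rewrite /F nabk.
have sub : ball (a, b, k) `<=` [set y | normc (phi y - phi x) < e].
  move=> y; rewrite /ball/= -/r => yr.
  have -> : phi y - phi x = (phi y - (ratr a +i* ratr b)) - (phi x - (ratr a +i* ratr b)).
    by ring.
  rewrite (le_lt_trans (le_normcD _ _))// normcN.
  by move: xr yr ke; move: (normc _) (normc _) => s t; clear; lra.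
rewrite (subset_measure0 _ _ sub B0) ?eqxx//; exact: measurable_cball.
Qed.

Lemma Lp_indic (E : set Omega) : measurable E -> (mu E < +oo)%E ->
  exists u, {ae mu, forall x, repr u x = (\1_E x : R)%:C}.
Proof.
move=> mE Eoo; apply: Lp_of.
  by split; [exact: measurable_indic|exact: measurable_cst].
rewrite cLnormE; apply: poweR_lty.
under eq_integral => x _.
  rewrite (_ : normc _ `^ p = \1_E x); last first.
    rewrite normc_real ger0_norm// indicE; case: (x \in E); first by rewrite powR1.
    by rewrite powR0// gt_eqF// (lt_le_trans _ p1).
  over.
by rewrite integral_indic// setIT.
Qed.

Lemma Re_oppM (t : R) (z : R[i]) : complex.Re (- (t%:C * z)) = - (t * complex.Re z).
Proof. by case: z => a b /=; rewrite mul0r subr0. Qed.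

(* Testing the bound on the indicator of a set of finite measure where the
   multiplier exceeds twice the bound forces that set to be null. *)
Lemma Lp_multiplier_bound phi (t C : R) (F : set Omega) : cmeasurable phi ->
  {ae mu, forall x, 0 < complex.Re (phi x)} -> 0 < C ->
  measurable F -> (mu F < +oo)%E ->
  op_bound (op_mul (Lp_mult (mu := mu) (p1 := p1) (fun x => cexp (- (t%:C * phi x))))
     (op_inv (op_shift 1%R (Lp_mult (mu := mu) (p1 := p1) phi)))) C ->
  {ae mu, forall x, F x ->
     normc (cexp (- (t%:C * phi x))) <= 2 * C * normc (1 + phi x)}.
Proof.
move=> mphi phi0 C0 mF Foo [ex le].
pose E := F `&` [set x | 2 * C * normc (1 + phi x) < normc (cexp (- (t%:C * phi x)))].
have mE : measurable E.
  apply: measurableI => //; apply: measurable_lt_set.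
    apply: measurable_funM; first exact: measurable_cst.
    apply: (@measurable_normc _ _ _ ((fun=> 1) + phi)).
    by apply: cmeasurableD => //; exact: cmeasurable_cst.
  under eq_fun do rewrite normc_cexp Re_oppM.
  apply: measurableT_comp => //; apply: measurable_funN.
  by apply: measurable_funM => //; have [] := mphi.
have [|h hE] := @Lp_indic E mE.
  by apply: le_lt_trans Foo; apply: le_measure; rewrite ?inE//; exact: subIsetl.
have [y [By _]] := ex h; have := le h y By; rewrite !nrmE -rmorphM lecR => yh.
case: By => g + yg; rewrite /op_inv /op_shift scale1r => gh.
have hy : {ae mu, forall x, normc (repr h x) <= (2 * C)^-1 * normc (repr y x)}.
  have FF : Filter (nbhs (almost_everywhere mu)) := ae_filter_ringOfSetsType mu.
  have e1 := @filterI _ _ FF _ _ hE (Lp_sub h g); have e2 := @filterI _ _ FF _ _ gh yg.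
  apply: filterS3 e1 e2 phi0 => x [hx sx] [gx yx] x0; rewrite hx.
  have [xE|xE] := boolP (x \in E); last first.
    rewrite indicE (negbTE xE) normc_real normr0 mulr_ge0 ?normc_ge0//.
    by rewrite invr_ge0 mulr_ge0// ltW.
  have [_ Ex] := set_mem xE.
  have nz : 0 < normc (1 + phi x).
    rewrite normc_gt0; apply/eqP => /(congr1 (@complex.Re R)); rewrite ReD /=; lra.
  move: gx; rewrite sx hx indicE xE => /eqP; rewrite subr_eq => /eqP gx.
  rewrite normc_real normr1 ler_pdivlMl ?mulr_gt0// mulr1.
  rewrite -(ler_pM2r nz) -Normc.normcM.
  have -> : repr y x * (1 + phi x) = cexp (- (t%:C * phi x)); last exact: (ltW Ex).
  by rewrite yx -mulrA mulrDr mulr1 [repr g x * _]mulrC addrC -gx mulr1.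
(* Pointwise 2 C |h| <= |y|, whereas the operator bound says |y| <= C |h| in norm. *)
have h0 : nrm h = 0.
  apply/eqP; rewrite eq_le nrm_ge0 andbT.
  have := Lp_nrm_le (_ : 0 <= (2 * C)^-1) hy.
  rewrite invr_ge0 mulr_ge0 ?(ltW C0)// => /(_ isT); rewrite ler_pdivlMl ?mulr_gt0//.
  have := nrm_ge0 h; move: (nrm h) (nrm y) yh => a b; nra.
have : cLnorm (repr h) = 0%E by rewrite -Lp_nrmE h0.
move/(cLnorm_eq0 p1 (Lp_cmeasurable h)) => h00.
apply: filterS2 h00 hE => x -> e Fx; rewrite leNgt; apply/negP => lt.
have : x \in E by apply/mem_set; split.
by move: e; rewrite indicE => e xE; move: e; rewrite xE => -[/eqP]; rewrite eq_sym oner_eq0.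
Qed.

(** [Lp_multiplier_bound] is applied on each set of a countable cover by sets of finite measure and
    for each integer time, so the exceptional null sets are countably many. *)
Lemma Lp_mult_region phi (beta : R) : sigma_finite [set: Omega] mu ->
  cmeasurable phi -> {ae mu, forall x, 0 < complex.Re (phi x)} -> 0 < beta ->
  decay (fun t => Lp_mult (mu := mu) (p1 := p1) (fun x => cexp (- (t%:C * phi x))))
    (Lp_mult (mu := mu) (p1 := p1) phi) beta ->
  exists2 c : R, 0 < c & {ae mu, forall x, 0 < complex.Re (phi x) /\
    c <= complex.Re (phi x) * (1 + normc (phi x)) `^ beta}.
Proof.
move=> [F FT FP] mphi phi0 b0 /decay_op_bound[K [t1 [K0 t10 KP]]].
have K20 : 0 < 2 * K by rewrite mulr_gt0.
have [c c0 cP] := decay_region t1 K20 b0.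
exists c => //.
have bound : {ae mu, forall x, forall t i : nat, (0 < t)%N -> t1 <= t%:R -> F i x ->
    normc (cexp (- (t%:R%:C * phi x))) <= 2 * K * t%:R `^ (- beta^-1) * normc (1 + phi x)}.
  apply: ae_foralln => t; apply: ae_foralln => i.
  have [t0|] := ltnP 0 t; last by move=> h; apply: nearW.
  have [t1t|] := leP t1 t%:R; last by move=> h; apply: nearW.
  have [mF Foo] := FP i.
  have C0 : 0 < K * t%:R `^ (- beta^-1) by rewrite mulr_gt0// powR_gt0// ltr0n.
  have := Lp_multiplier_bound mphi phi0 C0 mF Foo (KP _ t1t).
  by apply: filterS => x h _ _ Fx; rewrite -[2 * K * _]mulrA; exact: h.
apply: filterS2 phi0 bound => x x0 xb; split => //; apply: cP => // t t0 t1t.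
have : [set: Omega] x by []; rewrite FT => -[i _ Fx]; exact: xb Fx.
Qed.

Lemma Lp_mult_cayley phi (beta : R) : sigma_finite [set: Omega] mu ->
  cmeasurable phi -> ess_range mu phi `<=` Cplus R -> 0 < beta ->
  decay (fun t => Lp_mult (mu := mu) (p1 := p1) (fun x => cexp (- (t%:C * phi x))))
    (Lp_mult (mu := mu) (p1 := p1) phi) beta ->
  cayley_estimate (Lp_mult (mu := mu) (p1 := p1) phi) beta.
Proof.
move=> sf mphi er b0 dec.
have phi0 : {ae mu, forall x, 0 < complex.Re (phi x)}.
  by apply: filterS (ae_ess_range mphi) => x /er.
have [c c0 cP] := Lp_mult_region sf mphi phi0 b0 dec.
apply: (@multiplication_cayley_estimate R Lp Omega (@Lp_fun _ _ _ mu p p1)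
  (almost_everywhere mu) phi _ _ beta c) => //.
- exact: Lp_complete.
- exact: Lp_ae_inj.
- exact: Lp_lin.
- exact: Lp_nrm_le.
(* Almost everywhere |phi + l| >= e, so division by phi + l maps L^p to itself. *)
move=> l u l0; have [e e0 eP] := region_lower_bound c0 b0.
have mq : cmeasurable (fun x => Lp_fun u x / (phi x + l%:C)).
  apply: cmeasurable_div; first exact: Lp_cmeasurable.
  by apply: (@cmeasurableD _ _ _ phi (fun=> l%:C)) => //; exact: cmeasurable_cst.
apply: Lp_of => //.
apply: (@le_lt_trans _ _ ((e^-1)%:E * cLnorm (Lp_fun u))%E); last first.
  by rewrite -Lp_nrmE -EFinM ltry.
apply: cLnorm_le_ae => //; [exact: Lp_cmeasurable|by rewrite invr_ge0 ltW|].
apply: filterS cP => x [x0 xc].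
have [_ h] := normc_shift_ge x0 l0.
have el : e <= normc (phi x + l%:C).
  apply: le_trans h; apply: le_trans (eP _ x0 xc).
  by rewrite ler_peMr ?(ltW e0)// lerDl normc_ge0.
rewrite Normc.normcM Normc.normcV mulrC ler_wpM2r ?normc_ge0//.
by rewrite lef_pV2// posrE (lt_le_trans e0).
Qed.

End LpMultiplication.

Theorem proposition3p7 (R : realType) :
  (forall (H : completeNormedModType R[i]) (ip : {dot H for @Num.conj R[i]})
      (T : R -> H -> H) (A : graph H) (beta : R),
      induces_norm ip ->
      bounded_C0_semigroup T ->
      generator T = op_opp A ->
      normal_op ip A ->
      0 < beta ->
      decay (fun t => op_fun (T t)) A beta ->
    cayley_estimate A beta)
  /\
  (forall (Omega : ptopologicalType)
      (mu : {measure set (borel Omega) -> \bar R})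
      (p : R) (p1 : 1 <= p) (phi : Omega -> R[i]) (beta : R),
      hausdorff_space Omega ->
      locally_compact [set: Omega] ->
      sigma_finite [set: borel Omega] mu ->
      regular_measure mu ->
      cmeasurable (phi : borel Omega -> R[i]) ->
      ess_range mu phi `<=` Cplus R ->
      0 < beta ->
      decay (fun t => Lp_mult (mu := mu) (p1 := p1)
                        (fun x => cexp (- (t%:C * phi x))))
            (Lp_mult (mu := mu) (p1 := p1) phi) beta ->
    cayley_estimate (Lp_mult (mu := mu) (p1 := p1) phi) beta)
  /\
  (forall (Omega : topologicalType) (phi : Omega -> R[i]) (beta : R),
      hausdorff_space Omega ->
      locally_compact [set: Omega] ->
      continuous (phi : Omega -> R[i]^o) ->
      range phi `<=` Cplus R ->
      0 < beta ->
      decay (fun t => C0_mult (fun x => cexp (- (t%:C * phi x))))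
            (C0_mult phi) beta ->
    cayley_estimate (C0_mult phi) beta).
Proof.
split; [|split].
- move=> H ip T A beta ipn T_sg T_gen A_normal b0 dec.
  exact: (normal_cayley_estimate ipn T_sg T_gen A_normal b0 dec).
- move=> Omega mu p p1 phi beta _ _ sf _ mphi er b0 dec.
  exact: Lp_mult_cayley.
- move=> Omega phi beta haus lc cphi phi0 b0 dec.
  exact: C0_mult_cayley.
Qed.
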